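(* Let $\mathbb{F}$ be an algebraically closed field of characteristic $\neq 2$. There are infinitely many (pairwise non-isomorphic) five-dimensional nilpotent Jordan algebras over $\mathbb{F}$, and every nilpotent non-associative Jordan algebra of dimension five over $\mathbb{F}$ is isomorphic to one of the following algebras (each with basis $a,b,c,d,e$; only the non-zero products of basis elements are listed, up to commutativity): - $J_{5,1}: a^{2}=b,\ b\circ c=d.$ - $J_{5,2}: a\circ b=c,\ a\circ c=d.$ - $J_{5,3}: a\circ b=c,\ a\circ c=d,\ b^{2}=d.$ - $J_{5,4}: a\circ b=c,\ a\circ c=d,\ b\circ c=d.$ - $J_{5,5}: a^{2}=b,\ d^{2}=e,\ b\circ c=e.$ - $J_{5,6}: a^{2}=b,\ a\circ d=e,\ b\circ c=e.$ - $J_{5,7}: a\circ b=c,\ c\circ d=e.$ - $J_{5,8}: a\circ b=c,\ c\circ d=e,\ a^{2}=e.$ - $J_{5,9}: a\circ b=c,\ c\circ d=e,\ a^{2}=e,\ b^{2}=e.$ - $J_{5,10}: a\circ b=c,\ a\circ c=e,\ d^{2}=e,\ b\circ c=e.$ - $J_{5,11}: a\circ b=c,\ a\circ c=e,\ d^{2}=e.$ - $J_{5,12}: a\circ b=c,\ a\circ c=e,\ d^{2}=e,\ b^{2}=e.$ - $J_{5,13}: a\circ b=c,\ a\circ c=e,\ a\circ d=e,\ b\circ c=e.$ - $J_{5,14}: a\circ b=c,\ a\circ c=e,\ b\circ d=e.$ - $J_{5,15}^{\alpha}$ ($\alpha\in\mathbb{F}$): $a^{2}=b,\ a\circ b=c,\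 a\circ c=e,\ b^{2}=e,\ b\circ d=e,\ d^{2}=\alpha e.$ - $J_{5,16}: a\circ b=d,\ c^{2}=d,\ a\circ d=e.$ - $J_{5,17}: a\circ b=d,\ c^{2}=d,\ a\circ d=e,\ b\circ c=e.$ - $J_{5,18}: a\circ b=d,\ c^{2}=d,\ a\circ d=e,\ b^{2}=e.$ - $J_{5,19}: a\circ b=d,\ c^{2}=d,\ c\circ d=e.$ - $J_{5,20}: a\circ b=d,\ c^{2}=d,\ c\circ d=e,\ a^{2}=e.$ - $J_{5,21}: a\circ b=d,\ c^{2}=d,\ c\circ d=e,\ a^{2}=e,\ b^{2}=e.$ - $J_{5,22}: a^{2}=b,\ a\circ b=d,\ c^{2}=d,\ b^{2}=e,\ a\circ d=e.$ - $J_{5,23}^{\alpha}$ ($\alpha\in\mathbb{F}$): $a^{2}=c,\ a\circ b=d,\ a\circ c=e,\ b\circ d=e,\ b\circ c=\alpha e.$ - $J_{5,24}^{\alpha}$ ($\alpha\in\mathbb{F}\setminus\{0,1\}$): $a^{2}=c,\ a\circ b=d,\ b\circ c=e,\ a\circ d=\alpha e.$ - $J_{5,25}: a^{2}=c,\ a\circ b=d,\ a\circ c=e,\ b\circ c=-2e,\ a\circ d=e.$ - $J_{5,26}^{\alpha}$ ($\alpha\in\mathbb{F}\setminus\{0\}$): $a^{2}=c,\ b^{2}=d,\ a\circ c=e,\ a\circ d=e,\ b\circ d=\alpha e.$ - $J_{5,27}^{\alpha,\beta}$ ($\alpha,\beta\in\mathbb{F}$, $\alpha\beta\neq 1$): $a^{2}=c,\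 b^{2}=d,\ b\circ c=e,\ a\circ d=e,\ b\circ d=\alpha e,\ a\circ c=\beta e.$ - $J_{5,28}: a^{2}=b,\ b\circ c=d,\ c^{2}=e.$ - $J_{5,29}: a^{2}=b,\ b\circ c=d,\ a\circ c=e.$ - $J_{5,30}: a^{2}=b,\ b\circ c=d,\ a\circ c=e,\ c^{2}=e.$ - $J_{5,31}: a^{2}=b,\ b\circ c=d,\ a\circ b=e.$ - $J_{5,32}: a^{2}=b,\ b\circ c=d,\ a\circ b=e,\ a\circ c=e.$ - $J_{5,33}: a^{2}=b,\ b\circ c=d,\ a\circ b=e,\ c^{2}=e.$ - $J_{5,34}: a\circ b=c,\ a\circ c=d,\ a^{2}=e.$ - $J_{5,35}: a\circ b=c,\ a\circ c=d,\ b^{2}=e.$ - $J_{5,36}: a\circ b=c,\ a\circ c=d,\ b\circ c=e.$ - $J_{5,37}: a\circ b=c,\ a\circ c=d,\ a^{2}=e,\ b^{2}=e.$ - $J_{5,38}: a\circ b=c,\ a\circ c=d,\ a^{2}=e,\ b\circ c=e.$ - $J_{5,39}: a\circ b=c,\ b^{2}=d,\ a\circ c=d,\ a^{2}=e.$ - $J_{5,40}: a\circ b=c,\ b^{2}=d,\ a\circ c=d,\ a^{2}=e,\ b\circ c=e.$ - $J_{5,41}^{\alpha}$ ($\alpha\in\mathbb{F}$): $a\circ b=c,\ a\circ c=d,\ b\circ c=d,\ a^{2}=e,\ b^{2}=\alpha e.$ - $M_{5,1}: a^{2}=b,\ a\circ b=d+e,\ c^{2}=d,\ b^{2}=e,\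 a\circ d=e.$ - $M_{5,2}: a^{2}=b,\ b\circ c=d,\ a\circ b=e,\ a\circ c=e,\ c^{2}=e.$ Among these algebras there are precisely the following isomorphisms (that is, two algebras of the list with different names or different parameters are isomorphic only when one of the following items says so): - $J_{5,23}^{\alpha}\cong J_{5,23}^{\beta}$ if and only if $\alpha^{2}-\beta^{2}=0$. - $J_{5,26}^{\alpha}\cong J_{5,26}^{\beta}$ if and only if $\alpha^{2}-\beta^{2}=0$. - $J_{5,27}^{\alpha,\beta}\cong J_{5,27}^{\alpha',\beta'}$ if and only if $(\alpha,\beta)=(\alpha',\beta')$ or $(\alpha,\beta)=(\beta',\alpha')$. - $J_{5,41}^{\alpha}\cong J_{5,41}^{\beta}$ if and only if $\beta(\alpha^{2}+1)=\alpha(\beta^{2}+1)$. - $M_{5,1}\cong J_{5,22}$ if and only if the characteristic of $\mathbb{F}$ is $\neq 3$. - $M_{5,2}\cong J_{5,33}$ if and only if the characteristic of $\mathbb{F}$ is $\neq 3$.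
   Context: A Jordan algebra over a field $\mathbb{F}$ is a commutative (not necessarily associative) $\mathbb{F}$-algebra $J$ with multiplication $\circ$ satisfying $x^{2}\circ(x\circ y)=x\circ(x^{2}\circ y)$ for all $x,y\in J$, where $x^2=x\circ x$. Put $J^{\langle 1\rangle}=J$ and $J^{\langle n\rangle}=J^{\langle n-1\rangle}\circ J$ (linear span of products); $J$ is nilpotent if $J^{\langle n\rangle}=0$ for some $n$. ''Non-associative'' means ''not associative''. Multiplication tables list only non-zero products of basis elements (a coefficient depending on a parameter may vanish); all other products, except those obtained by commutativity, are zero. *)

(* Defs.v *)
From HB Require Import structures.
From mathcomp Require Import all_boot all_order all_algebra.
From mathcomp Require Import sesquilinear ring.

Set Implicit Arguments.
Unset Strict Implicit.
Unset Printing Implicit Defensive.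

Import GRing.Theory.
Local Open Scope ring_scope.

Record algebra (F : fieldType) := Algebra {
  carrier :> vectType F;
  mulj : {bilinear carrier -> carrier -> carrier}
}.

Definition is_jordan (F : fieldType) (J : algebra F) : Prop :=
  commutative (mulj J) /\
  forall x y : J, mulj J (mulj J x x) (mulj J x y) =
                  mulj J x (mulj J (mulj J x x) y).

Definition is_assoc (F : fieldType) (J : algebra F) : Prop :=
  associative (mulj J).

(* The linear span of the products of U by V, as [prodv] in falgebra (which
   is only available for associative unital algebras); see [prodjP]. *)
Definition prodj (F : fieldType) (J : algebra F) (U V : {vspace J}) :
    {vspace J} :=
  <<[seq mulj J u v | u <- vbasis U, v <- vbasis V]>>%VS.

Lemma memv_prodj (F : fieldType) (J : algebra F) (U V : {vspace J}) :
  {in U & V, forall u v, mulj J u v \in prodj U V}.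
Proof.
move=> u v /coord_vbasis-> /coord_vbasis->.
rewrite linear_sumr; apply: memv_suml => j _.
rewrite linearZr_LR linear_sumlz; apply/memvZ/memv_suml => i _.
rewrite linearZl_LR; apply/memvZ/memv_span/allpairsP.
by exists ((vbasis U)`_i, (vbasis V)`_j); rewrite !memt_nth.
Qed.

Lemma prodjP (F : fieldType) (J : algebra F) (U V W : {vspace J}) :
  reflect {in U & V, forall u v, mulj J u v \in W} (prodj U V <= W)%VS.
Proof.
apply: (iffP idP) => [sUVW u v Uu Vv | sUVW].
  by rewrite (subvP sUVW) ?memv_prodj.
apply/span_subvP=> _ /allpairsP[[u v] /= [Uu Vv ->]].
by rewrite sUVW ?vbasis_mem.
Qed.

(* J^<n> for n >= 1; the junk value at n = 0 is J^<1> = J. *)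
Definition powj (F : fieldType) (J : algebra F) (n : nat) : {vspace J} :=
  iter n.-1 (fun U => prodj U fullv) fullv.

Definition is_nilpotent (F : fieldType) (J : algebra F) : Prop :=
  exists n, powj J n = 0%VS.

Definition isomorphic (F : fieldType) (J K : algebra F) : Prop :=
  exists2 f : {linear J -> K},
    bijective f & {morph f : x y / mulj J x y >-> mulj K x y}.

(* A multiplication table on F^5 lists triples (i, j, w), read as
   e_i o e_j = w; an unordered pair {i, j} occurs at most once, and all
   products not listed vanish up to commutativity. *)
Definition table (F : fieldType) := seq ('I_5 * 'I_5 * 'rV[F]_5).

Definition table_coef (F : fieldType) (i j : 'I_5) (x y : 'rV[F]_5) : F :=
  if i == j then x 0 i * y 0 i else x 0 i * y 0 j + x 0 j * y 0 i.

Definition table_mul (F : fieldType) (t : table F) (x y : 'rV[F]_5) :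
    'rV[F]_5 :=
  \sum_(r <- t) table_coef r.1.1 r.1.2 x y *: r.2.

Lemma table_mul_is_bilinear (F : fieldType) (t : table F) :
  bilinear_for *:%R *:%R (@table_mul F t).
Proof.
split=> [y k x1 x2 | x k y1 y2] /=; rewrite /table_mul scaler_sumr -big_split /=;
  apply: eq_bigr => r _; rewrite scalerA -scalerDl /table_coef; congr (_ *: _);
  by case: ifP => _; rewrite !mxE; ring.
Qed.

HB.instance Definition _ (F : fieldType) (t : table F) :=
  bilinear_isBilinear.Build F 'rV[F]_5 'rV[F]_5 'rV[F]_5 *:%R *:%R
    (table_mul t) (table_mul_is_bilinear t).

Definition table_algebra (F : fieldType) (t : table F) : algebra F :=
  @Algebra F 'rV[F]_5 (table_mul t).

Inductive name (F : Type) :=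
| J5_1 | J5_2 | J5_3 | J5_4 | J5_5 | J5_6 | J5_7 | J5_8 | J5_9 | J5_10
| J5_11 | J5_12 | J5_13 | J5_14 | J5_15 of F | J5_16 | J5_17 | J5_18 | J5_19
| J5_20 | J5_21 | J5_22 | J5_23 of F | J5_24 of F | J5_25 | J5_26 of F
| J5_27 of F & F | J5_28 | J5_29 | J5_30 | J5_31 | J5_32 | J5_33 | J5_34
| J5_35 | J5_36 | J5_37 | J5_38 | J5_39 | J5_40 | J5_41 of F | M5_1 | M5_2.

Definition admissible (F : fieldType) (l : name F) : Prop :=
  match l with
  | J5_24 alpha => alpha <> 0 /\ alpha <> 1
  | J5_26 alpha => alpha <> 0
  | J5_27 alpha beta => alpha * beta <> 1
  | _ => True
  end.

Section Tables.

Variable F : fieldType.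

Local Notation ia := (@Ordinal 5 0 isT).
Local Notation ib := (@Ordinal 5 1 isT).
Local Notation ic := (@Ordinal 5 2 isT).
Local Notation id := (@Ordinal 5 3 isT).
Local Notation ie := (@Ordinal 5 4 isT).

Local Notation b := (delta_mx 0 ib : 'rV[F]_5).
Local Notation c := (delta_mx 0 ic : 'rV[F]_5).
Local Notation d := (delta_mx 0 id : 'rV[F]_5).
Local Notation e := (delta_mx 0 ie : 'rV[F]_5).

Local Notation aa := (ia, ia).
Local Notation ab := (ia, ib).
Local Notation ac := (ia, ic).
Local Notation ad := (ia, id).
Local Notation bb := (ib, ib).
Local Notation bc := (ib, ic).
Local Notation bd := (ib, id).
Local Notation cc := (ic, ic).
Local Notation cd := (ic, id).
Local Notation dd := (id, id).

Definition table_of (l : name F) : table F :=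
  match l with
  | J5_1 => [:: (aa, b); (bc, d)]
  | J5_2 => [:: (ab, c); (ac, d)]
  | J5_3 => [:: (ab, c); (ac, d); (bb, d)]
  | J5_4 => [:: (ab, c); (ac, d); (bc, d)]
  | J5_5 => [:: (aa, b); (dd, e); (bc, e)]
  | J5_6 => [:: (aa, b); (ad, e); (bc, e)]
  | J5_7 => [:: (ab, c); (cd, e)]
  | J5_8 => [:: (ab, c); (cd, e); (aa, e)]
  | J5_9 => [:: (ab, c); (cd, e); (aa, e); (bb, e)]
  | J5_10 => [:: (ab, c); (ac, e); (dd, e); (bc, e)]
  | J5_11 => [:: (ab, c); (ac, e); (dd, e)]
  | J5_12 => [:: (ab, c); (ac, e); (dd, e); (bb, e)]
  | J5_13 => [:: (ab, c); (ac, e); (ad, e); (bc, e)]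
  | J5_14 => [:: (ab, c); (ac, e); (bd, e)]
  | J5_15 alpha =>
      [:: (aa, b); (ab, c); (ac, e); (bb, e); (bd, e); (dd, alpha *: e)]
  | J5_16 => [:: (ab, d); (cc, d); (ad, e)]
  | J5_17 => [:: (ab, d); (cc, d); (ad, e); (bc, e)]
  | J5_18 => [:: (ab, d); (cc, d); (ad, e); (bb, e)]
  | J5_19 => [:: (ab, d); (cc, d); (cd, e)]
  | J5_20 => [:: (ab, d); (cc, d); (cd, e); (aa, e)]
  | J5_21 => [:: (ab, d); (cc, d); (cd, e); (aa, e); (bb, e)]
  | J5_22 => [:: (aa, b); (ab, d); (cc, d); (bb, e); (ad, e)]
  | J5_23 alpha => [:: (aa, c); (ab, d); (ac, e); (bd, e); (bc, alpha *: e)]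
  | J5_24 alpha => [:: (aa, c); (ab, d); (bc, e); (ad, alpha *: e)]
  | J5_25 => [:: (aa, c); (ab, d); (ac, e); (bc, (- 2) *: e); (ad, e)]
  | J5_26 alpha => [:: (aa, c); (bb, d); (ac, e); (ad, e); (bd, alpha *: e)]
  | J5_27 alpha beta =>
      [:: (aa, c); (bb, d); (bc, e); (ad, e); (bd, alpha *: e);
          (ac, beta *: e)]
  | J5_28 => [:: (aa, b); (bc, d); (cc, e)]
  | J5_29 => [:: (aa, b); (bc, d); (ac, e)]
  | J5_30 => [:: (aa, b); (bc, d); (ac, e); (cc, e)]
  | J5_31 => [:: (aa, b); (bc, d); (ab, e)]
  | J5_32 => [:: (aa, b); (bc, d); (ab, e); (ac, e)]
  | J5_33 => [:: (aa, b); (bc, d); (ab, e); (cc, e)]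
  | J5_34 => [:: (ab, c); (ac, d); (aa, e)]
  | J5_35 => [:: (ab, c); (ac, d); (bb, e)]
  | J5_36 => [:: (ab, c); (ac, d); (bc, e)]
  | J5_37 => [:: (ab, c); (ac, d); (aa, e); (bb, e)]
  | J5_38 => [:: (ab, c); (ac, d); (aa, e); (bc, e)]
  | J5_39 => [:: (ab, c); (bb, d); (ac, d); (aa, e)]
  | J5_40 => [:: (ab, c); (bb, d); (ac, d); (aa, e); (bc, e)]
  | J5_41 alpha => [:: (ab, c); (ac, d); (bc, d); (aa, e); (bb, alpha *: e)]
  | M5_1 => [:: (aa, b); (ab, d + e); (cc, d); (bb, e); (ad, e)]
  | M5_2 => [:: (aa, b); (bc, d); (ab, e); (ac, e); (cc, e)]
  end.

End Tables.

Definition listed (F : fieldType) (l : name F) : algebra F :=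
  table_algebra (table_of l).

Definition same_class (F : fieldType) (l m : name F) : Prop :=
  match l, m with
  | J5_23 alpha, J5_23 beta => alpha ^+ 2 - beta ^+ 2 = 0
  | J5_26 alpha, J5_26 beta => alpha ^+ 2 - beta ^+ 2 = 0
  | J5_27 alpha beta, J5_27 alpha' beta' =>
      (alpha, beta) = (alpha', beta') \/ (alpha, beta) = (beta', alpha')
  | J5_41 alpha, J5_41 beta =>
      beta * (alpha ^+ 2 + 1) = alpha * (beta ^+ 2 + 1)
  | M5_1, J5_22 | J5_22, M5_1 => 3%N \notin [pchar F]
  | M5_2, J5_33 | J5_33, M5_2 => 3%N \notin [pchar F]
  | _, _ => l = m
  end.

(* Main.v *)
Require Import Defs.
From HB Require Import structures.
From mathcomp Require Import all_boot all_order all_algebra.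
From mathcomp Require Import sesquilinear ring.

Set Implicit Arguments.
Unset Strict Implicit.
Unset Printing Implicit Defensive.

Import GRing.Theory.
Local Open Scope ring_scope.

(* The filtration of J by J, J^<2>, J^<3>, J^<4> is the backbone.  If J^<3> = 0
   then J is associative; if dim J^<2> = 4 then J is generated by one element
   and is associative too.  There remain the dimensions (2, 1, 0), (3, 1, 0),
   (3, 2, 0) and (3, 2, 1) of J^<2>, J^<3>, J^<4>.  In a basis adapted to the
   filtration such an algebra is given by the squaring map of J / J^<2> and by
   the products of J with J^<2>, subject to the Jordan identity, which makes
   J^<2> o J^<2> vanish except when dim J^<4> = 1.  An isomorphism respects the
   filtration, so that it amounts to an action of triangular matrices on these
   coefficients; the normal forms of this action are the listed algebras, and
   they are separated by the polynomial relations between the coefficients.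
   Characteristic 3 plays a role only when dim J^<3> = 2, where some change of
   basis has to divide by 3. *)

(** * Symbolic multiplication tables *)

(** The obstacle is size: an isomorphism has 25 unknown entries and 75 coordinate equations. So
    vectors are lists of [coef], an entry shown to vanish becomes [C0] before the next equation is
    computed, and what survives is a short relation for each type: [relA], [relB1], [relB2], [relX],
    [relY], [relC2]. Each relation yields an isomorphism and, as long as the products that make the
    algebra reach the assumed J^<3> do not vanish, is implied by one (for [relB2] and [relY] up to
    exchanging the two generators). It therefore serves twice: solving it for a given table produces
    the normal form, and the polynomial conditions it preserves keep normal forms apart, the
    families with parameters being compared by solving it outright. Algebraic closedness enters
    through square roots, through one cube root (for [J5_40]) and through the infinity of the field.
    Division by 2 is everywhere: in the linearised Jordan identity, in polarisation, and in
    completing squares. *)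

(* Coefficients that are visibly 0 or 1 are kept apart from field elements, so
   that evaluating a table product yields short polynomial expressions. *)
Inductive coef (F : Type) := C0 | C1 | CE of F.
Arguments C0 {F}.
Arguments C1 {F}.

Section Symbolic.

Variable F : fieldType.

Implicit Types (c d : coef F) (v w : seq (coef F)) (g : seq (seq (coef F))).

Definition ev c : F := match c with C0 => 0 | C1 => 1 | CE x => x end.

Definition cadd c d : coef F :=
  match c, d with C0, _ => d | _, C0 => c | _, _ => CE (ev c + ev d) end.

Definition cmul c d : coef F :=
  match c, d with
  | C0, _ | _, C0 => C0
  | C1, _ => d
  | _, C1 => c
  | CE x, CE y => CE (x * y)
  end.

Definition copp c : coef F :=
  match c with C0 => C0 | C1 => CE (- 1) | CE x => CE (- x) end.

Lemma ev_add c d : ev (cadd c d) = ev c + ev d.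
Proof. by case: c => [||x]; case: d => [||y] //=; rewrite ?add0r ?addr0. Qed.

Lemma ev_mul c d : ev (cmul c d) = ev c * ev d.
Proof.
by case: c => [||x]; case: d => [||y] //=;
  rewrite ?mul0r ?mulr0 ?mul1r ?mulr1.
Qed.

Lemma ev_opp c : ev (copp c) = - ev c.
Proof. by case: c => [||x] //=; rewrite oppr0. Qed.

Definition vev v : 'rV[F]_5 := \row_k ev (nth C0 v k).

Fixpoint vadd v w : seq (coef F) :=
  match v, w with
  | [::], _ => w
  | _, [::] => v
  | c :: v', d :: w' => cadd c d :: vadd v' w'
  end.

Definition vscale c v : seq (coef F) :=
  match c with C0 => [::] | _ => map (cmul c) v end.

Lemma nth_vadd v w k : ev (nth C0 (vadd v w) k) = ev (nth C0 v k) + ev (nth C0 w k).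
Proof.
elim: v w k => [|c v IHv] [|d w] [|k] //=; rewrite ?add0r ?addr0 ?ev_add //.
Qed.

Lemma nth_vscale c v k : ev (nth C0 (vscale c v) k) = ev c * ev (nth C0 v k).
Proof.
rewrite -ev_mul; case: c => [||x]; first by rewrite /= nth_nil.
  by elim: v k => [|d v IHv] [|k] //=; apply: IHv.
by elim: v k => [|d v IHv] [|k] //=; apply: IHv.
Qed.

Lemma vev_add v w : vev (vadd v w) = vev v + vev w.
Proof. by apply/rowP=> k; rewrite !mxE nth_vadd. Qed.

Lemma vev_scale c v : vev (vscale c v) = ev c *: vev v.
Proof. by apply/rowP=> k; rewrite !mxE nth_vscale. Qed.

Lemma vev_nil : vev [::] = 0.
Proof. by apply/rowP=> k; rewrite !mxE nth_nil. Qed.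

Definition stable := seq ('I_5 * 'I_5 * seq (coef F)).

Definition den (s : stable) : table F := [seq (r.1, vev r.2) | r <- s].

Definition talg (s : stable) : algebra F := table_algebra (den s).

(** [eqn] in place of [==] lets [cbv] decide the comparison of literal indices. *)
Definition tcoef (i j : nat) v w : coef F :=
  if eqn i j then cmul (nth C0 v i) (nth C0 w i)
  else cadd (cmul (nth C0 v i) (nth C0 w j)) (cmul (nth C0 v j) (nth C0 w i)).

Fixpoint vmul (s : stable) v w : seq (coef F) :=
  match s with
  | [::] => [::]
  | (i, j, u) :: s' => vadd (vscale (tcoef i j v w) u) (vmul s' v w)
  end.

Lemma mulj_talg s v w : mulj (talg s) (vev v) (vev w) = vev (vmul s v w).
Proof.
change (table_mul (den s) (vev v) (vev w) = vev (vmul s v w)).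
rewrite /table_mul big_map; elim: s => [|[[i j] u] s IHs] /=.
  by rewrite big_nil vev_nil.
rewrite big_cons IHs vev_add vev_scale /=; congr (_ *: _ + _).
rewrite /table_coef /tcoef !mxE.
have -> : eqn i j = (i == j) by [].
by case: ifP => _; rewrite ?ev_add !ev_mul // addrC mulrC [X in _ + X]mulrC addrC
  [ev (nth C0 w j) * _]mulrC [ev (nth C0 w i) * _]mulrC.
Qed.

Lemma talg_comm s : commutative (mulj (talg s)).
Proof.
move=> x y; change (table_mul (den s) x y = table_mul (den s) y x).
apply: eq_bigr => r _; congr (_ *: _); rewrite /table_coef.
by case: ifP => _; rewrite ?(mulrC (x _ _)) // addrC !(mulrC (y _ _)).
Qed.

(* The pairs of field elements that have to agree for two symbolic vectors to
   have the same value; pairs that visibly agree are dropped. *)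
Definition ceqs c d : seq (F * F) :=
  match c, d with C0, C0 | C1, C1 => [::] | _, _ => [:: (ev c, ev d)] end.

Definition ixs : seq nat := [:: 0; 1; 2; 3; 4]%N.

Definition veqs v w : seq (F * F) :=
  flatten (map (fun k => ceqs (nth C0 v k) (nth C0 w k)) ixs).

(** A one-element list gives the bare equation without a trailing [True], so that an unfolded
    hypothesis can be used or substituted at once. *)
Fixpoint allp (l : seq (F * F)) : Prop :=
  match l with
  | [::] => True
  | [:: p] => p.1 = p.2
  | p :: l' => p.1 = p.2 /\ allp l'
  end.

Lemma allp_cons p l : allp (p :: l) <-> p.1 = p.2 /\ allp l.
Proof. by case: l => [|q l] //=; split=> // -[]. Qed.

Lemma allp_cat l1 l2 : allp (l1 ++ l2) <-> allp l1 /\ allp l2.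
Proof.
elim: l1 => [|p l1 IHl] /=; first by split=> // -[].
have := allp_cons p (l1 ++ l2); have := allp_cons p l1; rewrite /=; tauto.
Qed.

Lemma allp_flatten (T : eqType) (f : T -> seq (F * F)) (l : seq T) :
  allp (flatten (map f l)) <-> {in l, forall x, allp (f x)}.
Proof.
elim: l => [|x l IHl] /=; first by split.
rewrite allp_cat IHl; split=> [[fx fl] y | fl].
  by rewrite inE => /orP[/eqP-> // | /fl].
by split=> [|y yl]; apply: fl; rewrite inE ?eqxx // yl orbT.
Qed.

Lemma ceqsP c d : allp (ceqs c d) <-> ev c = ev d.
Proof. by case: c => [||x]; case: d => [||y]. Qed.

Lemma mem_ixs (i : 'I_5) : val i \in ixs.
Proof. by case: i => [[|[|[|[|[|?]]]]] ?]. Qed.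

Lemma ixsP (P : nat -> Prop) : {in ixs, forall k, P k} <-> forall i : 'I_5, P i.
Proof.
split=> [H i | H k]; first by apply: H; apply: mem_ixs.
rewrite !inE => k5; have {}k5 : (k < 5)%N by case/or4P: k5 => [||/eqP->|/orP[]/eqP->] // /eqP->.
exact: (H (Ordinal k5)).
Qed.

Lemma veqsP v w : allp (veqs v w) <-> vev v = vev w.
Proof.
rewrite /veqs allp_flatten ixsP; split=> [vw | /rowP vw i].
  by apply/rowP=> i; rewrite !mxE; apply/ceqsP.
by apply/ceqsP; have := vw i; rewrite !mxE.
Qed.

Definition units : seq (seq (coef F)) :=
  [:: [:: C1]; [:: C0; C1]; [:: C0; C0; C1]; [:: C0; C0; C0; C1];
      [:: C0; C0; C0; C0; C1]].

Lemma vev_units (i : 'I_5) : vev (nth [::] units i) = delta_mx 0 i.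
Proof.
apply/rowP=> k; rewrite !mxE eqxx /=.
by case: i k => [[|[|[|[|[|?]]]]] ?] // [[|[|[|[|[|?]]]]] ?].
Qed.

Lemma vev_surj (x : 'rV[F]_5) :
  x = vev [:: CE (x 0 (@Ordinal 5 0 isT)); CE (x 0 (@Ordinal 5 1 isT));
              CE (x 0 (@Ordinal 5 2 isT)); CE (x 0 (@Ordinal 5 3 isT));
              CE (x 0 (@Ordinal 5 4 isT))].
Proof.
apply/rowP=> k; rewrite !mxE.
by case: k => [[|[|[|[|[|?]]]]] ?] //=; congr (x _ _); apply: val_inj.
Qed.

Fixpoint vlin v g : seq (coef F) :=
  match v, g with
  | c :: v', r :: g' => vadd (vscale c r) (vlin v' g')
  | _, _ => [::]
  end.

Definition gmx n g : 'M[F]_n := \matrix_(i, j) ev (nth C0 (nth [::] g i) j).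

Lemma vev_lin v g : size g = 5%N -> vev (vlin v g) = vev v *m gmx 5 g.
Proof.
move=> g5; rewrite mulmx_sum_row.
transitivity (\sum_(i < size g) ev (nth C0 v i) *: vev (nth [::] g i)).
  elim: g v {g5} => [|r g IHg] [|c v] /=; rewrite ?big_ord0 ?vev_nil //.
    by rewrite big1 // => i _; rewrite nth_nil scale0r.
  by rewrite big_ord_recl vev_add vev_scale IHg.
rewrite g5; apply: eq_bigr => i _; rewrite !mxE; congr (_ *: _).
by apply/rowP=> k; rewrite !mxE.
Qed.

(** Laplace expansion along the first column; on the nearly triangular matrices that occur, the [C0]
    entries leave only a few products. *)
Fixpoint sdet n g : coef F :=
  if n is n'.+1 then
    foldr (fun i acc =>
             cadd (cmul (nth C0 (nth [::] g i) 0%N)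
                        (let m := sdet n' (map behead (take i g ++ drop i.+1 g)) in
                         if odd i then copp m else m)) acc) C0 (iota 0%N n)
  else C1.

Lemma sdetE n g : size g = n -> \det (gmx n g) = ev (sdet n g).
Proof.
elim: n g => [|n IHn] g gn; first by rewrite det_mx00.
rewrite (expand_det_col _ ord0) [sdet _ _]/sdet -/sdet.
transitivity (\sum_(i <- iota 0%N n.+1)
   ev (cmul (nth C0 (nth [::] g i) 0%N)
                        (let m := sdet n (map behead (take i g ++ drop i.+1 g)) in
                         if odd i then copp m else m))).
  rewrite -[iota 0%N n.+1]/(index_iota 0%N n.+1) big_mkord; apply: eq_bigr => i _.
  rewrite ev_mul mxE /cofactor addn0; congr (_ * _).
  have -> (c : coef F) : ev (if odd i then copp c else c) = (-1) ^+ i * ev c.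
    by rewrite -signr_odd; case: ifP => _; rewrite ?ev_opp ?mulN1r ?mul1r.
  congr (_ * _); rewrite -IHn; last first.
    rewrite size_map size_cat size_take size_drop gn ltn_ord subSS.
    by rewrite subnKC // -ltnS.
  congr (\det _); apply/matrixP=> k l; rewrite !mxE.
  have -> : nth [::] (map behead (take i g ++ drop i.+1 g)) k =
            behead (nth [::] g (lift i k)).
    rewrite (nth_map [::]); last first.
      rewrite size_cat size_take size_drop gn ltn_ord subSS.
      by rewrite subnKC // -ltnS.
    congr behead; rewrite nth_cat size_take gn ltn_ord /= /bump.
    case: ltnP => [ki|ik]; first by rewrite nth_take.
    by rewrite nth_drop add1n addSn subnKC.
  by rewrite nth_behead.
elim: (iota _ _) => [|i l IHl]; first by rewrite big_nil.
by rewrite big_cons IHl -ev_add.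
Qed.

(** Vectors are rows and matrices act on the right: row [i] of [g] is the image of the [i]-th basis
    vector. *)
Definition is_iso (s s' : stable) g : Prop :=
  [/\ size g = 5%N, \det (gmx 5 g) != 0 &
      forall x y, mulj (talg s) x y *m gmx 5 g =
                  mulj (talg s') (x *m gmx 5 g) (y *m gmx 5 g)].

Lemma bilinear_eq (V : lmodType F) (b1 b2 : 'rV[F]_5 -> 'rV[F]_5 -> V) :
    bilinear_for *:%R *:%R b1 -> bilinear_for *:%R *:%R b2 ->
    (forall i j, b1 (delta_mx 0 i) (delta_mx 0 j) = b2 (delta_mx 0 i) (delta_mx 0 j)) ->
  forall x y, b1 x y = b2 x y.
Proof.
move=> [l1 r1] [l2 r2] b12 x y.
have lin0 (f : 'rV[F]_5 -> V) : (forall (k : F) (x1 x2 : 'rV[F]_5), f (k *: x1 + x2) = k *: f x1 + f x2) ->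
    forall z, f z = \sum_i z 0 i *: f (delta_mx 0 i).
  move=> lf z; pose g : {linear 'rV[F]_5 -> V} :=
    HB.pack f (GRing.isLinear.Build F _ _ _ f lf).
  rewrite -[f]/(g : _ -> _) {1}[z]row_sum_delta linear_sum.
  by apply: eq_bigr => i _; rewrite linearZ.
rewrite (lin0 (b1 x)) => [|k u v]; last exact: r1.
rewrite (lin0 (b2 x)) => [|k u v]; last exact: r2.
apply: eq_bigr => j _; congr (_ *: _).
rewrite (lin0 (b1^~ _)) => [|k u v]; last exact: l1.
rewrite (lin0 (b2^~ _)) => [|k u v]; last exact: l2.
by apply: eq_bigr => i _; rewrite b12.
Qed.

Definition ixpairs : seq (nat * nat) :=
  [:: (0, 0); (0, 1); (0, 2); (0, 3); (0, 4); (1, 1); (1, 2); (1, 3); (1, 4);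
      (2, 2); (2, 3); (2, 4); (3, 3); (3, 4); (4, 4)]%N.

Lemma ixpairsP (P : nat * nat -> Prop) :
  {in ixpairs, forall p, P p} <-> forall i j : 'I_5, (i <= j)%N -> P (val i, val j).
Proof.
split=> [H i j ij | H p].
  apply: H; case: i j ij => [[|[|[|[|[|?]]]]] ?] // [[|[|[|[|[|?]]]]] ?] //.
rewrite !inE; do 14 (case/orP=> [/eqP->|];
  first match goal with |- P (?i, ?j) =>
    exact (H (@Ordinal 5 i isT) (@Ordinal 5 j isT) isT) end).
by move/eqP->; exact: (H (@Ordinal 5 4 isT) (@Ordinal 5 4 isT) isT).
Qed.

Definition iso_eqs (s s' : stable) g : seq (F * F) :=
  flatten (map (fun p =>
       veqs (vmul s' (nth [::] g p.1) (nth [::] g p.2))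
            (vlin (vmul s (nth [::] units p.1) (nth [::] units p.2)) g)) ixpairs).

Lemma delta_gmx g i : delta_mx 0 i *m gmx 5 g = vev (nth [::] g i) :> 'rV[F]_5.
Proof. by rewrite -rowE; apply/rowP=> k; rewrite !mxE. Qed.

Lemma iso_eqsP s s' g : size g = 5%N ->
  allp (iso_eqs s s' g) <->
  forall x y, mulj (talg s) x y *m gmx 5 g =
              mulj (talg s') (x *m gmx 5 g) (y *m gmx 5 g).
Proof.
move=> g5.
have E (i j : nat) (ij : 'I_5 * 'I_5) : i = ij.1 -> j = ij.2 ->
    allp (veqs (vmul s' (nth [::] g i) (nth [::] g j))
            (vlin (vmul s (nth [::] units i) (nth [::] units j)) g)) <->
    mulj (talg s) (delta_mx 0 ij.1) (delta_mx 0 ij.2) *m gmx 5 g =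
    mulj (talg s') (delta_mx 0 ij.1 *m gmx 5 g) (delta_mx 0 ij.2 *m gmx 5 g).
  move=> -> ->; rewrite veqsP -mulj_talg vev_lin // -mulj_talg !vev_units !delta_gmx.
  by split.
split=> [H | H].
  have [l r] := table_mul_is_bilinear (den s).
  have [l' r'] := table_mul_is_bilinear (den s').
  apply: bilinear_eq.
  - split=> [y|x] k x1 x2 /=; [rewrite [X in X *m _](l y k x1 x2)
                              | rewrite [X in X *m _](r x k x1 x2)];
    by rewrite mulmxDl -scalemxAl.
  - split=> [y|x] k x1 x2 /=; rewrite mulmxDl -scalemxAl; [exact: l' | exact: r'].
  move=> i j; wlog ij : i j / (i <= j)%N.
    move=> W; case: (leqP i j) => [|/ltnW] /W // ji.
    by rewrite talg_comm ji talg_comm.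
  move: H; rewrite /iso_eqs allp_flatten ixpairsP => /(_ i j ij).
  by move/(E _ _ (i, j) erefl erefl).
rewrite /iso_eqs allp_flatten ixpairsP => i j _.
exact/(E _ _ (i, j) erefl erefl)/H.
Qed.

Lemma is_isoP s s' g : size g = 5%N ->
  is_iso s s' g <-> allp (iso_eqs s s' g) /\ ev (sdet 5 g) <> 0.
Proof.
move=> g5; rewrite iso_eqsP //; split=> [[_ dg ?]|[? dg]].
  by split=> //; apply/eqP; rewrite -sdetE.
by split=> //; rewrite sdetE //; apply/eqP.
Qed.

(* Rewriting a matrix with vanishing entries into one with visible zeros. *)
Lemma is_iso_ev s s' g g' :
  map (map ev) g = map (map ev) g' -> is_iso s s' g -> is_iso s s' g'.
Proof.
move=> gg' [g5 dg Hg].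
have nthE h i j : ev (nth C0 (nth [::] h i) j) = nth 0 (nth [::] (map (map ev) h) i) j.
  elim: h i j => [|r h IHh] [|i] j //=; rewrite ?nth_nil //.
  by elim: r j => [|c r IHr] [|j] /=.
have E : gmx 5 g = gmx 5 g' by apply/matrixP=> i j; rewrite !mxE !nthE gg'.
rewrite E in dg Hg; split=> //; rewrite -g5.
by rewrite -(size_map (map ev) g) gg' size_map.
Qed.

Lemma is_iso_isomorphic s s' g : is_iso s s' g -> isomorphic (talg s) (talg s').
Proof.
case=> _ dg Hg.
have ug : gmx 5 g \in unitmx by rewrite unitmxE unitfE.
exists (mulmxr (gmx 5 g) : {linear talg s -> talg s'}); last exact: Hg.
by exists (mulmx^~ (invmx (gmx 5 g))) => x /=; rewrite ?mulmxK ?mulmxKV.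
Qed.

(** All explicit isomorphisms pass through here: a concrete matrix leaves polynomial equations and a
    determinant. *)
Lemma iso_check s s' g : size g = 5%N ->
  allp (iso_eqs s s' g) /\ ev (sdet 5 g) <> 0 -> isomorphic (talg s) (talg s').
Proof. by move=> g5 /is_isoP-/(_ g5)/is_iso_isomorphic. Qed.

(** Conversely, the analysis of a given isomorphism starts here, with all 25 entries unknown. *)
Lemma iso_coords s s' : isomorphic (talg s) (talg s') ->
  exists a : nat -> nat -> F,
    is_iso s s' [:: [:: CE (a 0 0); CE (a 0 1); CE (a 0 2); CE (a 0 3); CE (a 0 4)];
                    [:: CE (a 1 0); CE (a 1 1); CE (a 1 2); CE (a 1 3); CE (a 1 4)];
                    [:: CE (a 2 0); CE (a 2 1); CE (a 2 2); CE (a 2 3); CE (a 2 4)];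
                    [:: CE (a 3 0); CE (a 3 1); CE (a 3 2); CE (a 3 3); CE (a 3 4)];
                    [:: CE (a 4 0); CE (a 4 1); CE (a 4 2); CE (a 4 3); CE (a 4 4)]]%N.
Proof.
case=> f bij_f morf; pose A := lin1_mx (f : 'rV[F]_5 -> 'rV[F]_5).
have fA x : f x = x *m A by rewrite mul_rV_lin1.
exists (fun i j => A (inord i) (inord j)).
set g := [:: _; _; _; _; _].
have gA : gmx 5 g = A.
  apply/matrixP=> i j; rewrite mxE -{2}(inord_val i) -{2}(inord_val j).
  by case: i => [[|[|[|[|[|?]]]]] ?] //; case: j => [[|[|[|[|[|?]]]]] ?].
split=> //; last by move=> x y; rewrite gA -!fA.
case: bij_f => h hf fh; rewrite gA -unitfE -unitmxE.
suff /mulmx1_unit[] : (\matrix_i (h (delta_mx 0 i) : 'rV[F]_5)) *m A = 1%:M by [].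
apply/row_matrixP=> i; rewrite row_mul rowK -fA.
by apply: etrans (fh _) _; rewrite rowE mulmx1.
Qed.

Definition assoc_eqs (s : stable) : seq (F * F) :=
  flatten (map (fun i => flatten (map (fun j => flatten (map (fun k =>
     let u n := nth [::] units n in
     veqs (vmul s (vmul s (u i) (u j)) (u k)) (vmul s (u i) (vmul s (u j) (u k))))
   ixs)) ixs)) ixs).

Lemma assoc_check s : allp (assoc_eqs s) -> is_assoc (talg s).
Proof.
rewrite /assoc_eqs allp_flatten ixsP => H.
have {}H i j k : mulj (talg s) (mulj (talg s) (delta_mx 0 i) (delta_mx 0 j)) (delta_mx 0 k)
    = mulj (talg s) (delta_mx 0 i) (mulj (talg s) (delta_mx 0 j) (delta_mx 0 k)).
  have := H i; rewrite allp_flatten ixsP => /(_ j).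
  rewrite allp_flatten ixsP => /(_ k)/veqsP.
  by rewrite -!mulj_talg !vev_units.
have [l r] := table_mul_is_bilinear (den s).
have {}H j x z : mulj (talg s) (mulj (talg s) x (delta_mx 0 j)) z
    = mulj (talg s) x (mulj (talg s) (delta_mx 0 j) z).
  move: x z; apply: bilinear_eq => //.
  - split=> [y|x] k x1 x2 /=; last exact: r.
    by rewrite [table_mul _ _ (delta_mx 0 j)](l _ k x1 x2); apply: l.
  - split=> [y|x] k x1 x2 /=; first exact: l.
    by rewrite [table_mul _ (delta_mx 0 j) _](r _ k x1 x2); apply: r.
move=> x y z; apply: esym; move: x y; apply: bilinear_eq => //.
- split=> [y|x] k x1 x2 /=; last by apply: etrans (l _ k _ _); congr table_mul; apply: r.
  by apply: etrans (l _ k _ _); congr table_mul; apply: l.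
- split=> [y|x] k x1 x2 /=; first exact: l.
  by apply: etrans (r _ k _ _); congr table_mul; apply: l.
Qed.

End Symbolic.

(** * Transport along isomorphisms and the linearised Jordan identity *)

Section Isomorphic.

Variable F : fieldType.

Implicit Types J K L : algebra F.

Lemma isomorphic_refl J : isomorphic J J.
Proof. by exists (idfun : {linear J -> J}) => //; exists id. Qed.

Lemma isomorphic_trans J K L : isomorphic J K -> isomorphic K L -> isomorphic J L.
Proof.
move=> [f bf mf] [g bg mg]; exists (g \o f : {linear J -> L}); first exact: bij_comp.
by move=> x y /=; rewrite mf mg.
Qed.

Lemma isomorphic_sym J K : isomorphic J K -> isomorphic K J.
Proof.
move=> [f [g fK gK] mf].
have lg : linear g.
  by move=> k u v; apply: (can_inj fK); rewrite linearP !gK.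
pose h : {linear K -> J} := HB.pack g (GRing.isLinear.Build F _ _ _ g lg).
exists h; first by exists f.
by move=> x y; apply: (can_inj fK); rewrite mf /= !gK.
Qed.

Lemma iso_jordan J K : isomorphic J K -> is_jordan J -> is_jordan K.
Proof.
move=> /isomorphic_sym[f [g fK gK] mf] [cJ jJ]; split=> x y; apply: (can_inj fK).
  by rewrite !mf cJ.
by rewrite !mf jJ.
Qed.

Lemma iso_assoc J K : isomorphic J K -> is_assoc J -> is_assoc K.
Proof.
by move=> /isomorphic_sym[f [g fK gK] mf] aJ x y z; apply: (can_inj fK); rewrite !mf aJ.
Qed.

(* The Jordan identity at [x = a + t b] for [t = 1] and [t = - 1]. *)
Lemma jordan_lin J : 2 != 0 :> F -> is_jordan J -> forall a b y : J,
  2 *: mulj J (mulj J a b) (mulj J a y) + mulj J (mulj J a a) (mulj J b y) =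
  2 *: mulj J a (mulj J (mulj J a b) y) + mulj J b (mulj J (mulj J a a) y).
Proof.
move=> two [cJ jJ] a b y.
have Eb := jJ b y; have E1 := jJ (a + b) y; have E2 := jJ (a - b) y.
move: Eb E1 E2; rewrite !(linearDl, linearDr, linearBl, linearBr) /= (cJ b a).
rewrite ?(linearNl, linearNr) /= !(cJ b a) => Eb E1 E2.
(* Comparing coordinates turns the identity in J into identities in the field, where [ring]
   applies. *)
have coord_inj (u v : J) :
    (forall i, coord (vbasis fullv) i u = coord (vbasis fullv) i v) -> u = v.
  move=> uv; rewrite (coord_vbasis (memvf u)) (coord_vbasis (memvf v)).
  by apply: eq_bigr => i _; rewrite uv.
apply: coord_inj => i.
have {}Eb := congr1 (coord (vbasis fullv) i) Eb.
have {}E1 := congr1 (coord (vbasis fullv) i) E1.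
have {}E2 := congr1 (coord (vbasis fullv) i) E2.
move: Eb E1 E2; rewrite !(linearD, linearN, linearZ) /= => Eb E1 E2.
apply: (mulfI two); apply: subr0_eq.
move/eqP: Eb; rewrite -subr_eq0 => /eqP Eb.
move/eqP: E1; rewrite -subr_eq0 => /eqP E1.
move/eqP: E2; rewrite -subr_eq0 => /eqP E2.
(* [E1 - E2] is twice the part of the identity that is odd in [b]; subtracting [2 * Eb] removes its
   cubic part and leaves twice the part linear in [b]. *)
have := congr2 (fun x y => x - y) (congr2 (fun x y => x - y) E1 E2) (congr1 (fun x => 2 * x) Eb).
rewrite mulr0 !subr0 => <-; ring.
Qed.

End Isomorphic.

Notation i0 := (@Ordinal 5 0 isT).
Notation i1 := (@Ordinal 5 1 isT).
Notation i2 := (@Ordinal 5 2 isT).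
Notation i3 := (@Ordinal 5 3 isT).
Notation i4 := (@Ordinal 5 4 isT).

(* In [ring_scope] a numeral passed to a tactic would be read as a ring element. *)
Definition k0 : nat := 0%N.
Definition k1 : nat := 1%N.
Definition k2 : nat := 2%N.
Definition k3 : nat := 3%N.
Definition k4 : nat := 4%N.

(** Only the symbolic layer is unfolded; the field operations stay folded for [ring] and [field]. *)
Ltac symd :=
  cbv beta iota zeta delta [ev cadd cmul copp vadd vscale tcoef vmul ceqs veqs
    allp units ixs ixpairs vlin sdet iso_eqs assoc_eqs map flatten foldr nth cat
    take drop iota behead odd negb eqn fst snd nat_of_ord k0 k1 k2 k3 k4].
Tactic Notation "sym" := symd.
Tactic Notation "sym" "in" hyp(H) :=
  cbv beta iota zeta delta [ev cadd cmul copp vadd vscale tcoef vmul ceqs veqs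
    allp units ixs ixpairs vlin sdet iso_eqs assoc_eqs map flatten foldr nth cat
    take drop iota behead odd negb eqn fst snd nat_of_ord k0 k1 k2 k3 k4] in H.

Ltac conjs tac :=
  lazymatch goal with
  | |- _ /\ _ => apply: conj; [conjs tac | conjs tac]
  | |- True => exact I
  | |- _ => tac
  end.

(** * The listed algebras as symbolic tables *)

Section SymbolicTables.

Variable F : fieldType.

Local Notation b := ([:: C0; C1] : seq (coef F)).
Local Notation c := ([:: C0; C0; C1] : seq (coef F)).
Local Notation d := ([:: C0; C0; C0; C1] : seq (coef F)).
Local Notation e := ([:: C0; C0; C0; C0; C1] : seq (coef F)).
Local Notation ke k := ([:: C0; C0; C0; C0; CE k] : seq (coef F)).
Local Notation aa := (i0, i0).
Local Notation ab := (i0, i1).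
Local Notation ac := (i0, i2).
Local Notation ad := (i0, i3).
Local Notation bb := (i1, i1).
Local Notation bc := (i1, i2).
Local Notation bd := (i1, i3).
Local Notation cc := (i2, i2).
Local Notation cd := (i2, i3).
Local Notation dd := (i3, i3).

Definition stab (l : name F) : stable F :=
  match l with
  | J5_1 => [:: (aa, b); (bc, d)]
  | J5_2 => [:: (ab, c); (ac, d)]
  | J5_3 => [:: (ab, c); (ac, d); (bb, d)]
  | J5_4 => [:: (ab, c); (ac, d); (bc, d)]
  | J5_5 => [:: (aa, b); (dd, e); (bc, e)]
  | J5_6 => [:: (aa, b); (ad, e); (bc, e)]
  | J5_7 => [:: (ab, c); (cd, e)]
  | J5_8 => [:: (ab, c); (cd, e); (aa, e)]
  | J5_9 => [:: (ab, c); (cd, e); (aa, e); (bb, e)]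
  | J5_10 => [:: (ab, c); (ac, e); (dd, e); (bc, e)]
  | J5_11 => [:: (ab, c); (ac, e); (dd, e)]
  | J5_12 => [:: (ab, c); (ac, e); (dd, e); (bb, e)]
  | J5_13 => [:: (ab, c); (ac, e); (ad, e); (bc, e)]
  | J5_14 => [:: (ab, c); (ac, e); (bd, e)]
  | J5_15 alpha =>
      [:: (aa, b); (ab, c); (ac, e); (bb, e); (bd, e); (dd, ke alpha)]
  | J5_16 => [:: (ab, d); (cc, d); (ad, e)]
  | J5_17 => [:: (ab, d); (cc, d); (ad, e); (bc, e)]
  | J5_18 => [:: (ab, d); (cc, d); (ad, e); (bb, e)]
  | J5_19 => [:: (ab, d); (cc, d); (cd, e)]
  | J5_20 => [:: (ab, d); (cc, d); (cd, e); (aa, e)]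
  | J5_21 => [:: (ab, d); (cc, d); (cd, e); (aa, e); (bb, e)]
  | J5_22 => [:: (aa, b); (ab, d); (cc, d); (bb, e); (ad, e)]
  | J5_23 alpha => [:: (aa, c); (ab, d); (ac, e); (bd, e); (bc, ke alpha)]
  | J5_24 alpha => [:: (aa, c); (ab, d); (bc, e); (ad, ke alpha)]
  | J5_25 => [:: (aa, c); (ab, d); (ac, e); (bc, ke (- 2)); (ad, e)]
  | J5_26 alpha => [:: (aa, c); (bb, d); (ac, e); (ad, e); (bd, ke alpha)]
  | J5_27 alpha beta =>
      [:: (aa, c); (bb, d); (bc, e); (ad, e); (bd, ke alpha); (ac, ke beta)]
  | J5_28 => [:: (aa, b); (bc, d); (cc, e)]
  | J5_29 => [:: (aa, b); (bc, d); (ac, e)]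
  | J5_30 => [:: (aa, b); (bc, d); (ac, e); (cc, e)]
  | J5_31 => [:: (aa, b); (bc, d); (ab, e)]
  | J5_32 => [:: (aa, b); (bc, d); (ab, e); (ac, e)]
  | J5_33 => [:: (aa, b); (bc, d); (ab, e); (cc, e)]
  | J5_34 => [:: (ab, c); (ac, d); (aa, e)]
  | J5_35 => [:: (ab, c); (ac, d); (bb, e)]
  | J5_36 => [:: (ab, c); (ac, d); (bc, e)]
  | J5_37 => [:: (ab, c); (ac, d); (aa, e); (bb, e)]
  | J5_38 => [:: (ab, c); (ac, d); (aa, e); (bc, e)]
  | J5_39 => [:: (ab, c); (bb, d); (ac, d); (aa, e)]
  | J5_40 => [:: (ab, c); (bb, d); (ac, d); (aa, e); (bc, e)]
  | J5_41 alpha => [:: (ab, c); (ac, d); (bc, d); (aa, e); (bb, ke alpha)]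
  | M5_1 => [:: (aa, b); (ab, [:: C0; C0; C0; C1; C1]); (cc, d); (bb, e); (ad, e)]
  | M5_2 => [:: (aa, b); (bc, d); (ab, e); (ac, e); (cc, e)]
  end.

Lemma listedE l : listed l = talg (stab l).
Proof.
have vb : delta_mx 0 i1 = vev b by rewrite -(vev_units F i1).
have vc : delta_mx 0 i2 = vev c by rewrite -(vev_units F i2).
have vd : delta_mx 0 i3 = vev d by rewrite -(vev_units F i3).
have ve : delta_mx 0 i4 = vev e by rewrite -(vev_units F i4).
have vk k : k *: vev e = vev (ke k).
  by rewrite -[k in LHS]/(ev (CE k)) -vev_scale.
have vde : vev d + vev e = vev [:: C0; C0; C0; C1; C1].
  by rewrite -vev_add.
rewrite /listed /talg; congr table_algebra.
have c3 (x y : 'I_5 * 'I_5 * 'rV[F]_5) t t' : x = y -> t = t' -> x :: t = y :: t'.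
  by move=> -> ->.
have p2 (x : 'I_5 * 'I_5) (v w : 'rV[F]_5) : v = w -> (x, v) = (x, w) by move=> ->.
case: l => *; cbv [table_of den stab map fst snd];
  repeat (apply c3; [apply p2;
    lazymatch goal with
    | |- _ *: _ = _ => rewrite ve; exact (vk _)
    | |- _ + _ = _ => rewrite vd ve; exact vde
    | |- delta_mx 0 i1 = _ => exact vb
    | |- delta_mx 0 i2 = _ => exact vc
    | |- delta_mx 0 i3 = _ => exact vd
    | |- delta_mx 0 i4 = _ => exact ve
    end | ]); exact (erefl (@nil _)).
Qed.

End SymbolicTables.

Section Identities.

Variable F : fieldType.
Hypothesis two : 2 != 0 :> F.

Implicit Types (s : stable F) (x y z : seq (coef F)).

Definition jordan_eqs s x y : seq (F * F) :=
  veqs (vmul s (vmul s x x) (vmul s x y)) (vmul s x (vmul s (vmul s x x) y)).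

Lemma jordan_talg s x y : is_jordan (talg s) -> allp (jordan_eqs s x y).
Proof.
case=> _ jJ; apply: (proj2 (veqsP _ _)); have := jJ (vev x) (vev y).
rewrite (mulj_talg s x x) (mulj_talg s x y) (mulj_talg s (vmul s x x) (vmul s x y)).
by rewrite (mulj_talg s (vmul s x x) y) (mulj_talg s x).
Qed.

Definition jordan_lin_eqs s x y z : seq (F * F) :=
  let dbl v := vscale (CE 2) v in
  veqs (vadd (dbl (vmul s (vmul s x y) (vmul s x z)))
             (vmul s (vmul s x x) (vmul s y z)))
       (vadd (dbl (vmul s x (vmul s (vmul s x y) z)))
             (vmul s y (vmul s (vmul s x x) z))).

Lemma jordan_lin_talg s x y z : is_jordan (talg s) -> allp (jordan_lin_eqs s x y z).
Proof.
move=> jJ; apply: (proj2 (veqsP _ _)).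
have := jordan_lin two jJ (vev x) (vev y) (vev z).
rewrite (mulj_talg s x y) (mulj_talg s x z) (mulj_talg s x x) (mulj_talg s y z).
rewrite (mulj_talg s (vmul s x y) (vmul s x z)) (mulj_talg s (vmul s x x) (vmul s y z)).
rewrite (mulj_talg s (vmul s x y) z) (mulj_talg s (vmul s x x) z).
rewrite (mulj_talg s x (vmul s (vmul s x y) z)) (mulj_talg s y).
rewrite -(vev_scale (CE 2)) -(vev_add (vscale _ _)).
by rewrite -(vev_scale (CE 2) (vmul s x (vmul s (vmul s x y) z))) -(vev_add (vscale _ _)).
Qed.

End Identities.

(** * Single coordinate equations and certificates for their consequences *)

Section Entries.

Variable F : fieldType.

Implicit Types (s : stable F) (g : seq (seq (coef F))).

(** The equations are drawn one at a time, because each entry that is found is substituted before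
    the next equation is computed. *)
Lemma is_iso_entry s s' g : is_iso s s' g -> forall i j k : nat,
  (i, j) \in ixpairs -> k \in ixs ->
  ev (nth C0 (vmul s' (nth [::] g i) (nth [::] g j)) k) =
  ev (nth C0 (vlin (vmul s (nth [::] (units F) i) (nth [::] (units F) j)) g) k).
Proof.
move=> isog; have g5 : size g = 5%N by case: isog.
case: (proj1 (is_isoP s s' g5) isog) => H _ i j k ij kx.
move: H; rewrite /iso_eqs allp_flatten => /(_ _ ij).
by rewrite /veqs allp_flatten => /(_ _ kx)/ceqsP.
Qed.

Lemma is_iso_det s s' g : is_iso s s' g -> ev (sdet 5 g) <> 0.
Proof.
move=> isog; have g5 : size g = 5%N by case: isog.
by case: (proj1 (is_isoP s s' g5) isog).
Qed.

Lemma mul0_neq (x y : F) : x != 0 -> x * y = 0 -> y = 0.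
Proof. by move=> x0 /eqP; rewrite mulf_eq0 (negbTE x0) => /eqP. Qed.

End Entries.

Ltac entry E H i j k :=
  have E := is_iso_entry H (i := i) (j := j) (k := k) isT isT; sym in E.

Section LinearCombinations.

Variable R : fieldType.

(** Certificates of ideal membership: [p - q] is an explicit combination of the differences given by
    the hypotheses, and [ring] ([field] for [lcf]) checks it. The multipliers passed to [lc] and
    [lcf] below are such certificates. *)
Lemma lc1 (p q k a b : R) : a = b -> p - q = k * (a - b) -> p = q.
Proof. by move=> -> H; apply: subr0_eq; rewrite H subrr mulr0. Qed.

Lemma lc2 (p q k a b k' a' b' : R) : a = b -> a' = b' ->
  p - q = k * (a - b) + k' * (a' - b') -> p = q.
Proof. by move=> -> -> H; apply: subr0_eq; rewrite H !subrr !mulr0 addr0. Qed.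

Lemma lc3 (p q k a b k' a' b' k2 a2 b2 : R) : a = b -> a' = b' -> a2 = b2 ->
  p - q = k * (a - b) + k' * (a' - b') + k2 * (a2 - b2) -> p = q.
Proof. by move=> -> -> -> H; apply: subr0_eq; rewrite H !subrr !mulr0 !addr0. Qed.

Lemma lc6 (p q k a b k' a' b' k2 a2 b2 k3 a3 b3 k4 a4 b4 k5 a5 b5 : R) :
  a = b -> a' = b' -> a2 = b2 -> a3 = b3 -> a4 = b4 -> a5 = b5 ->
  p - q = k * (a - b) + k' * (a' - b') + k2 * (a2 - b2) + k3 * (a3 - b3)
          + k4 * (a4 - b4) + k5 * (a5 - b5) -> p = q.
Proof.
by move=> -> -> -> -> -> -> H; apply: subr0_eq; rewrite H !subrr !mulr0 !addr0.
Qed.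

End LinearCombinations.

Tactic Notation "lc" uconstr(k) constr(H) := (refine (@lc1 _ _ _ k _ _ H _); ring).
Tactic Notation "lc" uconstr(k) constr(H) "," uconstr(k') constr(H') :=
  (refine (@lc2 _ _ _ k _ _ k' _ _ H H' _); ring).
Tactic Notation "lc" uconstr(k) constr(H) "," uconstr(k') constr(H')
    "," uconstr(l2) constr(H2) :=
  (refine (@lc3 _ _ _ k _ _ k' _ _ l2 _ _ H H' H2 _); ring).

Ltac lcany :=
  match goal with H : _ = _ |- _ => solve [lc 1 H | lc (- 1) H] end.

Ltac coords H :=
  let g := fresh "g" in
  case/iso_coords: H => g;
  generalize (g 0 0)%N (g 0 1)%N (g 0 2)%N (g 0 3)%N (g 0 4)%N
             (g 1 0)%N (g 1 1)%N (g 1 2)%N (g 1 3)%N (g 1 4)%N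
             (g 2 0)%N (g 2 1)%N (g 2 2)%N (g 2 3)%N (g 2 4)%N
             (g 3 0)%N (g 3 1)%N (g 3 2)%N (g 3 3)%N (g 3 4)%N
             (g 4 0)%N (g 4 1)%N (g 4 2)%N (g 4 3)%N (g 4 4)%N;
  clear g;
  intros a00 a01 a02 a03 a04 a10 a11 a12 a13 a14 a20 a21 a22 a23 a24
         a30 a31 a32 a33 a34 a40 a41 a42 a43 a44 H.

(** Turns the entries [CE 0] into [C0], so that they disappear from all later computations. *)
Ltac zeros H :=
  match type of H with
  | @is_iso ?F ?s ?s' ?g =>
    let p := eval pattern (@CE F 0) in g in
    lazymatch p with
    | ?f _ => let g' := eval cbv beta in (f (@C0 F)) in
        apply (@is_iso_ev F s s' g g' (erefl _)) in H
    end
  end.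

Ltac nz :=
  rewrite ?(mulf_eq0, invr_eq0, oppr_eq0, expf_eq0, oner_eq0) ?negb_or /= ?andbT ?orbF;
  repeat match goal with |- is_true (_ && _) => apply/andP; split end; try done.

Ltac fielda := field; nz.

Tactic Notation "lcf" uconstr(k) constr(H) :=
  (refine (@lc1 _ _ _ k _ _ H _); fielda).
Tactic Notation "lcf" uconstr(k) constr(H) "," uconstr(k') constr(H') :=
  (refine (@lc2 _ _ _ k _ _ k' _ _ H H' _); fielda).
Tactic Notation "lcf" uconstr(k) constr(H) "," uconstr(k') constr(H')
    "," uconstr(l2) constr(H2) :=
  (refine (@lc3 _ _ _ k _ _ k' _ _ l2 _ _ H H' H2 _); fielda).

Tactic Notation "jord" hyp(J) uconstr(x) uconstr(y) ident(E) :=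
  pose proof (jordan_talg x y J) as E; unfold jordan_eqs in E; sym in E.

Tactic Notation "jordl" hyp(two) hyp(J) uconstr(x) uconstr(y) uconstr(z) ident(E) :=
  pose proof (jordan_lin_talg two x y z J) as E; unfold jordan_lin_eqs in E; sym in E.

Ltac iso_with g := apply: (iso_check (g := g)); first exact: (erefl 5%N).

(** * Algebras with dim J^<2> = 2 *)

Section TypeA.

Variable F : fieldType.
Hypothesis two : 2 != 0 :> F.

(* The vectors 0, 1, 2 span J modulo J^<2>, the vectors 3, 4 span J^<2>, and 4
   spans J^<3>; the products of the generators are given modulo J^<3> by the
   quadratic form q, and 0, 1 span the annihilator of J^<2> in their span. *)
Definition TA (q11 q12 q13 q22 q23 q33 r11 r12 r22 : F) : stable F :=
  [:: (i0, i0, [:: C0; C0; C0; CE q11; CE r11]);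
      (i0, i1, [:: C0; C0; C0; CE q12; CE r12]);
      (i0, i2, [:: C0; C0; C0; CE q13]);
      (i1, i1, [:: C0; C0; C0; CE q22; CE r22]);
      (i1, i2, [:: C0; C0; C0; CE q23]);
      (i2, i2, [:: C0; C0; C0; CE q33]);
      (i2, i3, [:: C0; C0; C0; C0; C1])].

(** The rows (a, b, 0), (c, d, 0), (x, y, h) are the images of 0, 1, 2 modulo J^<2>; 3 goes to s 3 +
    t 4, hence 4 to s h 4. So q changes by congruence and scaling, while r is a quadratic form on
    the span of 0 and 1 that matters only modulo multiples of the restriction of q, through [t]. *)
Definition relA (q11 q12 q13 q22 q23 q33 r11 r12 r22 : F)
    (p11 p12 p13 p22 p23 p33 s11 s12 s22 : F) : Prop :=
  exists a b c d x y h s t : F,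
  [/\ h != 0, s != 0 & a * d - b * c != 0] /\
  [/\ s * q11 = a ^+ 2 * p11 + 2 * a * b * p12 + b ^+ 2 * p22,
      s * q12 = a * c * p11 + (a * d + b * c) * p12 + b * d * p22,
      s * q22 = c ^+ 2 * p11 + 2 * c * d * p12 + d ^+ 2 * p22,
      s * q13 = a * x * p11 + (a * y + b * x) * p12 + b * y * p22
                + h * (a * p13 + b * p23) &
      s * q23 = c * x * p11 + (c * y + d * x) * p12 + d * y * p22
                + h * (c * p13 + d * p23)] /\
  [/\ s * q33 = x ^+ 2 * p11 + 2 * x * y * p12 + y ^+ 2 * p22
                + 2 * h * (x * p13 + y * p23) + h ^+ 2 * p33,
      t * q11 + s * h * r11 = a ^+ 2 * s11 + 2 * a * b * s12 + b ^+ 2 * s22,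
      t * q12 + s * h * r12 = a * c * s11 + (a * d + b * c) * s12 + b * d * s22 &
      t * q22 + s * h * r22 = c ^+ 2 * s11 + 2 * c * d * s12 + d ^+ 2 * s22].

Lemma iso_relA q11 q12 q13 q22 q23 q33 r11 r12 r22 p11 p12 p13 p22 p23 p33 s11 s12 s22 :
  relA q11 q12 q13 q22 q23 q33 r11 r12 r22 p11 p12 p13 p22 p23 p33 s11 s12 s22 ->
  isomorphic (talg (TA q11 q12 q13 q22 q23 q33 r11 r12 r22))
             (talg (TA p11 p12 p13 p22 p23 p33 s11 s12 s22)).
Proof.
move=> [a [b [c [d [x [y [h [s [t [[h0 s0 D0] [[E11 E12 E22 E13 E23] [E33 R11 R12 R22]]]]]]]]]]]].
(* The components of the images of 0, 1, 2 along 3 restore the shape of [TA], in which the products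
   with 2 have no free coefficient along 4. *)
pose u1 := (t * q13 - (a * x * s11 + (a * y + b * x) * s12 + b * y * s22)) / h.
pose u2 := (t * q23 - (c * x * s11 + (c * y + d * x) * s12 + d * y * s22)) / h.
pose u3 := (t * q33 - (x ^+ 2 * s11 + 2 * x * y * s12 + y ^+ 2 * s22)) / (2 * h).
apply: (iso_check (g := [:: [:: CE a; CE b; C0; CE u1]; [:: CE c; CE d; C0; CE u2];
  [:: CE x; CE y; CE h; CE u3]; [:: C0; C0; C0; CE s; CE t];
  [:: C0; C0; C0; C0; CE (s * h)]])); first exact: (erefl 5%N).
rewrite /TA; sym; split; last first.
  apply/eqP; have -> : a * (d * (h * (s * (s * h)))) + c * - (b * (h * (s * (s * h))))
      = (a * d - b * c) * (h * h * (s * s)) by ring.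
  by rewrite !mulf_neq0.
conjs ltac:(first [by ring | lcany | rewrite /u1 /u2 /u3; by fielda]).

Qed.

(** By the hypothesis some product of 0 or 1 with a generator has a component along 3. Comparing it
    with the images, whose products lie in the span of 3 and 4, confines the image of 3 to that
    span. *)
Lemma relA_iso q11 q12 q13 q22 q23 q33 r11 r12 r22 p11 p12 p13 p22 p23 p33 s11 s12 s22 :
  isomorphic (talg (TA q11 q12 q13 q22 q23 q33 r11 r12 r22))
             (talg (TA p11 p12 p13 p22 p23 p33 s11 s12 s22)) ->
  ~ [/\ q11 = 0, q12 = 0, q13 = 0, q22 = 0 & q23 = 0] ->
  relA q11 q12 q13 q22 q23 q33 r11 r12 r22 p11 p12 p13 p22 p23 p33 s11 s12 s22.
Proof.
move=> H nQ; coords H; unfold TA in H.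
entry E H k2 k3 k0; subst a40; entry E H k2 k3 k1; subst a41; entry E H k2 k3 k2; subst a42.
zeros H.
have z (u : F) : (forall q : F, q \in [:: q11; q12; q13; q22; q23] -> q * u = 0) -> u = 0.
  move=> qu; case: (eqVneq u 0) => // u0; case: nQ.
  by split; apply: (mul0_neq u0); rewrite mulrC qu // !inE eqxx ?orbT.
have z30 : a30 = 0.
  apply: z => q; rewrite !inE => /or4P[|||/orP[]] /eqP->;
  [entry E H k0 k0 k0|entry E H k0 k1 k0|entry E H k0 k2 k0|entry E H k1 k1 k0|entry E H k1 k2 k0];
  by rewrite -E.
have z31 : a31 = 0.
  apply: z => q; rewrite !inE => /or4P[|||/orP[]] /eqP->;
  [entry E H k0 k0 k1|entry E H k0 k1 k1|entry E H k0 k2 k1|entry E H k1 k1 k1|entry E H k1 k2 k1];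
  by rewrite -E.
have z32 : a32 = 0.
  apply: z => q; rewrite !inE => /or4P[|||/orP[]] /eqP->;
  [entry E H k0 k0 k2|entry E H k0 k1 k2|entry E H k0 k2 k2|entry E H k1 k1 k2|entry E H k1 k2 k2];
  by rewrite -E.
subst a30 a31 a32; zeros H.
entry E H k2 k3 k3; subst a43; zeros H.
have D := is_iso_det H; sym in D.
have s0 : a33 != 0.
  by apply/eqP=> s0; apply: D; rewrite s0; ring.
(* 0 and 1 annihilate 3, so that their images have no component along 2. *)
entry E H k0 k3 k4; have z02 := mul0_neq s0 (etrans (mulrC _ _) E).
entry E' H k1 k3 k4; have z12 := mul0_neq s0 (etrans (mulrC _ _) E').
subst a02 a12; zeros H.
entry e4 H k2 k3 k4; subst a44; move/eqP: D => D.
have [h0 D0] : a22 != 0 /\ a00 * a11 - a01 * a10 != 0.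
  by split; apply: contraNneq D => D0; apply/eqP;
   [rewrite D0; ring | lc (a22 * (a33 * (a22 * a33))) D0].
exists a00, a01, a10, a11, a20, a21, a22, a33, a34; split=> //.
entry E003 H k0 k0 k3; entry E013 H k0 k1 k3; entry E113 H k1 k1 k3.
entry E023 H k0 k2 k3; entry E123 H k1 k2 k3; entry E223 H k2 k2 k3.
entry E004 H k0 k0 k4; entry E014 H k0 k1 k4; entry E114 H k1 k1 k4.
by split; split; [lc (- 1) E003|lc (- 1) E013|lc (- 1) E113|lc (- 1) E023|lc (- 1) E123|
  lc (- 1) E223|lc (- 1) E004|lc (- 1) E014|lc (- 1) E114].
Qed.

End TypeA.

Definition listable (F : fieldType) (J : algebra F) : Prop :=
  exists l : name F, admissible l /\ isomorphic J (listed l).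

Lemma listable_iso (F : fieldType) (J K : algebra F) :
  isomorphic J K -> listable J -> listable K.
Proof.
move=> JK [l [al Jl]]; exists l; split=> //.
exact: isomorphic_trans (isomorphic_sym JK) Jl.
Qed.

Definition vanish (F : fieldType) (l : seq F) : bool := all (fun x => x == 0) l.

Ltac nf_check :=
  sym; split; [conjs ltac:(ring) | by rewrite ?(mul1r, mulr1) ?oppr0 ?addr0; apply/eqP;
    rewrite ?oppr_eq0 ?opprK ?oner_eq0].

Ltac vanish_goal :=
  rewrite /vanish /= ?andbT;
  repeat match goal with
  | |- is_true (_ && _) -> _ => case/andP
  | |- is_true (_ == 0) -> _ => let h := fresh "Z" in move/eqP=> h
  end;
  repeat match goal with |- is_true (_ && _) => apply/andP; split end; apply/eqP.

(** * Separation of the algebras with dim J^<2> = 2 *)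

Section SeparationA.

Variable F : fieldType.
Hypothesis two : 2 != 0 :> F.

(* Vanishing conditions which are invariant under [relA]: det q, the minors of
   q, the restriction q_K of q to the span K of the generators 0 and 1, and
   joint invariants of q_K and r that do not change when a multiple of q_K is
   added to r; [q23 ^+ 2 * r11 - ...] is r on the vector of K orthogonal to 2. *)
Definition codeA (q11 q12 q13 q22 q23 q33 r11 r12 r22 : F) : seq bool :=
  let qK := [:: q11; q12; q22] in
  let dK := q11 * q22 - q12 ^+ 2 in
  let m := q11 * r22 - 2 * q12 * r12 + q22 * r11 in
  let dr := r11 * r22 - r12 ^+ 2 in
  [:: vanish [:: q11 * (q22 * q33 - q23 ^+ 2) - q12 * (q12 * q33 - q13 * q23)
                 + q13 * (q12 * q23 - q13 * q22)];
      vanish [:: dK; q11 * q23 - q13 * q12; q12 * q23 - q13 * q22;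
                 q11 * q33 - q13 ^+ 2; q12 * q33 - q13 * q23;
                 q22 * q33 - q23 ^+ 2];
      vanish [:: dK];
      vanish qK;
      vanish [:: q11 * r12 - q12 * r11; q11 * r22 - q22 * r11;
                 q12 * r22 - q22 * r12];
      vanish [:: dK; m];
      vanish [:: m ^+ 2 - 4 * dK * dr];
      vanish (q23 ^+ 2 * r11 - 2 * q13 * q23 * r12 + q13 ^+ 2 * r22 :: qK);
      vanish (dr :: qK);
      vanish ([:: r11; r12; r22] ++ qK)].

(** Each polynomial evaluated at the source is a combination of those evaluated at the target, with
    powers of [s] and [h] as denominators. The converse implication is obtained from the inverse
    isomorphism. *)
Lemma codeA_rel q11 q12 q13 q22 q23 q33 r11 r12 r22 p11 p12 p13 p22 p23 p33 s11 s12 s22 :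
  relA q11 q12 q13 q22 q23 q33 r11 r12 r22 p11 p12 p13 p22 p23 p33 s11 s12 s22 ->
  forall i, nth false (codeA p11 p12 p13 p22 p23 p33 s11 s12 s22) i ->
            nth false (codeA q11 q12 q13 q22 q23 q33 r11 r12 r22) i.
Proof.
move=> [a [b [c [d [x [y [h [s [t [[h0 s0 D0] [[E11 E12 E22 E13 E23] [E33 R11 R12 R22]]]]]]]]]]]].
have s30 : s ^+ 3 != 0 by rewrite expf_neq0.
have s20 : s ^+ 2 != 0 by rewrite expf_neq0.
have sh0 : s * h != 0 by rewrite mulf_neq0.
have Q11 : q11 = (s * q11) / s by rewrite mulrC mulKf.
have Q12 : q12 = (s * q12) / s by rewrite mulrC mulKf.
have Q13 : q13 = (s * q13) / s by rewrite mulrC mulKf.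
have Q22 : q22 = (s * q22) / s by rewrite mulrC mulKf.
have Q23 : q23 = (s * q23) / s by rewrite mulrC mulKf.
have Q33 : q33 = (s * q33) / s by rewrite mulrC mulKf.
rewrite E11 in Q11; rewrite E12 in Q12; rewrite E13 in Q13.
rewrite E22 in Q22; rewrite E23 in Q23; rewrite E33 in Q33.
have S11 : r11 = (a ^+ 2 * s11 + 2 * a * b * s12 + b ^+ 2 * s22 - t * q11) / (s * h).
  by rewrite -R11; field; nz.
have S12 : r12 = (a * c * s11 + (a * d + b * c) * s12 + b * d * s22 - t * q12) / (s * h).
  by rewrite -R12; field; nz.
have S22 : r22 = (c ^+ 2 * s11 + 2 * c * d * s12 + d ^+ 2 * s22 - t * q22) / (s * h).
  by rewrite -R22; field; nz.
clear E11 E12 E13 E22 E23 E33 R11 R12 R22 D0.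
case=> [|[|[|[|[|[|[|[|[|[|i]]]]]]]]]]; rewrite /codeA /= ?nth_nil //; vanish_goal.
- rewrite Q11 Q12 Q13 Q22 Q23 Q33.
  by lcf ((h * (a * d - b * c)) ^+ 2 / s ^+ 3) Z.
(* The minors of q transform by Cauchy-Binet: the multipliers in this and the next five cases are
   products of 2 by 2 minors of the matrix with rows (a, b, 0), (c, d, 0), (x, y, h). *)
- rewrite Q11 Q12 Q22.
  by lcf (((a * d - b * c) * (a * d - b * c)) / s ^+ 2) Z.
- rewrite Q11 Q12 Q13 Q23.
  by lcf (((a * d - b * c) * (a * y - b * x)) / s ^+ 2) Z,
     (((a * d - b * c) * (a * h)) / s ^+ 2) Z0,
     (((a * d - b * c) * (b * h)) / s ^+ 2) Z1.
- rewrite Q12 Q13 Q22 Q23.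
  by lcf (((a * d - b * c) * (c * y - d * x)) / s ^+ 2) Z,
     (((a * d - b * c) * (c * h)) / s ^+ 2) Z0,
     (((a * d - b * c) * (d * h)) / s ^+ 2) Z1.
- rewrite Q11 Q13 Q33.
  refine (@lc6 _ _ _ (((a * y - b * x) * (a * y - b * x)) / s ^+ 2) _ _
    (((a * y - b * x) * (a * h) + (a * h) * (a * y - b * x)) / s ^+ 2) _ _
    (((a * y - b * x) * (b * h) + (b * h) * (a * y - b * x)) / s ^+ 2) _ _
    (((a * h) * (a * h)) / s ^+ 2) _ _
    (((a * h) * (b * h) + (b * h) * (a * h)) / s ^+ 2) _ _
    (((b * h) * (b * h)) / s ^+ 2) _ _
    Z Z0 Z1 Z2 Z3 Z4 _); fielda.
- rewrite Q12 Q13 Q23 Q33.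
  refine (@lc6 _ _ _ (((a * y - b * x) * (c * y - d * x)) / s ^+ 2) _ _
    (((a * y - b * x) * (c * h) + (a * h) * (c * y - d * x)) / s ^+ 2) _ _
    (((a * y - b * x) * (d * h) + (b * h) * (c * y - d * x)) / s ^+ 2) _ _
    (((a * h) * (c * h)) / s ^+ 2) _ _
    (((a * h) * (d * h) + (b * h) * (c * h)) / s ^+ 2) _ _
    (((b * h) * (d * h)) / s ^+ 2) _ _
    Z Z0 Z1 Z2 Z3 Z4 _); fielda.
- rewrite Q22 Q23 Q33.
  refine (@lc6 _ _ _ (((c * y - d * x) * (c * y - d * x)) / s ^+ 2) _ _
    (((c * y - d * x) * (c * h) + (c * h) * (c * y - d * x)) / s ^+ 2) _ _
    (((c * y - d * x) * (d * h) + (d * h) * (c * y - d * x)) / s ^+ 2) _ _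
    (((c * h) * (c * h)) / s ^+ 2) _ _
    (((c * h) * (d * h) + (d * h) * (c * h)) / s ^+ 2) _ _
    (((d * h) * (d * h)) / s ^+ 2) _ _
    Z Z0 Z1 Z2 Z3 Z4 _); fielda.
- by rewrite Q11 Q12 Q22; lcf ((a * d - b * c) ^+ 2 / s ^+ 2) Z.
- by rewrite Q11 Z Z0 Z1 !(mulr0, addr0, mul0r).
- by rewrite Q12 Z Z0 Z1 !(mulr0, addr0, mul0r).
- by rewrite Q22 Z Z0 Z1 !(mulr0, addr0, mul0r).
- rewrite S11 S12 Q11 Q12.
  by lcf ((a * d - b * c) / (s ^+ 2 * h) * a ^+ 2) Z,
     ((a * d - b * c) / (s ^+ 2 * h) * (a * b)) Z0,
     ((a * d - b * c) / (s ^+ 2 * h) * b ^+ 2) Z1.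
- rewrite S11 S22 Q11 Q22.
  by lcf ((a * d - b * c) / (s ^+ 2 * h) * (2 * a * c)) Z,
     ((a * d - b * c) / (s ^+ 2 * h) * (a * d + b * c)) Z0,
     ((a * d - b * c) / (s ^+ 2 * h) * (2 * b * d)) Z1.
- rewrite S12 S22 Q12 Q22.
  by lcf ((a * d - b * c) / (s ^+ 2 * h) * c ^+ 2) Z,
     ((a * d - b * c) / (s ^+ 2 * h) * (c * d)) Z0,
     ((a * d - b * c) / (s ^+ 2 * h) * d ^+ 2) Z1.
- by rewrite Q11 Q12 Q22; lcf ((a * d - b * c) ^+ 2 / s ^+ 2) Z.
- rewrite S11 S12 S22 Q11 Q12 Q22.
  by lcf ((a * d - b * c) ^+ 2 / (s ^+ 2 * h)) Z0,
     (- 2 * t * (a * d - b * c) ^+ 2 / (s ^+ 3 * h)) Z.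
- rewrite S11 S12 S22 Q11 Q12 Q22.
  by lcf ((a * d - b * c) ^+ 4 / (s ^+ 2 * h) ^+ 2) Z.
- have -> : q23 ^+ 2 * r11 - 2 * q13 * q23 * r12 + q13 ^+ 2 * r22 =
    ((s * q23) ^+ 2 * r11 - 2 * (s * q13) * (s * q23) * r12 + (s * q13) ^+ 2 * r22)
    / s ^+ 2 by fielda.
  rewrite Q13 Q23 S11 S12 S22 Q11 Q12 Q22 Z0 Z1 Z2.
  by lcf (h * (a * d - b * c) ^+ 2 / s ^+ 3) Z.
- by rewrite Q11 Z0 Z1 Z2 !(mulr0, addr0, mul0r).
- by rewrite Q12 Z0 Z1 Z2 !(mulr0, addr0, mul0r).
- by rewrite Q22 Z0 Z1 Z2 !(mulr0, addr0, mul0r).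
- rewrite S11 S12 S22 Q11 Q12 Q22 Z0 Z1 Z2.
  by lcf ((a * d - b * c) ^+ 2 / (s * h) ^+ 2) Z.
- by rewrite Q11 Z0 Z1 Z2 !(mulr0, addr0, mul0r).
- by rewrite Q12 Z0 Z1 Z2 !(mulr0, addr0, mul0r).
- by rewrite Q22 Z0 Z1 Z2 !(mulr0, addr0, mul0r).
- by rewrite S11 Q11 Z Z0 Z1 Z2 Z3 Z4; fielda.
- by rewrite S12 Q12 Z Z0 Z1 Z2 Z3 Z4; fielda.
- by rewrite S22 Q22 Z Z0 Z1 Z2 Z3 Z4; fielda.
- by rewrite Q11 Z2 Z3 Z4 !(mulr0, addr0, mul0r).
- by rewrite Q12 Z2 Z3 Z4 !(mulr0, addr0, mul0r).
- by rewrite Q22 Z2 Z3 Z4 !(mulr0, addr0, mul0r).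
Qed.

(** [None] marks the algebras with dim J^<2> = 3. The entry [- 2] occurs when a∘c = b∘c: the
    generator annihilating c is then b - a, whose square is - 2 c. *)
Definition parA (l : name F) : option (F * F * F * F * F * F * F * F * F) :=
  match l with
  | J5_1 => Some (1, 0, 0, 0, 0, 0, 0, 0, 0)
  | J5_2 => Some (0, 0, 1, 0, 0, 0, 0, 0, 0)
  | J5_3 => Some (0, 0, 1, 0, 0, 0, 1, 0, 0)
  | J5_4 => Some ((- 2), 0, 1, 0, 0, 0, 0, 0, 0)
  | J5_5 => Some (1, 0, 0, 0, 0, 0, 0, 0, 1)
  | J5_6 => Some (1, 0, 0, 0, 0, 0, 0, 1, 0)
  | J5_7 => Some (0, 1, 0, 0, 0, 0, 0, 0, 0)
  | J5_8 => Some (0, 1, 0, 0, 0, 0, 1, 0, 0)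
  | J5_9 => Some (0, 1, 0, 0, 0, 0, 1, 0, 1)
  | J5_10 => Some ((- 2), 0, 1, 0, 0, 0, 0, 0, 1)
  | J5_11 => Some (0, 0, 1, 0, 0, 0, 0, 0, 1)
  | J5_12 => Some (0, 0, 1, 0, 0, 0, 1, 0, 1)
  | J5_13 => Some ((- 2), 0, 1, 0, 0, 0, 0, (- 1), 0)
  | J5_14 => Some (0, 0, 1, 0, 0, 0, 0, 1, 0)
  | J5_16 => Some (1, 0, 0, 0, 1, 0, 0, 0, 0)
  | J5_17 => Some (1, 0, 0, 0, 1, 0, 0, 1, 0)
  | J5_18 => Some (1, 0, 0, 0, 1, 0, 0, 0, 1)
  | J5_19 => Some (0, 1, 0, 0, 0, 1, 0, 0, 0)
  | J5_20 => Some (0, 1, 0, 0, 0, 1, 1, 0, 0)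
  | J5_21 => Some (0, 1, 0, 0, 0, 1, 1, 0, 1)
  | _ => None
  end.

Definition TAof (p : F * F * F * F * F * F * F * F * F) : stable F :=
  let: (q11, q12, q13, q22, q23, q33, r11, r12, r22) := p in
  TA q11 q12 q13 q22 q23 q33 r11 r12 r22.

Definition codeAof (p : F * F * F * F * F * F * F * F * F) : seq bool :=
  let: (q11, q12, q13, q22, q23, q33, r11, r12, r22) := p in
  codeA q11 q12 q13 q22 q23 q33 r11 r12 r22.

(** The twenty codes are pairwise distinct, which is all that the separation of these algebras
    uses. *)
Definition nfA_code (l : name F) : seq bool :=
  match l with
  | J5_1 => [:: true; true; true; false; true; true; true; false; false; false]
  | J5_2 => [:: true; false; true; true; true; true; true; true; true; true]
  | J5_3 => [:: true; false; true; true; true; true; true; true; true; false]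
  | J5_4 => [:: true; false; true; false; true; true; true; false; false; false]
  | J5_5 => [:: true; true; true; false; false; false; false; false; false; false]
  | J5_6 => [:: true; true; true; false; false; true; true; false; false; false]
  | J5_7 => [:: true; false; false; false; true; false; true; false; false; false]
  | J5_8 => [:: true; false; false; false; false; false; true; false; false; false]
  | J5_9 => [:: true; false; false; false; false; false; false; false; false; false]
  | J5_10 => [:: true; false; true; false; false; false; false; false; false; false]
  | J5_11 => [:: true; false; true; true; true; true; true; false; true; false]
  | J5_12 => [:: true; false; true; true; true; true; true; false; false; false]
  | J5_13 => [:: true; false; true; false; false; true; true; false; false; false]
  | J5_14 => [:: true; false; true; true; true; true; true; true; false; false]
  | J5_16 => [:: false; false; true; false; true; true; true; false; false; false]
  | J5_17 => [:: false; false; true; false; false; true; true; false; false; false]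
  | J5_18 => [:: false; false; true; false; false; false; false; false; false; false]
  | J5_19 => [:: false; false; false; false; true; false; true; false; false; false]
  | J5_20 => [:: false; false; false; false; false; false; true; false; false; false]
  | J5_21 => [:: false; false; false; false; false; false; false; false; false; false]
  | _ => [::]
  end.

(** Every polynomial of the code takes one of the values 0, 1, -1, 2, -2, 4 on the normal forms, so
    that [two] decides whether it vanishes. *)
Lemma codeA_nf l p : parA l = Some p -> codeAof p = nfA_code l.
Proof.
have two' : - 2 != 0 :> F by rewrite oppr_eq0.
have four : 4 != 0 :> F by rewrite (_ : 4 = 2 * 2); [rewrite mulf_neq0 | ring].
have N (x y : F) : y != 0 -> x = y -> (x == 0) = false by move=> y0 ->; apply: negbTE.
have Z (x : F) : x = 0 -> (x == 0) = true by move=> ->; apply: eqxx.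
case: l => //= -[<-];
  rewrite /codeAof /codeA /vanish /=;
  repeat match goal with |- context [?e == 0] =>
    first [ rewrite (Z e); [|by ring]
          | rewrite (N e 1); [|exact: oner_neq0|by ring]
          | rewrite (N e (- 1)); [|by rewrite oppr_eq0 oner_neq0|by ring]
          | rewrite (N e 2); [|exact: two|by ring]
          | rewrite (N e (- 2)); [|exact: two'|by ring]
          | rewrite (N e 4); [|exact: four|by ring] ] end; exact (erefl _).
Qed.

Lemma listed_nfA l p : parA l = Some p -> isomorphic (talg (TAof p)) (listed l).
Proof.
rewrite listedE; case: l => //= -[<-]; rewrite /TAof /TA.
- apply: (iso_check (g := [:: [:: C1; C0; C0; C0; C0];
    [:: C0; C0; C0; C0; C1];
    [:: C0; C0; C1; C0; C0];
    [:: C0; C1; C0; C0; C0];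
    [:: C0; C0; C0; C1; C0]])); first exact: (erefl 5%N).
  by nf_check.
- apply: (iso_check (g := [:: [:: C0; C1; C0; C0; C0];
    [:: C0; C0; C0; C0; C1];
    [:: C1; C0; C0; C0; C0];
    [:: C0; C0; C1; C0; C0];
    [:: C0; C0; C0; C1; C0]])); first exact: (erefl 5%N).
  by nf_check.
- apply: (iso_check (g := [:: [:: C0; C1; C0; C0; C0];
    [:: C0; C0; C0; C0; C1];
    [:: C1; C0; C0; C0; C0];
    [:: C0; C0; C1; C0; C0];
    [:: C0; C0; C0; C1; C0]])); first exact: (erefl 5%N).
  by nf_check.
- apply: (iso_check (g := [:: [:: CE (- 1); C1; C0; C0; C0];
    [:: C0; C0; C0; C0; C1];
    [:: C1; C0; C0; C0; C0];
    [:: C0; C0; C1; C0; C0];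
    [:: C0; C0; C0; C1; C0]])); first exact: (erefl 5%N).
  by nf_check.
- apply: (iso_check (g := [:: [:: C1; C0; C0; C0; C0];
    [:: C0; C0; C0; C1; C0];
    [:: C0; C0; C1; C0; C0];
    [:: C0; C1; C0; C0; C0];
    [:: C0; C0; C0; C0; C1]])); first exact: (erefl 5%N).
  by nf_check.
- apply: (iso_check (g := [:: [:: C1; C0; C0; C0; C0];
    [:: C0; C0; C0; C1; C0];
    [:: C0; C0; C1; C0; C0];
    [:: C0; C1; C0; C0; C0];
    [:: C0; C0; C0; C0; C1]])); first exact: (erefl 5%N).
  by nf_check.
- apply: (iso_check (g := [:: [:: C1; C0; C0; C0; C0];
    [:: C0; C1; C0; C0; C0];
    [:: C0; C0; C0; C1; C0];
    [:: C0; C0; C1; C0; C0];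
    [:: C0; C0; C0; C0; C1]])); first exact: (erefl 5%N).
  by nf_check.
- apply: (iso_check (g := [:: [:: C1; C0; C0; C0; C0];
    [:: C0; C1; C0; C0; C0];
    [:: C0; C0; C0; C1; C0];
    [:: C0; C0; C1; C0; C0];
    [:: C0; C0; C0; C0; C1]])); first exact: (erefl 5%N).
  by nf_check.
- apply: (iso_check (g := [:: [:: C1; C0; C0; C0; C0];
    [:: C0; C1; C0; C0; C0];
    [:: C0; C0; C0; C1; C0];
    [:: C0; C0; C1; C0; C0];
    [:: C0; C0; C0; C0; C1]])); first exact: (erefl 5%N).
  by nf_check.
- apply: (iso_check (g := [:: [:: CE (- 1); C1; C0; C0; C0];
    [:: C0; C0; C0; C1; C0];
    [:: C1; C0; C0; C0; C0];
    [:: C0; C0; C1; C0; C0];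
    [:: C0; C0; C0; C0; C1]])); first exact: (erefl 5%N).
  by nf_check.
- apply: (iso_check (g := [:: [:: C0; C1; C0; C0; C0];
    [:: C0; C0; C0; C1; C0];
    [:: C1; C0; C0; C0; C0];
    [:: C0; C0; C1; C0; C0];
    [:: C0; C0; C0; C0; C1]])); first exact: (erefl 5%N).
  by nf_check.
- apply: (iso_check (g := [:: [:: C0; C1; C0; C0; C0];
    [:: C0; C0; C0; C1; C0];
    [:: C1; C0; C0; C0; C0];
    [:: C0; C0; C1; C0; C0];
    [:: C0; C0; C0; C0; C1]])); first exact: (erefl 5%N).
  by nf_check.
- apply: (iso_check (g := [:: [:: CE (- 1); C1; C0; C0; C0];
    [:: C0; C0; CE (- 1); C1; C0];
    [:: C1; C0; C0; C0; C0];
    [:: C0; C0; C1; C0; C0];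
    [:: C0; C0; C0; C0; C1]])); first exact: (erefl 5%N).
  by nf_check.
- apply: (iso_check (g := [:: [:: C0; C1; C0; C0; C0];
    [:: C0; C0; C0; C1; C0];
    [:: C1; C0; C0; C0; C0];
    [:: C0; C0; C1; C0; C0];
    [:: C0; C0; C0; C0; C1]])); first exact: (erefl 5%N).
  by nf_check.
- apply: (iso_check (g := [:: [:: C0; C0; C1; C0; C0];
    [:: C0; C1; C0; C0; C0];
    [:: C1; C0; C0; C0; C0];
    [:: C0; C0; C0; C1; C0];
    [:: C0; C0; C0; C0; C1]])); first exact: (erefl 5%N).
  by nf_check.
- apply: (iso_check (g := [:: [:: C0; C0; C1; C0; C0];
    [:: C0; C1; C0; C0; C0];
    [:: C1; C0; C0; C0; C0];
    [:: C0; C0; C0; C1; C0];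
    [:: C0; C0; C0; C0; C1]])); first exact: (erefl 5%N).
  by nf_check.
- apply: (iso_check (g := [:: [:: C0; C0; C1; C0; C0];
    [:: C0; C1; C0; C0; C0];
    [:: C1; C0; C0; C0; C0];
    [:: C0; C0; C0; C1; C0];
    [:: C0; C0; C0; C0; C1]])); first exact: (erefl 5%N).
  by nf_check.
- apply: (iso_check (g := [:: [:: C1; C0; C0; C0; C0];
    [:: C0; C1; C0; C0; C0];
    [:: C0; C0; C1; C0; C0];
    [:: C0; C0; C0; C1; C0];
    [:: C0; C0; C0; C0; C1]])); first exact: (erefl 5%N).
  by nf_check.
- apply: (iso_check (g := [:: [:: C1; C0; C0; C0; C0];
    [:: C0; C1; C0; C0; C0];
    [:: C0; C0; C1; C0; C0];
    [:: C0; C0; C0; C1; C0];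
    [:: C0; C0; C0; C0; C1]])); first exact: (erefl 5%N).
  by nf_check.
- apply: (iso_check (g := [:: [:: C1; C0; C0; C0; C0];
    [:: C0; C1; C0; C0; C0];
    [:: C0; C0; C1; C0; C0];
    [:: C0; C0; C0; C1; C0];
    [:: C0; C0; C0; C0; C1]])); first exact: (erefl 5%N).
  by nf_check.
Qed.

Lemma nfA_same l l' p p' : parA l = Some p -> parA l' = Some p' ->
  isomorphic (listed l) (listed l') -> l = l'.
Proof.
move=> lp lp' ll'.
have nassoc l1 q11 q12 q13 q22 q23 q33 r11 r12 r22 :
    parA l1 = Some (q11, q12, q13, q22, q23, q33, r11, r12, r22) ->
    ~ [/\ q11 = 0, q12 = 0, q13 = 0, q22 = 0 & q23 = 0].
  have one := @oner_neq0 F.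
  by case: l1 => //= -[<- <- <- <- <- _ _ _ _] [] /eqP; rewrite ?oppr_eq0 ?(negbTE two) ?(negbTE one)
    // => _ /eqP; rewrite ?(negbTE one) // => _ /eqP; rewrite ?(negbTE one).
have imp l1 l2 q q' : parA l1 = Some q -> parA l2 = Some q' ->
    isomorphic (listed l1) (listed l2) ->
    forall i, nth false (nfA_code l2) i -> nth false (nfA_code l1) i.
  move=> l1q l2q l12; rewrite -(codeA_nf l1q) -(codeA_nf l2q).
  have := isomorphic_trans (listed_nfA l1q)
    (isomorphic_trans l12 (isomorphic_sym (listed_nfA l2q))).
  move: q q' l1q l2q {l12} => [[[[[[[[q11 q12] q13] q22] q23] q33] r11] r12] r22].
  move=> [[[[[[[[p11 p12] p13] p22] p23] p33] s11] s12] s22] l1q l2q.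
  by move/(relA_iso)/(_ (nassoc _ _ _ _ _ _ _ _ _ _ l1q))/codeA_rel.
have I := imp _ _ _ _ lp lp' ll'.
have I' := imp _ _ _ _ lp' lp (isomorphic_sym ll').
move: lp lp' (I 0%N) (I 1%N) (I 2%N) (I 3%N) (I 4%N) (I 5%N) (I 6%N) (I 7%N) (I 8%N) (I 9%N)
 (I' 0%N) (I' 1%N) (I' 2%N) (I' 3%N) (I' 4%N) (I' 5%N) (I' 6%N) (I' 7%N) (I' 8%N) (I' 9%N).
clear; case: l => //=; case: l' => //= *;
  exfalso; solve [repeat match goal with H : true -> is_true _ |- _ => move: (H isT) => {}H end; discriminate | auto].
Qed.

End SeparationA.

(** * Reduction to normal form when dim J^<2> = 2 *)

Section ClassifyA.

Variable F : fieldType.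
Hypothesis two : 2 != 0 :> F.
Hypothesis sqrtF : forall x : F, exists y, y ^+ 2 = x.

Local Notation lTA q11 q12 q13 q22 q23 q33 r11 r12 r22 :=
  (listable (F := F) (talg (TA (F := F) q11 q12 q13 q22 q23 q33 r11 r12 r22))) (only parsing).

Lemma relA_listable q11 q12 q13 q22 q23 q33 r11 r12 r22 p11 p12 p13 p22 p23 p33 s11 s12 s22 :
  relA q11 q12 q13 q22 q23 q33 r11 r12 r22 p11 p12 p13 p22 p23 p33 s11 s12 s22 ->
  lTA q11 q12 q13 q22 q23 q33 r11 r12 r22 -> lTA p11 p12 p13 p22 p23 p33 s11 s12 s22.
Proof. by move/(iso_relA two)/listable_iso. Qed.

Lemma parA_listable (l : name F) p : parA l = Some p -> listable (talg (TAof p)).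
Proof.
move=> lp; exists l; split; first by case: l lp.
exact: listed_nfA lp.
Qed.

(* A change of basis prescribed by its effect on q: r becomes whatever it is. *)
Lemma changeQ a b c d x y h s q11 q12 q13 q22 q23 q33 p11 p12 p13 p22 p23 p33 s11 s12 s22 :
  h != 0 -> s != 0 -> a * d - b * c != 0 ->
  [/\ s * q11 = a ^+ 2 * p11 + 2 * a * b * p12 + b ^+ 2 * p22,
      s * q12 = a * c * p11 + (a * d + b * c) * p12 + b * d * p22,
      s * q22 = c ^+ 2 * p11 + 2 * c * d * p12 + d ^+ 2 * p22,
      s * q13 = a * x * p11 + (a * y + b * x) * p12 + b * y * p22
                + h * (a * p13 + b * p23) &
      s * q23 = c * x * p11 + (c * y + d * x) * p12 + d * y * p22
                + h * (c * p13 + d * p23)] ->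
  s * q33 = x ^+ 2 * p11 + 2 * x * y * p12 + y ^+ 2 * p22
                + 2 * h * (x * p13 + y * p23) + h ^+ 2 * p33 ->
  (forall r11 r12 r22, lTA q11 q12 q13 q22 q23 q33 r11 r12 r22) ->
  lTA p11 p12 p13 p22 p23 p33 s11 s12 s22.
Proof.
move=> h0 s0 D0 E E33 H.
pose r11 := (a ^+ 2 * s11 + 2 * a * b * s12 + b ^+ 2 * s22) / (s * h).
pose r12 := (a * c * s11 + (a * d + b * c) * s12 + b * d * s22) / (s * h).
pose r22 := (c ^+ 2 * s11 + 2 * c * d * s12 + d ^+ 2 * s22) / (s * h).
apply: relA_listable (H r11 r12 r22).
exists a, b, c, d, x, y, h, s, 0; split=> //; split=> //.
by split=> //; rewrite mul0r add0r mulrC divfK // mulf_neq0.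
Qed.

Ltac relA_with a b c d x y h s t :=
  exists a, b, c, d, x, y, h, s, t; split; [split | split; split];
  first [by fielda | by rewrite ?(mulr0, mul0r, mulr1, mul1r, subr0, sub0r); nz | idtac].

(** In [class_A11], [class_A20], [class_A21], [class_A22], [class_A31], [class_A32] the digits are
    the rank of q and the rank of its restriction to the span of 0 and 1; with q fixed, only r
    remains to be normalised. The pair (1, 0) is absent since it gives associative algebras. *)
Lemma class_A11 s11 s12 s22 : lTA 1 0 0 0 0 0 s11 s12 s22.
Proof.
have [z22|n22] := eqVneq s22 0; last first.
  apply: relA_listable (@parA_listable (J5_5 _) _ erefl).
  (* The first vector is made r-orthogonal to the second, [h] scales r22 to 1, and [t] absorbs r11
     because q11 = 1. *)
  relA_with (1 : F) (- s12 / s22) (0 : F) (1 : F) (0 : F) (0 : F) s22 (1 : F)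
    (s11 - s12 ^+ 2 / s22).
subst s22; have [z12|n12] := eqVneq s12 0.
  subst s12; apply: relA_listable (@parA_listable (J5_1 _) _ erefl).
  relA_with (1 : F) (0 : F) (0 : F) (1 : F) (0 : F) (0 : F) (1 : F) (1 : F) s11.
apply: relA_listable (@parA_listable (J5_6 _) _ erefl).
relA_with (1 : F) (0 : F) (0 : F) (1 : F) (0 : F) (0 : F) s12 (1 : F) s11.
Qed.

Lemma class_A20 s11 s12 s22 : lTA 0 0 1 0 0 0 s11 s12 s22.
Proof.
have [z22|n22] := eqVneq s22 0; last first.
  (* [m] is the determinant of r divided by [s22]: its vanishing distinguishes [J5_11] from
     [J5_12]. *)
  have [m E] : exists m, s11 = m + s12 ^+ 2 / s22.
    by exists (s11 - s12 ^+ 2 / s22); rewrite subrK.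
  subst s11; have [m0|m0] := eqVneq m 0.
    subst m; apply: relA_listable (@parA_listable (J5_11 _) _ erefl).
    by relA_with s22 (- s12) (0 : F) (1 : F) (0 : F) (0 : F) (1 : F) s22 (0 : F).
  have [z z2] := sqrtF (m * s22).
  have z0 : z != 0 by rewrite -sqrf_eq0 z2 mulf_neq0.
  apply: relA_listable (@parA_listable (J5_12 _) _ erefl).
  relA_with (1 / m) (- s12 / s22 / m) (0 : F) (1 / z) (0 : F) (0 : F) (1 : F) (1 / m) (0 : F).
  by lcf (1 / z ^+ 2 / m) z2.
subst s22; have [z12|n12] := eqVneq s12 0; last first.
  apply: relA_listable (@parA_listable (J5_14 _) _ erefl).
  by relA_with (1 : F) (- s11 / (2 * s12)) (0 : F) (1 / s12) (0 : F) (0 : F) (1 : F) (1 : F) (0 : F).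
subst s12; have [z11|n11] := eqVneq s11 0.
  by subst s11; apply: (@parA_listable (J5_2 _) _ erefl).
apply: relA_listable (@parA_listable (J5_3 _) _ erefl).
by relA_with (1 / s11) (0 : F) (0 : F) (1 : F) (0 : F) (0 : F) (1 : F) (1 / s11) (0 : F).
Qed.

Lemma class_A21 s11 s12 s22 : lTA (- 2) 0 1 0 0 0 s11 s12 s22.
Proof.
have [z22|n22] := eqVneq s22 0; last first.
  apply: relA_listable (@parA_listable (J5_10 _) _ erefl).
  by relA_with s22 (- s12) (0 : F) s22 (0 : F) (0 : F) s22 (s22 ^+ 2)
    (- (s22 ^+ 2 * s11 - 2 * s22 * s12 * s12 + s12 ^+ 2 * s22) / 2).
subst s22; have [z12|n12] := eqVneq s12 0.
  subst s12; apply: relA_listable (@parA_listable (J5_4 _) _ erefl).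
  by relA_with (1 : F) (0 : F) (0 : F) (1 : F) (0 : F) (0 : F) (1 : F) (1 : F) (- s11 / 2).
apply: relA_listable (@parA_listable (J5_13 _) _ erefl).
by relA_with (1 : F) (0 : F) (0 : F) (- 1 / s12) (0 : F) (0 : F) (1 : F) (1 : F) (- s11 / 2).
Qed.

Lemma class_A22 s11 s12 s22 : lTA 0 1 0 0 0 0 s11 s12 s22.
Proof.
have [z11|n11] := eqVneq s11 0; have [z22|n22] := eqVneq s22 0.
- subst s11 s22; apply: relA_listable (@parA_listable (J5_7 _) _ erefl).
  by relA_with (1 : F) (0 : F) (0 : F) (1 : F) (0 : F) (0 : F) (1 : F) (1 : F) s12.
- subst s11; apply: relA_listable (@parA_listable (J5_8 _) _ erefl).
  by relA_with (0 : F) (1 : F) (1 : F) (0 : F) (0 : F) (0 : F) s22 (1 : F) s12.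
- subst s22; apply: relA_listable (@parA_listable (J5_8 _) _ erefl).
  by relA_with (1 : F) (0 : F) (0 : F) (1 : F) (0 : F) (0 : F) s11 (1 : F) s12.
have [h h2] := sqrtF (s11 * s22).
have h0 : h != 0 by rewrite -sqrf_eq0 h2 mulf_neq0.
apply: relA_listable (@parA_listable (J5_9 _) _ erefl).
relA_with (1 : F) (0 : F) (0 : F) (s11 / h) (0 : F) (0 : F) h (s11 / h) (s11 * s12 / h).
by lcf (s11 / h ^+ 2) h2.
Qed.

Lemma class_A31 s11 s12 s22 : lTA 1 0 0 0 1 0 s11 s12 s22.
Proof.
have [z22|n22] := eqVneq s22 0; last first.
  apply: relA_listable (@parA_listable (J5_18 _) _ erefl).
  by relA_with s22 (- s12) (0 : F) s22 s12 (- s12 ^+ 2 / (2 * s22)) s22 (s22 ^+ 2)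
    (s22 ^+ 2 * s11 - 2 * s22 * s12 * s12 + s12 ^+ 2 * s22).
subst s22; have [z12|n12] := eqVneq s12 0.
  subst s12; apply: relA_listable (@parA_listable (J5_16 _) _ erefl).
  by relA_with (1 : F) (0 : F) (0 : F) (1 : F) (0 : F) (0 : F) (1 : F) (1 : F) s11.
apply: relA_listable (@parA_listable (J5_17 _) _ erefl).
by relA_with s12 (0 : F) (0 : F) s12 (0 : F) (0 : F) s12 (s12 ^+ 2) (s12 ^+ 2 * s11).
Qed.

Lemma class_A32 s11 s12 s22 : lTA 0 1 0 0 0 1 s11 s12 s22.
Proof.
have [z11|n11] := eqVneq s11 0; have [z22|n22] := eqVneq s22 0.
- subst s11 s22; apply: relA_listable (@parA_listable (J5_19 _) _ erefl).
  by relA_with (1 : F) (0 : F) (0 : F) (1 : F) (0 : F) (0 : F) (1 : F) (1 : F) s12.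
- subst s11; apply: relA_listable (@parA_listable (J5_20 _) _ erefl).
  by relA_with (0 : F) s22 s22 (0 : F) (0 : F) (0 : F) s22 (s22 ^+ 2) (s22 ^+ 2 * s12).
- subst s22; apply: relA_listable (@parA_listable (J5_20 _) _ erefl).
  by relA_with s11 (0 : F) (0 : F) s11 (0 : F) (0 : F) s11 (s11 ^+ 2) (s11 ^+ 2 * s12).
have [h h2] := sqrtF (s11 * s22).
have h0 : h != 0 by rewrite -sqrf_eq0 h2 mulf_neq0.
have [a a2] := sqrtF (h ^+ 3 / s11).
have a0 : a != 0 by rewrite -sqrf_eq0 a2; nz.
apply: relA_listable (@parA_listable (J5_21 _) _ erefl).
relA_with a (0 : F) (0 : F) (h ^+ 2 / a) (0 : F) (0 : F) h (h ^+ 2) (h ^+ 2 * s12).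
- by lcf (- s11) a2.
- rewrite !(mulr0, mul0r, add0r).
  have -> : (h ^+ 2 / a) ^+ 2 = h * s11 by rewrite expr_div_n a2; fielda.
  by lcf h h2.
Qed.

Lemma class_TA_diag p13 p23 p33 s11 s12 s22 : lTA 1 0 p13 0 p23 p33 s11 s12 s22.
Proof.
have [z23|n23] := eqVneq p23 0; last first.
  apply: (changeQ (a := 1) (b := - p13 / p23) (c := 0) (d := 1 / p23) (x := 0)
    (y := - p33 / (2 * p23)) (h := 1) (s := 1)) (class_A31); try split; try by fielda.
  - by rewrite oner_neq0.
  - by rewrite oner_neq0.
  - by rewrite mulr0 subr0; nz.
subst p23; have [k0|k0] := eqVneq (p33 - p13 ^+ 2) 0.
  apply: (changeQ (a := 1) (b := 0) (c := 0) (d := 1) (x := - p13)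
    (y := 0) (h := 1) (s := 1)) (class_A11); try split; try by fielda.
  - by rewrite oner_neq0.
  - by rewrite oner_neq0.
  - by rewrite mulr0 subr0; nz.
  - by lcf (- 1) k0.
have four : 4 != 0 :> F by rewrite (_ : 4 = 2 * 2); [rewrite mulf_neq0 | ring].
(* q33 has to vanish in the normal form, which for the chosen [x] reads 1/4 + h^2 (p33 - p13^2) = 0;
   q11 = - 2 forces s = - 1/2. *)
have [h h2] := sqrtF (- 1 / (4 * (p33 - p13 ^+ 2))).
have h0 : h != 0 by rewrite -sqrf_eq0 h2; nz.
apply: (changeQ (a := 1) (b := 0) (c := 0) (d := 1) (x := - 1 / 2 - h * p13)
    (y := 0) (h := h) (s := - 1 / 2)) (class_A21); try split; try by fielda.
- by [].
- by nz.
- by rewrite mulr0 subr0; nz.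
- by lcf (- (p33 - p13 ^+ 2)) h2.
Qed.

Lemma class_TA_hyper p13 p23 p33 s11 s12 s22 : lTA 0 1 p13 0 p23 p33 s11 s12 s22.
Proof.
(* The vector 2 - p23 0 - p13 1 is q-orthogonal to 0 and 1, and this is the value of q on it. *)
have [k0|k0] := eqVneq (p33 - 2 * p13 * p23) 0.
  apply: (changeQ (a := 1) (b := 0) (c := 0) (d := 1) (x := - p23)
    (y := - p13) (h := 1) (s := 1)) (class_A22); try split; try by fielda.
  - by rewrite oner_neq0.
  - by rewrite oner_neq0.
  - by rewrite mulr0 subr0; nz.
  - by lcf (- 1) k0.
have [h h2] := sqrtF (1 / (p33 - 2 * p13 * p23)).
have h0 : h != 0 by rewrite -sqrf_eq0 h2; nz.
apply: (changeQ (a := 1) (b := 0) (c := 0) (d := 1) (x := - h * p23)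
    (y := - h * p13) (h := h) (s := 1)) (class_A32); try split; try by fielda.
- by [].
- by rewrite oner_neq0.
- by rewrite mulr0 subr0; nz.
- by lcf (- (p33 - 2 * p13 * p23)) h2.
Qed.

Lemma class_TA_rank1 a b c d p11 p12 p13 p22 p23 p33 s11 s12 s22 :
  a ^+ 2 * p11 + 2 * a * b * p12 + b ^+ 2 * p22 != 0 -> a * d - b * c != 0 ->
  a * c * p11 + (a * d + b * c) * p12 + b * d * p22 = 0 ->
  c ^+ 2 * p11 + 2 * c * d * p12 + d ^+ 2 * p22 = 0 ->
  lTA p11 p12 p13 p22 p23 p33 s11 s12 s22.
Proof.
set s := a ^+ 2 * p11 + _ + _ => s0 D0 E12 E22.
apply: (changeQ (a := a) (b := b) (c := c) (d := d) (x := 0) (y := 0) (h := 1) (s := s)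
  (q13 := (a * p13 + b * p23) / s) (q23 := (c * p13 + d * p23) / s) (q33 := p33 / s)
  (q11 := 1) (q12 := 0) (q22 := 0)) => //.
- exact: oner_neq0.
- split; [by rewrite mulr1 | by rewrite E12 mulr0 | by rewrite E22 mulr0 | by fielda | by fielda].
- by fielda.
by move=> *; apply: class_TA_diag.
Qed.

Lemma class_TA_rank2 a b c d p11 p12 p13 p22 p23 p33 s11 s12 s22 :
  a * c * p11 + (a * d + b * c) * p12 + b * d * p22 != 0 -> a * d - b * c != 0 ->
  a ^+ 2 * p11 + 2 * a * b * p12 + b ^+ 2 * p22 = 0 ->
  c ^+ 2 * p11 + 2 * c * d * p12 + d ^+ 2 * p22 = 0 ->
  lTA p11 p12 p13 p22 p23 p33 s11 s12 s22.
Proof.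
set s := a * c * p11 + _ + _ => s0 D0 E11 E22.
apply: (changeQ (a := a) (b := b) (c := c) (d := d) (x := 0) (y := 0) (h := 1) (s := s)
  (q13 := (a * p13 + b * p23) / s) (q23 := (c * p13 + d * p23) / s) (q33 := p33 / s)
  (q11 := 0) (q12 := 1) (q22 := 0)) => //.
- exact: oner_neq0.
- split; [by rewrite E11 mulr0 | by rewrite mulr1 | by rewrite E22 mulr0 | by fielda | by fielda].
- by fielda.
by move=> *; apply: class_TA_hyper.
Qed.

Lemma class_TA p11 p12 p13 p22 p23 p33 s11 s12 s22 :
  ~ [/\ p11 = 0, p12 = 0, p13 = 0, p22 = 0 & p23 = 0] ->
  lTA p11 p12 p13 p22 p23 p33 s11 s12 s22.
Proof.
move=> nQ; have [dK|dK] := eqVneq (p12 ^+ 2 - p11 * p22) 0.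
  have [z11|n11] := eqVneq p11 0; last first.
    (* (- p12, p11) spans the radical of the restricted form. *)
    apply: (@class_TA_rank1 1 0 (- p12) p11).
    - by rewrite (_ : _ + _ = p11) //; ring.
    - by rewrite mul0r subr0 mul1r.
    - by ring.
    - by lc (- p11) dK.
  subst p11; have z12 : p12 = 0 by apply/eqP; rewrite -sqrf_eq0 -dK mul0r subr0.
  subst p12; have [z22|n22] := eqVneq p22 0; last first.
    apply: (@class_TA_rank1 0 1 1 0).
    - by rewrite (_ : _ + _ = p22) //; ring.
    - by rewrite (_ : _ - _ = - 1); [nz | ring].
    - by ring.
    - by ring.
  subst p22; have [z13|n13] := eqVneq p13 0.
    have n23 : p23 != 0 by apply/eqP=> z23; apply: nQ.
    subst p13; apply: (changeQ (a := 0) (b := 1 / p23) (c := - p23) (d := 0) (x := 0)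
      (y := - p33 / (2 * p23)) (h := 1) (s := 1)) (class_A20); try split; try by fielda.
    - exact: oner_neq0.
    - exact: oner_neq0.
    by rewrite (_ : _ - _ = 1) ?oner_neq0 //; fielda.
  apply: (changeQ (a := 1 / p13) (b := 0) (c := - p23) (d := p13) (x := - p33 / (2 * p13))
      (y := 0) (h := 1) (s := 1)) (class_A20); try split; try by fielda.
  - exact: oner_neq0.
  - exact: oner_neq0.
  by rewrite (_ : _ - _ = 1) ?oner_neq0 //; fielda.
have [z11|n11] := eqVneq p11 0.
  subst p11; have n12 : p12 != 0.
    by apply: contraNneq dK => ->; rewrite mul0r subr0 expr0n.
  apply: (@class_TA_rank2 1 0 (- p22 / (2 * p12)) 1).
  - by rewrite (_ : _ + _ = p12) //; ring.
  - by rewrite mul0r subr0 mul1r oner_neq0.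
  - by ring.
  - by fielda.
have [z z2] := sqrtF (p12 ^+ 2 - p11 * p22).
have z0 : z != 0 by rewrite -sqrf_eq0 z2.
(* The isotropic vectors (T, 1), with T the roots of p11 T^2 + 2 p12 T + p22. *)
apply: (@class_TA_rank2 ((- p12 + z) / p11) 1 ((- p12 - z) / p11) 1).
- rewrite (_ : _ + _ = - 2 * z ^+ 2 / p11); first by nz.
  by lcf (1 / p11) z2.
- rewrite (_ : _ * 1 - _ = 2 * z / p11); first by nz.
  by fielda.
- by lcf (1 / p11) z2.
by lcf (1 / p11) z2.
Qed.

Definition GA (q11 q12 q13 q22 q23 q33 r11 r12 r13 r22 r23 r33 : F) : stable F :=
  [:: (i0, i0, [:: C0; C0; C0; CE q11; CE r11]);
      (i0, i1, [:: C0; C0; C0; CE q12; CE r12]);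
      (i0, i2, [:: C0; C0; C0; CE q13; CE r13]);
      (i1, i1, [:: C0; C0; C0; CE q22; CE r22]);
      (i1, i2, [:: C0; C0; C0; CE q23; CE r23]);
      (i2, i2, [:: C0; C0; C0; CE q33; CE r33]);
      (i2, i3, [:: C0; C0; C0; C0; C1])].

(** As 2∘3 = 4, adding multiples of 3 to the generators removes r13, r23 and r33. If q11, q12, q13,
    q22 and q23 all vanish, the algebra is associative. *)
Lemma class_GA q11 q12 q13 q22 q23 q33 r11 r12 r13 r22 r23 r33 :
  ~ is_assoc (talg (GA q11 q12 q13 q22 q23 q33 r11 r12 r13 r22 r23 r33)) ->
  listable (talg (GA q11 q12 q13 q22 q23 q33 r11 r12 r13 r22 r23 r33)).
Proof.
move=> nassoc; have nQ : ~ [/\ q11 = 0, q12 = 0, q13 = 0, q22 = 0 & q23 = 0].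
  case=> z11 z12 z13 z22 z23; apply: nassoc; apply: assoc_check.
  by subst; rewrite /GA; sym; conjs ltac:(ring).
apply: listable_iso (class_TA q33 r11 r12 r22 nQ).
apply: (iso_check (g := [:: [:: C1; C0; C0; CE (- r13)]; [:: C0; C1; C0; CE (- r23)];
  [:: C0; C0; C1; CE (- r33 / 2)]; [:: C0; C0; C0; C1]; [:: C0; C0; C0; C0; C1]]));
  first exact: (erefl 5%N).
by rewrite /GA /TA; sym; split; [conjs ltac:(fielda) | exact/eqP/oner_neq0].
Qed.

End ClassifyA.

(** * Algebras with dim J^<2> = 3 and dim J^<3> = 1 *)

Section TypeB.

Variable F : fieldType.
Hypothesis two : 2 != 0 :> F.

(* The vectors 0, 1 span J modulo J^<2>, 2, 3, 4 span J^<2> and 4 spans J^<3>.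
   The kernel of the product S^2 (J / J^<2>) -> J^<2> / J^<3> is spanned by the
   square of 1 in TB1 and by the product of 0 and 1 in TB2. *)
Definition TB1 (p q r s rho : F) : stable F :=
  [:: (i0, i0, [:: C0; C0; C1]); (i0, i1, [:: C0; C0; C0; C1]);
      (i1, i1, [:: C0; C0; C0; C0; CE rho]);
      (i0, i2, [:: C0; C0; C0; C0; CE p]); (i0, i3, [:: C0; C0; C0; C0; CE q]);
      (i1, i2, [:: C0; C0; C0; C0; CE r]); (i1, i3, [:: C0; C0; C0; C0; CE s])].

Definition TB2 (p q r s : F) : stable F :=
  [:: (i0, i0, [:: C0; C0; C1]); (i1, i1, [:: C0; C0; C0; C1]);
      (i0, i2, [:: C0; C0; C0; C0; CE p]); (i0, i3, [:: C0; C0; C0; C0; CE q]);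
      (i1, i2, [:: C0; C0; C0; C0; CE r]); (i1, i3, [:: C0; C0; C0; C0; CE s])].

(** Modulo the remaining terms 0 goes to x 0 + y 1, 1 to z 1 + m 2 + n 3 and 4 to w 4: the line of 1
    is preserved because its square lies in J^<3>. The coefficient [rho] can be moved by [m] and [n]
    unless r' = s' = 0. *)
Definition relB1 (p q r s rho p' q' r' s' rho' : F) : Prop :=
  exists x y z w m n : F,
  [/\ x != 0, z != 0 & w != 0] /\
  [/\ w * p = x ^+ 3 * p' + x ^+ 2 * y * (2 * q' + r') + 2 * x * y ^+ 2 * s',
      w * q = x * z * (x * q' + y * s'),
      w * r = x * z * (x * r' + 2 * y * s'),
      w * s = x * z ^+ 2 * s' &
      w * rho = z ^+ 2 * rho' + 2 * z * (m * r' + n * s')].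

Lemma iso_relB1 p q r s rho p' q' r' s' rho' :
  relB1 p q r s rho p' q' r' s' rho' ->
  isomorphic (talg (TB1 p q r s rho)) (talg (TB1 p' q' r' s' rho')).
Proof.
move=> [x [y [z [w [m [n [[x0 z0 w0] [Ep Eq Er Es Erho]]]]]]]].
apply: (iso_check (g := [:: [:: CE x; CE y]; [:: C0; CE z; CE m; CE n];
  [:: C0; C0; CE (x ^+ 2); CE (2 * x * y); CE (y ^+ 2 * rho')];
  [:: C0; C0; C0; CE (x * z);
    CE (y * z * rho' + x * (m * p' + n * q') + y * (m * r' + n * s'))];
  [:: C0; C0; C0; C0; CE w]])); first exact: (erefl 5%N).
rewrite /TB1; sym; split; last by apply/eqP; nz.
by conjs ltac:(first [by ring | lcany]).
Qed.

(* For the four products of 0, 1 by 2, 3 to vanish J^<3> has to vanish. *)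
Lemma relB1_iso p q r s rho p' q' r' s' rho' :
  isomorphic (talg (TB1 p q r s rho)) (talg (TB1 p' q' r' s' rho')) ->
  ~ [/\ p = 0, q = 0, r = 0 & s = 0] ->
  relB1 p q r s rho p' q' r' s' rho'.
Proof.
move=> H nM; coords H; unfold TB1 in H.
entry E H k0 k0 k0; subst a20; entry E H k0 k0 k1; subst a21.
entry E H k0 k1 k0; subst a30; entry E H k0 k1 k1; subst a31; zeros H.
have z (u : F) : [/\ p * u = 0, q * u = 0, r * u = 0 & s * u = 0] -> u = 0.
  case=> Ep Eq Er Es; case: (eqVneq u 0) => // u0; case: nM.
  by split; apply: (mul0_neq u0); rewrite mulrC.
have z40 : a40 = 0.
  by apply: z; split; [entry E H k0 k2 k0|entry E H k0 k3 k0|entry E H k1 k2 k0|entry E H k1 k3 k0].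
have z41 : a41 = 0.
  by apply: z; split; [entry E H k0 k2 k1|entry E H k0 k3 k1|entry E H k1 k2 k1|entry E H k1 k3 k1].
have z42 : a42 = 0.
  by apply: z; split; [entry E H k0 k2 k2|entry E H k0 k3 k2|entry E H k1 k2 k2|entry E H k1 k3 k2].
have z43 : a43 = 0.
  by apply: z; split; [entry E H k0 k2 k3|entry E H k0 k3 k3|entry E H k1 k2 k3|entry E H k1 k3 k3].
subst a40 a41 a42 a43; zeros H.
(* The square of 1 lies in the span of 4, hence so does the square of its image; the coordinate of
   the latter along 2 is a10^2. *)
entry E112 H k1 k1 k2.
have z10 : a10 = 0 by apply/eqP; rewrite -sqrf_eq0 expr2 E112.
subst a10; zeros H.
entry E002 H k0 k0 k2; entry E003 H k0 k0 k3; entry E012 H k0 k1 k2; entry E013 H k0 k1 k3.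
subst a22 a23 a32 a33; zeros H.
have D := is_iso_det H; sym in D.
have x0 : a00 != 0 by apply/eqP=> x0; apply: D; rewrite x0; ring.
have z0 : a11 != 0 by apply/eqP=> z0; apply: D; rewrite z0; ring.
have w0 : a44 != 0 by apply/eqP=> w0; apply: D; rewrite w0; ring.
exists a00, a01, a11, a44, a12, a13; split=> //.
entry E024 H k0 k2 k4; entry E034 H k0 k3 k4; entry E124 H k1 k2 k4.
entry E134 H k1 k3 k4; entry E114 H k1 k1 k4.
by split; [lc (- 1) E024|lc (- 1) E034|lc (- 1) E124|lc (- 1) E134|lc (- 1) E114].
Qed.

(** In [TB1] a vector outside J^<2> has its square in J^<3>. In [TB2] the square of x 0 + y 1 is x^2
    2 + y^2 3 modulo J^<3>, so that no such vector exists. *)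
Lemma TB1_TB2 p q r s rho p' q' r' s' : ~ [/\ p = 0, q = 0, r = 0 & s = 0] ->
  ~ isomorphic (talg (TB1 p q r s rho)) (talg (TB2 p' q' r' s')).
Proof.
move=> nM H; coords H; unfold TB1, TB2 in H.
entry E H k0 k0 k0; subst a20; entry E H k0 k0 k1; subst a21.
entry E H k0 k1 k0; subst a30; entry E H k0 k1 k1; subst a31; zeros H.
have z (u : F) : [/\ p * u = 0, q * u = 0, r * u = 0 & s * u = 0] -> u = 0.
  case=> Ep Eq Er Es; case: (eqVneq u 0) => // u0; case: nM.
  by split; apply: (mul0_neq u0); rewrite mulrC.
have z42 : a42 = 0.
  by apply: z; split; [entry E H k0 k2 k2|entry E H k0 k3 k2|entry E H k1 k2 k2|entry E H k1 k3 k2].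
have z43 : a43 = 0.
  by apply: z; split; [entry E H k0 k2 k3|entry E H k0 k3 k3|entry E H k1 k2 k3|entry E H k1 k3 k3].
subst a42 a43; zeros H.
entry E2 H k1 k1 k2; entry E3 H k1 k1 k3.
have z10 : a10 = 0 by apply/eqP; rewrite -sqrf_eq0 expr2; apply/eqP; rewrite E2; ring.
have z11 : a11 = 0 by apply/eqP; rewrite -sqrf_eq0 expr2; apply/eqP; rewrite E3; ring.
subst a10 a11; zeros H.
have z40 : a40 = 0.
  by apply: z; split; [entry E H k0 k2 k0|entry E H k0 k3 k0|entry E H k1 k2 k0|entry E H k1 k3 k0].
have z41 : a41 = 0.
  by apply: z; split; [entry E H k0 k2 k1|entry E H k0 k3 k1|entry E H k1 k2 k1|entry E H k1 k3 k1].
subst a40 a41; zeros H.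
by have := is_iso_det H; sym; apply; ring.
Qed.

Definition relB2 (p q r s p' q' r' s' : F) : Prop :=
  exists x z w : F,
  [/\ x != 0, z != 0 & w != 0] /\
  [/\ w * p = x ^+ 3 * p', w * q = x * z ^+ 2 * q',
      w * r = z * x ^+ 2 * r' & w * s = z ^+ 3 * s'].

Lemma iso_relB2 p q r s p' q' r' s' : relB2 p q r s p' q' r' s' ->
  isomorphic (talg (TB2 p q r s)) (talg (TB2 p' q' r' s')).
Proof.
move=> [x [z [w [[x0 z0 w0] [Ep Eq Er Es]]]]].
apply: (iso_check (g := [:: [:: CE x]; [:: C0; CE z];
  [:: C0; C0; CE (x ^+ 2)]; [:: C0; C0; C0; CE (z ^+ 2)];
  [:: C0; C0; C0; C0; CE w]])); first exact: (erefl 5%N).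
rewrite /TB2; sym; split; last by apply/eqP; nz.
by conjs ltac:(first [by ring | lcany]).
Qed.

Lemma TB2_swap p q r s : isomorphic (talg (TB2 p q r s)) (talg (TB2 s r q p)).
Proof.
apply: (iso_check (g := [:: [:: C0; C1]; [:: C1]; [:: C0; C0; C0; C1];
  [:: C0; C0; C1]; [:: C0; C0; C0; C0; C1]])); first exact: (erefl 5%N).
by rewrite /TB2; sym; split; [conjs ltac:(ring) | apply/eqP; nz].
Qed.

(** The images of 0 and 1 have product zero modulo J^<3>, that is a00 a10 = a01 a11 = 0: modulo
    J^<2> they are multiples of the two generators, in one order or the other. *)
Lemma relB2_iso p q r s p' q' r' s' :
  isomorphic (talg (TB2 p q r s)) (talg (TB2 p' q' r' s')) ->
  ~ [/\ p = 0, q = 0, r = 0 & s = 0] ->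
  relB2 p q r s p' q' r' s' \/ relB2 p q r s s' r' q' p'.
Proof.
move=> H nM; coords H; unfold TB2 in H.
entry E H k0 k0 k0; subst a20; entry E H k0 k0 k1; subst a21.
entry E H k1 k1 k0; subst a30; entry E H k1 k1 k1; subst a31; zeros H.
have z (u : F) : [/\ p * u = 0, q * u = 0, r * u = 0 & s * u = 0] -> u = 0.
  case=> Ep Eq Er Es; case: (eqVneq u 0) => // u0; case: nM.
  by split; apply: (mul0_neq u0); rewrite mulrC.
have z40 : a40 = 0.
  by apply: z; split; [entry E H k0 k2 k0|entry E H k0 k3 k0|entry E H k1 k2 k0|entry E H k1 k3 k0].
have z41 : a41 = 0.
  by apply: z; split; [entry E H k0 k2 k1|entry E H k0 k3 k1|entry E H k1 k2 k1|entry E H k1 k3 k1].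
have z42 : a42 = 0.
  by apply: z; split; [entry E H k0 k2 k2|entry E H k0 k3 k2|entry E H k1 k2 k2|entry E H k1 k3 k2].
have z43 : a43 = 0.
  by apply: z; split; [entry E H k0 k2 k3|entry E H k0 k3 k3|entry E H k1 k2 k3|entry E H k1 k3 k3].
subst a40 a41 a42 a43; zeros H.
entry E002 H k0 k0 k2; entry E003 H k0 k0 k3; entry E112 H k1 k1 k2; entry E113 H k1 k1 k3.
subst a22 a23 a32 a33.
entry E012 H k0 k1 k2; entry E013 H k0 k1 k3.
have D := is_iso_det H; sym in D.
have w0 : a44 != 0 by apply/eqP=> w0; apply: D; rewrite w0; ring.
have [x0|x0] := eqVneq a00 0.
  subst a00; have y0 : a01 != 0 by apply/eqP=> y0; apply: D; rewrite y0; ring.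
  have z11 := mul0_neq y0 E013; subst a11; zeros H.
  have z0 : a10 != 0 by apply/eqP=> z0; apply: D; rewrite z0; ring.
  right; exists a01, a10, a44; split=> //.
  entry E024 H k0 k2 k4; entry E034 H k0 k3 k4; entry E124 H k1 k2 k4; entry E134 H k1 k3 k4.
  by split; [lc (- 1) E024|lc (- 1) E034|lc (- 1) E124|lc (- 1) E134].
have z10 := mul0_neq x0 E012; subst a10; zeros H.
have z0 : a11 != 0 by apply/eqP=> z0; apply: D; rewrite z0; ring.
have z01 := mul0_neq z0 (etrans (mulrC _ _) E013); subst a01; zeros H.
left; exists a00, a11, a44; split=> //.
entry E024 H k0 k2 k4; entry E034 H k0 k3 k4; entry E124 H k1 k2 k4; entry E134 H k1 k3 k4.
by split; [lc (- 1) E024|lc (- 1) E034|lc (- 1) E124|lc (- 1) E134].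
Qed.

End TypeB.

(** * Separation of the algebras with dim J^<2> = 3 and dim J^<3> = 1 *)

Section SeparationB.

Variable F : fieldType.
Hypothesis two : 2 != 0 :> F.

Definition nfB1 (l : name F) (t : F * F * F * F * F) : Prop :=
  match l with
  | J5_23 al => t = (1, 0, al, 1, 0)
  | J5_24 al => t = (0, al, 1, 0, 0)
  | J5_25 => t = (1, 1, - 2, 0, 0)
  | J5_29 => t = (0, 0, 1, 0, 0)
  | J5_34 => t = (0, 1, 0, 0, 0)
  | J5_35 => t = (0, 0, 0, 1, 0)
  | J5_39 => t = (0, 1, 0, 0, 1)
  | J5_41 al => al = 0 /\ t = (0, 0, - 2, 1, 0)
  | _ => False
  end.

(** For [J5_41 al] the kernel of the product is spanned by b^2 - al a^2. This is a square for al =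
    0, whence the entry in [nfB1]; for al = g^2 with g nonzero it is (b - g a)(b + g a), and these
    factors are the generators used here. *)
Definition nfB2 (l : name F) (t : F * F * F * F) : Prop :=
  match l with
  | J5_26 al => t = (1, 1, 0, al)
  | J5_27 al be => t = (be, 1, 1, al)
  | J5_28 => t = (0, 0, 1, 0)
  | J5_30 => t = (- 1, 0, 1, 0)
  | J5_37 => t = (1, - 1, 1, - 1)
  | J5_41 al => exists g, [/\ g != 0, al = g ^+ 2 & t = (1 + g, - (1 + g), 1 - g, - (1 - g))]
  | _ => False
  end.

Definition TB1of (t : F * F * F * F * F) : stable F :=
  let: (p, q, r, s, rho) := t in TB1 p q r s rho.

Definition TB2of (t : F * F * F * F) : stable F :=
  let: (p, q, r, s) := t in TB2 p q r s.

Lemma listed_nfB1 l t : nfB1 l t -> isomorphic (talg (TB1of t)) (listed l).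
Proof.
rewrite listedE; case: l => //= [al|al||||||al]; [move=> -> ..|case=> -> ->]; rewrite /TB1of /TB1.
- iso_with [:: [:: C1]; [:: C0; C1]; [:: C0; C0; C1]; [:: C0; C0; C0; C1]; [:: C0; C0; C0; C0; C1 : coef F]].
  by nf_check.
- iso_with [:: [:: C1]; [:: C0; C1]; [:: C0; C0; C1]; [:: C0; C0; C0; C1]; [:: C0; C0; C0; C0; C1 : coef F]].
  by nf_check.
- iso_with [:: [:: C1]; [:: C0; C1]; [:: C0; C0; C1]; [:: C0; C0; C0; C1]; [:: C0; C0; C0; C0; C1 : coef F]].
  by nf_check.
- iso_with [:: [:: C1]; [:: C0; C0; C1]; [:: C0; C1]; [:: C0; C0; C0; C0; C1]; [:: C0; C0; C0; C1 : coef F]].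
  by nf_check.
- iso_with [:: [:: C1]; [:: C0; C1]; [:: C0; C0; C0; C0; C1]; [:: C0; C0; C1]; [:: C0; C0; C0; C1 : coef F]].
  by nf_check.
- iso_with [:: [:: C0; C1]; [:: C1]; [:: C0; C0; C0; C0; C1]; [:: C0; C0; C1]; [:: C0; C0; C0; C1 : coef F]].
  by nf_check.
- iso_with [:: [:: C1]; [:: C0; C1]; [:: C0; C0; C0; C0; C1]; [:: C0; C0; C1]; [:: C0; C0; C0; C1 : coef F]].
  by nf_check.
iso_with [:: [:: C1; CE (- 1)]; [:: C0; C1]; [:: C0; C0; CE (- 2); C0; C1]; [:: C0; C0; C1]; [:: C0; C0; C0; C1 : coef F]].
by nf_check.
Qed.

Lemma listed_nfB2 l t : nfB2 l t -> isomorphic (talg (TB2of t)) (listed l).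
Proof.
rewrite listedE; case: l => //= [al|al be||||al]; [move=> -> ..|case=> g [g0 -> ->]]; rewrite /TB2of /TB2.
- iso_with [:: [:: C1]; [:: C0; C1]; [:: C0; C0; C1]; [:: C0; C0; C0; C1]; [:: C0; C0; C0; C0; C1 : coef F]].
  by nf_check.
- iso_with [:: [:: C1]; [:: C0; C1]; [:: C0; C0; C1]; [:: C0; C0; C0; C1]; [:: C0; C0; C0; C0; C1 : coef F]].
  by nf_check.
- iso_with [:: [:: C1]; [:: C0; C0; C1]; [:: C0; C1]; [:: C0; C0; C0; C0; C1]; [:: C0; C0; C0; C1 : coef F]].
  by nf_check.
- iso_with [:: [:: C1; C0; CE (- 1)]; [:: C0; C0; C1]; [:: C0; C1; C0; C0; CE (- 1)]; [:: C0; C0; C0; C0; C1]; [:: C0; C0; C0; C1 : coef F]].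
  by nf_check.
- iso_with [:: [:: C1; C1]; [:: C1; CE (- 1)]; [:: C0; C0; CE 2; C0; CE 2]; [:: C0; C0; CE (- 2); C0; CE 2]; [:: C0; C0; C0; CE (2 : F)]].
  sym; split; [by conjs ltac:(ring) | ].
  by apply/eqP; rewrite (_ : _ + _ = 2 * 2 * 2 * 2 * 2); [nz | ring].
iso_with [:: [:: CE g; C1]; [:: CE (- g); C1]; [:: C0; C0; CE (2 * g); C0; CE (2 * g ^+ 2)];
  [:: C0; C0; CE (- (2 * g)); C0; CE (2 * g ^+ 2)]; [:: C0; C0; C0; CE (2 * g)]].
sym; split; [by conjs ltac:(ring) | ].
by apply/eqP; rewrite (_ : _ + _ = - (2 * 2 * 2 * 2 * 2 * g ^+ 5)); [nz | ring].
Qed.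

(** [r - 2 * q] is a relative invariant, since [y] shifts r by twice as much as q; [rho] becomes one
    only when r = s = 0. *)
Definition codeB1 (t : F * F * F * F * F) : seq bool :=
  let: (p, q, r, s, rho) := t in
  [:: vanish [:: s]; vanish [:: s; q]; vanish [:: s; r]; vanish [:: s; r; rho];
      vanish [:: p * s - q * r]; vanish [:: p * s - q * r; r - 2 * q]].

Lemma codeB1_rel p q r s rho p' q' r' s' rho' :
  relB1 p q r s rho p' q' r' s' rho' ->
  forall i, nth false (codeB1 (p', q', r', s', rho')) i ->
            nth false (codeB1 (p, q, r, s, rho)) i.
Proof.
move=> [x [y [z [w [m [n [[x0 z0 w0] [Ep Eq Er Es Erho]]]]]]]].
have w20 : w ^+ 2 != 0 by nz.
case=> [|[|[|[|[|[|i]]]]]]; rewrite /codeB1 /= ?nth_nil //; vanish_goal;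
  try by apply: (mul0_neq w0); rewrite ?Ep ?Eq ?Er ?Es ?Erho ?Z ?Z0 ?Z1; ring.
- apply: (mul0_neq w20); rewrite (_ : _ * _ = (w * p) * (w * s) - (w * q) * (w * r)); last by ring.
  by rewrite Ep Eq Er Es; lc (x ^+ 4 * z ^+ 2) Z.
- apply: (mul0_neq w20); rewrite (_ : _ * _ = (w * p) * (w * s) - (w * q) * (w * r)); last by ring.
  by rewrite Ep Eq Er Es; lc (x ^+ 4 * z ^+ 2) Z.
apply: (mul0_neq w0); rewrite (_ : _ * _ = (w * r) - 2 * (w * q)); last by ring.
by rewrite Er Eq; lc (x ^+ 2 * z) Z0.
Qed.

Definition nfB1_code (l : name F) : seq bool :=
  match l with
  | J5_23 _ => [:: false; false; false; false; false; false]
  | J5_24 _ => [:: true; false; false; false; false; false]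
  | J5_25 => [:: true; false; false; false; false; false]
  | J5_29 => [:: true; true; false; false; true; false]
  | J5_34 => [:: true; false; true; true; true; false]
  | J5_35 => [:: false; false; false; false; true; true]
  | J5_39 => [:: true; false; true; false; true; false]
  | J5_41 _ => [:: false; false; false; false; true; false]
  | _ => [::]
  end.

Lemma eq0F (x y : F) : y != 0 -> x = y -> (x == 0) = false.
Proof. by move=> y0 ->; apply: negbTE. Qed.

Lemma eq0T (x : F) : x = 0 -> (x == 0) = true.
Proof. by move=> ->; apply: eqxx. Qed.

Ltac decide_code al al0 :=
  repeat match goal with |- context [?e == 0] =>
    first [ rewrite (@eq0T e); [|by ring]
          | rewrite (@eq0F e 1); [|exact: oner_neq0|by ring]
          | rewrite (@eq0F e (- 1)); [|by rewrite oppr_eq0 oner_neq0|by ring]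
          | rewrite (@eq0F e 2); [|assumption|by ring]
          | rewrite (@eq0F e (- 2)); [|by rewrite oppr_eq0|by ring]
          | rewrite (@eq0F e al); [|exact: al0|by ring]
          | rewrite (@eq0F e (- al)); [|by rewrite oppr_eq0|by ring] ] end; exact (erefl _).

Lemma codeB1_nf l t : admissible l -> nfB1 l t -> codeB1 t = nfB1_code l.
Proof.
have one0 := @oner_neq0 F.
case: l => //= [al|al||||||al] adm; [move=> -> ..|case=> _ ->];
  rewrite /codeB1 /vanish /=; try decide_code (1 : F) one0.
have al0 : al != 0 by case: adm => /eqP.
by decide_code al al0.
Qed.

Lemma nfB1_nonzero l p q r s rho : nfB1 l (p, q, r, s, rho) ->
  ~ [/\ p = 0, q = 0, r = 0 & s = 0].
Proof.
have one0 := @oner_neq0 F.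
by case: l => //= [al|al||||||al]; [move=> [-> -> -> -> _] ..|case=> _ [-> -> -> -> _]];
  case=> /eqP H1 /eqP H2 /eqP H3 /eqP H4; move: H1 H2 H3 H4; rewrite ?(negbTE one0).
Qed.

Lemma nfB1_same l l' t t' : nfB1 l t -> nfB1 l' t' -> admissible l -> admissible l' ->
  isomorphic (listed l) (listed l') -> same_class l l'.
Proof.
move=> lt lt' al al' ll'.
have rel l1 l2 q q' : nfB1 l1 q -> nfB1 l2 q' ->
    isomorphic (listed l1) (listed l2) ->
    let: (p, q, r, s, rho) := q in let: (p', q', r', s', rho') := q' in
    relB1 p q r s rho p' q' r' s' rho'.
  move=> l1q l2q l12.
  have := isomorphic_trans (listed_nfB1 l1q)
    (isomorphic_trans l12 (isomorphic_sym (listed_nfB1 l2q))).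
  move: q q' l1q l2q {l12} => [[[[p q] r] s] rho] [[[[p' q'] r'] s'] rho'] l1q l2q.
  by move/(relB1_iso)/(_ (nfB1_nonzero l1q)).
have imp l1 l2 q q' : nfB1 l1 q -> nfB1 l2 q' -> admissible l1 -> admissible l2 ->
    isomorphic (listed l1) (listed l2) ->
    forall i, nth false (nfB1_code l2) i -> nth false (nfB1_code l1) i.
  move=> l1q l2q a1 a2 l12; rewrite -(codeB1_nf a1 l1q) -(codeB1_nf a2 l2q).
  move: q q' l1q l2q (rel _ _ _ _ l1q l2q l12) => [[[[p q] r] s] rho] [[[[p' q'] r'] s'] rho'] _ _.
  exact: codeB1_rel.
have I := imp _ _ _ _ lt lt' al al' ll'.
have ll'' := isomorphic_sym ll'.
have I' := imp _ _ _ _ lt' lt al' al ll''.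
have R := rel _ _ _ _ lt lt' ll'; have R' := rel _ _ _ _ lt' lt ll''.
(* The codes of [J5_24] and [J5_25] coincide. In [J5_25] the factor 2 q + r of [y] vanishes, so that
   [y] cannot remove p. *)
have nogo24 a : ~ (relB1 0 a 1 0 0 1 1 (- 2) 0 0).
  move=> [x [y [z [w [m [n [[x0 z0 w0] [Ep _ _ _ _]]]]]]]].
  have : x ^+ 3 = 0 by lc (- 1) Ep.
  by apply/eqP; nz.
move: lt lt' al al' (I 0%N) (I 1%N) (I 2%N) (I 3%N) (I 4%N) (I 5%N)
  (I' 0%N) (I' 1%N) (I' 2%N) (I' 3%N) (I' 4%N) (I' 5%N) R R'.
clear I I' rel imp ll' ll''; case: l => //= [al|al||||||al]; case: l' => //=;
  try by move=> *;
    match goal with H : is_true true -> is_true false |- _ => case: (notF (H isT)) end.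
- move=> be -> -> _ _ _ _ _ _ _ _ _ _ _ _ _ _ R _.
  case: R => x [y [z [w [m [n [[x0 z0 w0] [Ep Eq Er Es _]]]]]]].
  have y0 : y = 0.
    by apply: (mul0_neq (_ : x * z != 0)); [nz | lc (- 1) Eq].
  subst y; have w1 : w = x ^+ 3 by lc 1 Ep.
  have w2 : w = x * z ^+ 2 by lc 1 Es.
  subst w; have x2 : x ^+ 2 = z ^+ 2 by apply: (mulfI x0); lc 1 w2.
  have E : x * al = z * be by apply: (mulfI (_ : x ^+ 2 != 0)); [nz | lc 1 Er].
  have x20 : x ^+ 2 != 0 by nz.
  by apply: (mul0_neq x20); lc (x * al + z * be) E, (- be ^+ 2) x2.
- move=> be -> -> _ _ _ _ _ _ _ _ _ _ _ _ _ _ R _.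
  case: R => x [y [z [w [m [n [[x0 z0 w0] [Ep Eq Er Es _]]]]]]].
  by have -> : al = be by apply: (mulfI w0); lc 1 Eq, (- be) Er.
- by move=> -> -> _ _ _ _ _ _ _ _ _ _ _ _ _ _ /nogo24.
- by move=> be -> -> _ _ _ _ _ _ _ _ _ _ _ _ _ _ _ /nogo24.
by move=> be [-> _] [-> _] *; ring.
Qed.

Definition codeB2 (t : F * F * F * F) : seq bool :=
  let: (p, q, r, s) := t in
  [:: vanish [:: p * s - q * r]; vanish [:: p * s - q * r; p; s];
      vanish [:: p * s - q * r; p * q; r * s]].

(** [relB2_iso] determines the generators only up to exchange, so the code has to be symmetric under
    it. *)
Lemma codeB2_swap p q r s i :
  nth false (codeB2 (p, q, r, s)) i = nth false (codeB2 (s, r, q, p)) i.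
Proof.
rewrite /codeB2 (mulrC s p) (mulrC r q) (mulrC q p) (mulrC s r).
by case: i => [|[|[|i]]] //=; congr andb; rewrite ?andbT andbC.
Qed.

Lemma codeB2_rel p q r s p' q' r' s' : relB2 p q r s p' q' r' s' ->
  forall i, nth false (codeB2 (p', q', r', s')) i -> nth false (codeB2 (p, q, r, s)) i.
Proof.
move=> [x [z [w [[x0 z0 w0] [Ep Eq Er Es]]]]].
have w20 : w ^+ 2 != 0 by nz.
have det : p' * s' - q' * r' = 0 -> p * s - q * r = 0.
  move=> Z; apply: (mul0_neq w20).
  rewrite (_ : _ * _ = (w * p) * (w * s) - (w * q) * (w * r)); last by ring.
  by rewrite Ep Eq Er Es; lc (x ^+ 3 * z ^+ 3) Z.
case=> [|[|[|i]]]; rewrite /codeB2 /= ?nth_nil //; vanish_goal; try exact: det.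
- by apply: (mul0_neq w0); rewrite Ep Z0 mulr0.
- by apply: (mul0_neq w0); rewrite Es Z1 mulr0.
- apply: (mul0_neq w20); rewrite (_ : _ * _ = (w * p) * (w * q)); last by ring.
  by rewrite Ep Eq; lc (x ^+ 4 * z ^+ 2) Z0.
- apply: (mul0_neq w20); rewrite (_ : _ * _ = (w * r) * (w * s)); last by ring.
  by rewrite Er Es; lc (x ^+ 2 * z ^+ 4) Z1.
Qed.

Definition nfB2_code (l : name F) : seq bool :=
  match l with
  | J5_26 _ | J5_27 _ _ => [:: false; false; false]
  | J5_28 => [:: true; true; true]
  | J5_30 => [:: true; false; true]
  | J5_37 | J5_41 _ => [:: true; false; false]
  | _ => [::]
  end.

Lemma codeB2_nf l t : admissible l -> nfB2 l t -> codeB2 t = nfB2_code l.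
Proof.
have one0 := @oner_neq0 F.
case: l => //= [al|al be||||al] adm; [move=> -> ..|case=> g [g0 _ ->]];
  rewrite /codeB2 /vanish /=; try decide_code (1 : F) one0.
- have al0 : al != 0 by apply/eqP.
  by decide_code al al0.
- have al0 : al * be - 1 != 0 by rewrite subr_eq0; apply/eqP.
  by decide_code (al * be - 1) al0.
have -> : (1 + g) * - (1 - g) - - (1 + g) * (1 - g) = 0 by ring.
rewrite !mulrN ?mulNr !oppr_eq0 !mulf_eq0 !orbb eqxx /= ?andbT.
have [g1|//] := eqVneq (1 + g) 0; have [g2|//] := eqVneq (1 - g) 0.
by move: two; rewrite (_ : 2 = (1 + g) + (1 - g)); [rewrite g1 g2 addr0 eqxx | ring].
Qed.

Lemma nfB2_nonzero l p q r s : nfB2 l (p, q, r, s) ->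
  ~ [/\ p = 0, q = 0, r = 0 & s = 0].
Proof.
have one0 := @oner_neq0 F.
case: l => //= [al|al be||||al];
  [by move=> [-> -> -> ->] [] /eqP H1 /eqP H2 /eqP H3 /eqP H4;
      move: H1 H2 H3 H4; rewrite ?oppr_eq0 ?(negbTE one0) ..|case=> g [_ _ [-> _ -> _]]].
case=> E _ E' _; move/eqP: two; apply.
by lc 1 E, 1 E'.
Qed.

(** With al = g^2 and be = h^2, the condition be (al^2 + 1) = al (be^2 + 1) amounts to (al - be)(al
    be - 1) = 0. This splits into (g - h)(1 - g h) = 0, obtained here, and the same for - h,
    obtained in [rel41s]. *)
Lemma rel41 (g h : F) :
  relB2 (1 + g) (- (1 + g)) (1 - g) (- (1 - g)) (1 + h) (- (1 + h)) (1 - h) (- (1 - h)) ->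
  (g - h) * (1 - g * h) = 0.
Proof.
case=> x [z [w [[x0 z0 w0] [Ep Eq Er Es]]]].
have [g1|g1] := eqVneq (1 + g) 0.
  have h1 : 1 + h = 0 by apply: (mul0_neq (_ : x ^+ 3 != 0)); [nz | rewrite -Ep g1 mulr0].
  by lc (1 - g * h) g1, (- (1 - g * h)) h1.
have h1 : 1 + h != 0.
  by apply/eqP=> h1; case/eqP: (mulf_neq0 w0 g1); rewrite Ep h1 mulr0.
have x2 : x ^+ 2 = z ^+ 2.
  by apply: (mulfI (_ : x * (1 + h) != 0)); [nz | lc (- 1) Ep, (- 1) Eq].
have E : x * (1 - g) * (1 + h) = z * (1 + g) * (1 - h).
  by apply: (mulfI (_ : w * x ^+ 2 != 0)); [nz | lc (x ^+ 2 * x * (1 + h)) Er, (- z * x ^+ 2 * (1 - h)) Ep].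
have four : 4 * x ^+ 2 != 0 by rewrite (_ : 4 = 2 * 2); [nz | ring].
apply: (mul0_neq four).
by lc (- (x * (1 - g) * (1 + h) + z * (1 + g) * (1 - h))) E, ((1 + g) ^+ 2 * (1 - h) ^+ 2) x2.
Qed.

(** Exchanging the generators replaces h by - h, up to the sign of [w]. *)
Lemma rel41s (g h : F) :
  relB2 (1 + g) (- (1 + g)) (1 - g) (- (1 - g)) (- (1 - h)) (1 - h) (- (1 + h)) (1 + h) ->
  (g + h) * (1 + g * h) = 0.
Proof.
case=> x [z [w [[x0 z0 w0] [Ep Eq Er Es]]]].
have : relB2 (1 + g) (- (1 + g)) (1 - g) (- (1 - g))
             (1 + - h) (- (1 + - h)) (1 - - h) (- (1 - - h)).
  exists x, z, (- w); split; first by rewrite oppr_eq0.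
  by split; [lc (- 1) Ep | lc (- 1) Eq | lc (- 1) Er | lc (- 1) Es].
by move/rel41 => E; lc 1 E.
Qed.

Lemma nfB2_same l l' t t' : nfB2 l t -> nfB2 l' t' -> admissible l -> admissible l' ->
  isomorphic (listed l) (listed l') -> same_class l l'.
Proof.
move=> lt lt' al al' ll'.
have rel l1 l2 q q' : nfB2 l1 q -> nfB2 l2 q' ->
    isomorphic (listed l1) (listed l2) ->
    let: (p, q, r, s) := q in let: (p', q', r', s') := q' in
    relB2 p q r s p' q' r' s' \/ relB2 p q r s s' r' q' p'.
  move=> l1q l2q l12.
  have := isomorphic_trans (listed_nfB2 l1q)
    (isomorphic_trans l12 (isomorphic_sym (listed_nfB2 l2q))).
  move: q q' l1q l2q {l12} => [[[p q] r] s] [[[p' q'] r'] s'] l1q l2q.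
  by move/(relB2_iso)/(_ (nfB2_nonzero l1q)).
have imp l1 l2 q q' : nfB2 l1 q -> nfB2 l2 q' -> admissible l1 -> admissible l2 ->
    isomorphic (listed l1) (listed l2) ->
    forall i, nth false (nfB2_code l2) i -> nth false (nfB2_code l1) i.
  move=> l1q l2q a1 a2 l12; rewrite -(codeB2_nf a1 l1q) -(codeB2_nf a2 l2q).
  move: q q' l1q l2q (rel _ _ _ _ l1q l2q l12) => [[[p q] r] s] [[[p' q'] r'] s'] _ _.
  case=> R i; first exact: codeB2_rel R i.
  by rewrite (codeB2_swap p' q' r' s'); apply: codeB2_rel R i.
have I := imp _ _ _ _ lt lt' al al' ll'.
have ll'' := isomorphic_sym ll'.
have I' := imp _ _ _ _ lt' lt al' al ll''.
have R := rel _ _ _ _ lt lt' ll'; have R' := rel _ _ _ _ lt' lt ll''.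
have one0 := @oner_neq0 F.
(* The codes of [J5_26] and [J5_27] coincide, but r is 0 in the former, while in the latter it is 1
   for both orders of the generators. *)
have no2627 (a b c : F) : ~ (relB2 1 1 0 a c 1 1 b).
  move=> [x [z [w [[x0 z0 w0] [_ _ E _]]]]].
  have : z * x ^+ 2 != 0 by nz.
  by case/eqP; lc (- 1) E.
move: lt lt' al al' (I 0%N) (I 1%N) (I 2%N) (I' 0%N) (I' 1%N) (I' 2%N) R R'.
clear I I' rel imp ll' ll''; case: l => //= [al|al be||||al]; case: l' => //=;
  try by move=> *;
    match goal with H : is_true true -> is_true false |- _ => case: (notF (H isT)) end.
- move=> al' -> -> _ _ _ _ _ _ _ _ [] R _; case: R => x [z [w [[x0 z0 w0] [Ep Eq Er Es]]]]; last first.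
    by case/eqP: w0; lc 1 Eq.
  have w1 : w = x ^+ 3 by lc 1 Ep.
  subst w; have x2 : x ^+ 2 = z ^+ 2 by apply: (mulfI x0); lc 1 Eq.
  have x20 : x ^+ 2 != 0 by nz.
  have E : x * al = z * al' by apply: (mulfI x20); lc 1 Es, (- z * al') x2.
  by apply: (mul0_neq x20); lc (x * al + z * al') E, (- al' ^+ 2) x2.
- by move=> al' be' -> -> _ _ _ _ _ _ _ _ [/no2627|/no2627].
- by move=> al' -> -> _ _ _ _ _ _ _ _ _ [/no2627|/no2627].
- move=> al' be' -> -> _ _ _ _ _ _ _ _ R _.
  have H27 (a b c d : F) : relB2 a 1 1 b c 1 1 d -> a = c /\ b = d.
    case=> x [z [w [[x0 z0 w0] [Ep Eq Er Es]]]].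
    have xz : x = z by apply: (mulfI (_ : x * z != 0)); [nz | lc (- 1) Er, 1 Eq].
    subst z; have w1 : w = x ^+ 3 by lc 1 Eq.
    by subst w; split; apply: (mulfI w0).
  by case: R => /H27[-> ->]; [left | right].
- move=> al' -> [g [g0 _ ->]] _ _ _ _ _ _ _ _ R _; case/eqP: g0.
  (* [J5_37] is the member g = 0 of the family of parameters that describes [J5_41]. *)
  have {}R : relB2 (1 + 0) (- (1 + 0)) (1 - 0) (- (1 - 0)) (1 + g) (- (1 + g)) (1 - g) (- (1 - g))
     \/ relB2 (1 + 0) (- (1 + 0)) (1 - 0) (- (1 - 0)) (- (1 - g)) (1 - g) (- (1 + g)) (1 + g).
    by rewrite addr0 subr0.
  by case: R => [/rel41 | /rel41s] E; [lc (- 1) E | lc 1 E].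
- move=> [g [g0 _ ->]] -> _ _ _ _ _ _ _ _ _ R; case/eqP: g0.
  have {}R : relB2 (1 + 0) (- (1 + 0)) (1 - 0) (- (1 - 0)) (1 + g) (- (1 + g)) (1 - g) (- (1 - g))
     \/ relB2 (1 + 0) (- (1 + 0)) (1 - 0) (- (1 - 0)) (- (1 - g)) (1 - g) (- (1 + g)) (1 + g).
    by rewrite addr0 subr0.
  by case: R => [/rel41 | /rel41s] E; [lc (- 1) E | lc 1 E].
move=> al' [g [g0 -> ->]] [h [h0 -> ->]] _ _ _ _ _ _ _ _ R _.
case: R => [/rel41 | /rel41s] E.
  by lc (- (g + h) * (1 + g * h)) E.
by lc (- (g - h) * (1 - g * h)) E.
Qed.

End SeparationB.

(** * Reduction to normal form when dim J^<2> = 3 and dim J^<3> = 1 *)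

Section ClassifyB.

Variable F : fieldType.
Hypothesis two : 2 != 0 :> F.
Hypothesis sqrtF : forall x : F, exists y, y ^+ 2 = x.

Lemma nfB1_listable (l : name F) p q r s rho p' q' r' s' rho' : admissible l ->
  nfB1 l (p, q, r, s, rho) -> relB1 p q r s rho p' q' r' s' rho' ->
  listable (talg (TB1 p' q' r' s' rho')).
Proof.
move=> al lt rel; apply: (listable_iso (iso_relB1 rel)).
by exists l; split=> //; apply: listed_nfB1 lt.
Qed.

Lemma nfB2_listable (l : name F) p q r s p' q' r' s' : admissible l ->
  nfB2 l (p, q, r, s) -> relB2 p q r s p' q' r' s' ->
  listable (talg (TB2 p' q' r' s')).
Proof.
move=> al lt rel; apply: (listable_iso (iso_relB2 rel)).
by exists l; split=> //; apply: (listed_nfB2 two lt).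
Qed.

Ltac rel1_with x y z w m n :=
  exists x, y, z, w, m, n; split; [split; try by nz | split; try by fielda].

(** If s is nonzero, y = - q x / s kills q, and p becomes proportional to the determinant p s - q r.
    If s = 0, then [y] moves only p, by a multiple of 2 q + r, so that p survives just when r = - 2
    q. The excluded case q = r, s = 0 is the associative one. *)
Lemma class_TB1 (p q r s rho : F) : ~ (q = r /\ s = 0) -> listable (talg (TB1 p q r s rho)).
Proof.
have four : 4 != 0 :> F by rewrite (_ : 4 = 2 * 2); [nz | ring].
move=> nA; have [s0|s0] := eqVneq s 0; last first.
  have [P0|P0] := eqVneq (p * s - q * r) 0.
    have [R0|R0] := eqVneq (r - 2 * q) 0.
      apply: (@nfB1_listable (J5_35 F) _ _ _ _ _ _ _ _ _ _ I erefl).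
      rel1_with (1 : F) (- q / s) (1 : F) s (0 : F) (- rho / (2 * s)).
      - by lcf (- 1 / s) P0.
      - by lcf (- 1) R0.
    apply: (@nfB1_listable (J5_41 0) _ _ _ _ _ _ _ _ _ _ I (conj erefl erefl)).
    rel1_with (1 : F) (- q / s) (- (r - 2 * q) / (2 * s)) ((r - 2 * q) ^+ 2 / (4 * s))
      (0 : F) ((r - 2 * q) * rho / (4 * s ^+ 2)).
    by lcf (- 1 / s) P0.
  have [x x2] := sqrtF (s ^+ 2 / (p * s - q * r)).
  have x0 : x != 0 by rewrite -sqrf_eq0 x2; nz.
  have xP : x ^+ 2 * (p * s - q * r) = s ^+ 2 by rewrite x2 divfK.
  apply: (@nfB1_listable (J5_23 (x * (r - 2 * q) / s)) _ _ _ _ _ _ _ _ _ _ I erefl).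
  rel1_with x (- x * q / s) (1 : F) (x * s) (0 : F) (- rho / (2 * s)).
  by lcf (- x / s) xP.
subst s; have qr : q != r by apply/eqP=> qr; apply: nA.
have [r0|r0] := eqVneq r 0.
  subst r; have [rho0|rho0] := eqVneq rho 0.
    subst rho; apply: (@nfB1_listable (J5_34 F) _ _ _ _ _ _ _ _ _ _ I erefl).
    by rel1_with (1 : F) (- p / (2 * q)) (1 : F) q (0 : F) (0 : F).
  apply: (@nfB1_listable (J5_39 F) _ _ _ _ _ _ _ _ _ _ I erefl).
  by rel1_with (1 : F) (- p / (2 * q)) (q / rho) (q ^+ 2 / rho) (0 : F) (0 : F).
have [k0|k0] := eqVneq (2 * q + r) 0; last first.
  have [q0|q0] := eqVneq q 0.
    subst q; apply: (@nfB1_listable (J5_29 F) _ _ _ _ _ _ _ _ _ _ I erefl).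
    by rel1_with (1 : F) (- p / r) (1 : F) r (- rho / (2 * r)) (0 : F).
  have adm : admissible (J5_24 (q / r)).
    split=> [/eqP|E]; first by apply/negP; nz.
    by case/eqP: qr; rewrite -[q](divfK r0) E mul1r.
  apply: (@nfB1_listable (J5_24 (q / r)) _ _ _ _ _ _ _ _ _ _ adm erefl).
  by rel1_with (1 : F) (- p / (2 * q + r)) (1 : F) r (- rho / (2 * r)) (0 : F).
have Er : r = - 2 * q by lc 1 k0.
have q0 : q != 0 by apply: contraNneq r0 => q0; rewrite Er q0 mulr0.
subst r; have [p0|p0] := eqVneq p 0.
  subst p; have adm : admissible (J5_24 (- 1 / 2 : F)).
    split=> [/eqP|E]; first by apply/negP; nz.
    (* - 1/2 = 1 would mean characteristic 3, and there r = - 2 q would equal q. *)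
    by case/eqP: qr; lcf (- 2 * q) E.
  apply: (@nfB1_listable (J5_24 (- 1 / 2)) _ _ _ _ _ _ _ _ _ _ adm erefl).
  by rel1_with (1 : F) (0 : F) (1 : F) (- 2 * q) (rho / (4 * q)) (0 : F).
apply: (@nfB1_listable (J5_25 F) _ _ _ _ _ _ _ _ _ _ I erefl).
by rel1_with (1 : F) (0 : F) (p / q) p (p * rho / (4 * q ^+ 2)) (0 : F).
Qed.

Ltac rel2_with x z w :=
  exists x, z, w; split; [split; try by nz | split; try by fielda].

(** Only scalings and the exchange of generators are available. With q nonzero the cases are
    governed by r, the determinant p s - q r, and the vanishing of p and s; q = r = 0 is the
    associative case. *)
Lemma class_TB2 (p q r s : F) : ~ (q = 0 /\ r = 0) -> listable (talg (TB2 p q r s)).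
Proof.
have four : 4 != 0 :> F by rewrite (_ : 4 = 2 * 2); [nz | ring].
wlog q0 : p q r s / q != 0.
  move=> W nA; have [q0|q0] := eqVneq q 0; last exact: W.
  apply: (listable_iso (TB2_swap s r q p)); apply: W; last by case=> *; apply: nA.
  by apply/eqP=> r0; apply: nA.
move=> _; have [r0|r0] := eqVneq r 0.
  subst r; have [p0|p0] := eqVneq p 0.
    subst p; apply: (listable_iso (TB2_swap s 0 q 0)).
    have [s0|s0] := eqVneq s 0.
      subst s; apply: (@nfB2_listable (J5_28 F) _ _ _ _ _ _ _ _ I erefl).
      by rel2_with (1 : F) (1 : F) q.
    apply: (@nfB2_listable (J5_30 F) _ _ _ _ _ _ _ _ I erefl).
    by rel2_with q (- s) (- q ^+ 3 * s).
  have [s0|s0] := eqVneq s 0.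
    subst s; have [x x2] := sqrtF (- q / p).
    have x0 : x != 0 by rewrite -sqrf_eq0 x2; nz.
    apply: (@nfB2_listable (J5_41 1) (1 + 1) (- (1 + 1)) (1 - 1) (- (1 - 1)) _ _ _ _ I).
      by exists 1; split; [exact: oner_neq0 | rewrite expr1n | ].
    rel2_with x (1 : F) (- x * q / 2).
    by lcf (- x * p) x2.
  have [x x2] := sqrtF (q / p).
  have x0 : x != 0 by rewrite -sqrf_eq0 x2; nz.
  have adm : admissible (J5_26 (s / (x * q))) by apply/eqP; nz.
  apply: (@nfB2_listable (J5_26 (s / (x * q))) _ _ _ _ _ _ _ _ adm erefl).
  rel2_with x (1 : F) (x * q).
  by lcf (- x * p) x2.
have [d0|d0] := eqVneq (p * s - q * r) 0; last first.
  pose w := q ^+ 2 * r ^+ 2.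
  (* The product of the two parameters is p s / (q r), so that admissibility is the non-vanishing of
     the determinant. *)
  have adm : admissible (J5_27 (r ^+ 3 * s / w) (q ^+ 3 * p / w)).
    move=> E; case/eqP: d0; have : p * s * (q * r) = (q * r) ^+ 2.
      by rewrite -[RHS]mulr1 -E /w; fielda.
    by move=> E'; apply: (mulfI (_ : q * r != 0)); [nz | lc 1 E'].
  apply: (@nfB2_listable (J5_27 (r ^+ 3 * s / w) (q ^+ 3 * p / w)) _ _ _ _ _ _ _ _ adm erefl).
  by rewrite /w; rel2_with q r (q ^+ 2 * r ^+ 2).
have p0 : p != 0.
  by apply/eqP=> p0; case/eqP: (mulf_neq0 q0 r0); lc s p0, (- 1) d0.
have Es : s = q * r / p by lcf (1 / p) d0.
subst s; have [x x2] := sqrtF (- q / p).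
have x0 : x != 0 by rewrite -sqrf_eq0 x2; nz.
have Eq : q = - x ^+ 2 * p by rewrite x2; fielda.
clear x2 d0; subst q.
have [E|nE] := eqVneq r (x * p).
  subst r; apply: (@nfB2_listable (J5_37 F) _ _ _ _ _ _ _ _ I erefl).
  by rel2_with x (1 : F) (x ^+ 3 * p).
have [E|nE'] := eqVneq r (- x * p).
  subst r; apply: (@nfB2_listable (J5_37 F) _ _ _ _ _ _ _ _ I erefl).
  by rel2_with (- x) (1 : F) (- x ^+ 3 * p).
have n1 : x * p + r != 0 by apply/eqP=> E; case/eqP: nE'; lc 1 E.
have n2 : x * p - r != 0 by apply/eqP=> E; case/eqP: nE; lc (- 1) E.
(* [g] solves (1 - g) / (1 + g) = r / (x p); the excluded value r = x p would give g = 0, that is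
   [J5_37]. *)
pose g := (x * p - r) / (x * p + r).
apply: (@nfB2_listable (J5_41 (g ^+ 2)) (1 + g) (- (1 + g)) (1 - g) (- (1 - g)) _ _ _ _ I).
  by exists g; split=> //; rewrite /g; nz.
by rewrite /g; rel2_with x (1 : F) (x ^+ 2 * (x * p + r) / 2).
Qed.

Definition GB1 (p q r s rho u v w : F) : stable F :=
  TB1 p q r s rho ++
  [:: (i2, i2, [:: C0; C0; C0; C0; CE u]); (i2, i3, [:: C0; C0; C0; C0; CE v]);
      (i3, i3, [:: C0; C0; C0; C0; CE w])].

Definition GB2 (p q r s k u v w : F) : stable F :=
  TB2 p q r s ++
  [:: (i0, i1, [:: C0; C0; C0; C0; CE k]);
      (i2, i2, [:: C0; C0; C0; C0; CE u]); (i2, i3, [:: C0; C0; C0; C0; CE v]);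
      (i3, i3, [:: C0; C0; C0; C0; CE w])].

(** The Jordan identity equates the products of J^<2> with itself to elements of J^<4> = 0; three
    instances suffice to obtain u = v = w = 0. *)
Lemma class_GB1 p q r s rho u v w : is_jordan (talg (GB1 p q r s rho u v w)) ->
  ~ is_assoc (talg (GB1 p q r s rho u v w)) -> listable (talg (GB1 p q r s rho u v w)).
Proof.
unfold GB1, TB1, cat => jJ nA.
jord jJ [:: C1] [:: C1] E; jord jJ [:: C1] [:: C0; C1] E'; jordl two jJ [:: C1] [:: C0; C1] [:: C0; C1] E2.
have {}E2 := mul0_neq two E2; subst u v w.
have nqr : ~ (q = r /\ s = 0).
  case=> ? ?; subst r s; apply: nA; apply: assoc_check.
  by sym; conjs ltac:(ring).
apply: (listable_iso _ (class_TB1 p rho nqr)).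
iso_with [:: [:: C1]; [:: C0; C1]; [:: C0; C0; C1]; [:: C0; C0; C0; C1]; [:: C0; C0; C0; C0; C1 : coef F]].
by rewrite /TB1; nf_check.
Qed.

Lemma class_GB2 p q r s k u v w : is_jordan (talg (GB2 p q r s k u v w)) ->
  ~ is_assoc (talg (GB2 p q r s k u v w)) -> listable (talg (GB2 p q r s k u v w)).
Proof.
unfold GB2, TB2, cat => jJ nA.
jord jJ [:: C1] [:: C1] E; jord jJ [:: C0; C1] [:: C0; C1] E'; jordl two jJ [:: C1] [:: C0; C1] [:: C0; C1] E2.
subst u v w.
have nqr : ~ (q = 0 /\ r = 0).
  case=> ? ?; subst q r; apply: nA; apply: assoc_check.
  by sym; conjs ltac:(ring).
apply: (listable_iso _ (class_TB2 p s nqr)).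
(* The product of 0 and 1 is [k] times 4; it is removed by adding to 1 a multiple of 3 when q is
   nonzero, or to 0 a multiple of 2 when r is nonzero. *)
have [q0|q0] := eqVneq q 0.
  have r0 : r != 0 by apply/eqP=> r0; apply: nqr.
  iso_with [:: [:: C1; C0; CE (- k / r)]; [:: C0; C1]; [:: C0; C0; C1; C0; CE (- 2 * k * p / r)];
    [:: C0; C0; C0; C1]; [:: C0; C0; C0; C0; C1 : coef F]].
  by rewrite /TB2; sym; split; [conjs ltac:(first [by ring | by fielda]) | apply/eqP; nz].
iso_with [:: [:: C1]; [:: C0; C1; C0; CE (- k / q)]; [:: C0; C0; C1];
  [:: C0; C0; C0; C1; CE (- 2 * k * s / q)]; [:: C0; C0; C0; C0; C1 : coef F]].
by rewrite /TB2; sym; split; [conjs ltac:(first [by ring | by fielda]) | apply/eqP; nz].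
Qed.

Definition GB (c1 d1 e1 c2 d2 e2 c3 d3 e3 p q r s u v w : F) : stable F :=
  [:: (i0, i0, [:: C0; C0; CE c1; CE d1; CE e1]);
      (i0, i1, [:: C0; C0; CE c2; CE d2; CE e2]);
      (i1, i1, [:: C0; C0; CE c3; CE d3; CE e3]);
      (i0, i2, [:: C0; C0; C0; C0; CE p]); (i0, i3, [:: C0; C0; C0; C0; CE q]);
      (i1, i2, [:: C0; C0; C0; C0; CE r]); (i1, i3, [:: C0; C0; C0; C0; CE s]);
      (i2, i2, [:: C0; C0; C0; C0; CE u]); (i2, i3, [:: C0; C0; C0; C0; CE v]);
      (i3, i3, [:: C0; C0; C0; C0; CE w])].

Section GB.

Variables c1 d1 e1 c2 d2 e2 c3 d3 e3 p q r s u v w : F.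
Local Notation G := (GB c1 d1 e1 c2 d2 e2 c3 d3 e3 p q r s u v w).

Hypothesis jG : is_jordan (talg G).
Hypothesis nG : ~ is_assoc (talg G).

Lemma transport J : isomorphic J (talg G) ->
  (is_jordan J -> ~ is_assoc J -> listable J) -> listable (talg G).
Proof.
move=> iso H; apply: (listable_iso iso); apply: H.
  exact: iso_jordan (isomorphic_sym iso) jG.
by move/(iso_assoc iso).
Qed.

Local Notation prd i1 i2 i3 x y z t := (x * z * i1 + (x * t + y * z) * i2 + y * t * i3).

(** [prd] is the symmetric bilinear form with given coefficients on (x, y) and (z, t). Here (z, t)
    is the generator whose square falls into J^<3>; the square of (x, y) and its product with (z, t)
    become the new 2 and 3. *)
Lemma GB_GB1 x y z t : x * t - y * z != 0 ->
  prd c1 c2 c3 z t z t = 0 -> prd d1 d2 d3 z t z t = 0 ->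
  prd c1 c2 c3 x y x y * prd d1 d2 d3 x y z t
  - prd d1 d2 d3 x y x y * prd c1 c2 c3 x y z t != 0 ->
  listable (talg G).
Proof.
move=> D0 Ec Ed.
set A := prd c1 c2 c3 x y x y; set B := prd d1 d2 d3 x y x y.
set C := prd d1 d2 d3 x y z t; set E := prd c1 c2 c3 x y z t => N0.
pose p' := (x * p + y * r) * A + (x * q + y * s) * B.
pose q' := (x * p + y * r) * E + (x * q + y * s) * C.
pose r' := (z * p + t * r) * A + (z * q + t * s) * B.
pose s' := (z * p + t * r) * E + (z * q + t * s) * C.
pose u' := A * A * u + 2 * A * B * v + B * B * w.
pose v' := A * E * u + (A * C + B * E) * v + B * C * w.
pose w' := E * E * u + 2 * E * C * v + C * C * w.
apply: (transport (J := talg (GB1 p' q' r' s' (prd e1 e2 e3 z t z t) u' v' w')) _ (@class_GB1 _ _ _ _ _ _ _ _)).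
iso_with [:: [:: CE x; CE y]; [:: CE z; CE t];
  [:: C0; C0; CE A; CE B; CE (prd e1 e2 e3 x y x y)];
  [:: C0; C0; CE E; CE C; CE (prd e1 e2 e3 x y z t)]; [:: C0; C0; C0; C0; C1]].
rewrite /GB1 /TB1 /GB; sym; split.
  by conjs ltac:(first [ring | rewrite /p' /q' /r' /s' /u' /v' /w' /A /B /C /E; ring | lc 1 Ec | lc 1 Ed]).
by apply/eqP; rewrite (_ : _ + _ = (x * t - y * z) * (A * C - B * E)); [rewrite mulf_neq0 | ring].
Qed.

Lemma GB_GB2 x y z t : x * t - y * z != 0 ->
  prd c1 c2 c3 x y z t = 0 -> prd d1 d2 d3 x y z t = 0 ->
  prd c1 c2 c3 x y x y * prd d1 d2 d3 z t z t
  - prd d1 d2 d3 x y x y * prd c1 c2 c3 z t z t != 0 ->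
  listable (talg G).
Proof.
move=> D0 Ec Ed.
set A := prd c1 c2 c3 x y x y; set B := prd d1 d2 d3 x y x y.
set C := prd d1 d2 d3 z t z t; set E := prd c1 c2 c3 z t z t => N0.
pose p' := (x * p + y * r) * A + (x * q + y * s) * B.
pose q' := (x * p + y * r) * E + (x * q + y * s) * C.
pose r' := (z * p + t * r) * A + (z * q + t * s) * B.
pose s' := (z * p + t * r) * E + (z * q + t * s) * C.
pose u' := A * A * u + 2 * A * B * v + B * B * w.
pose v' := A * E * u + (A * C + B * E) * v + B * C * w.
pose w' := E * E * u + 2 * E * C * v + C * C * w.
apply: (transport (J := talg (GB2 p' q' r' s' (prd e1 e2 e3 x y z t) u' v' w')) _ (@class_GB2 _ _ _ _ _ _ _ _)).
iso_with [:: [:: CE x; CE y]; [:: CE z; CE t];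
  [:: C0; C0; CE A; CE B; CE (prd e1 e2 e3 x y x y)];
  [:: C0; C0; CE E; CE C; CE (prd e1 e2 e3 z t z t)]; [:: C0; C0; C0; C0; C1]].
rewrite /GB2 /TB2 /GB; sym; split.
  by conjs ltac:(first [ring | rewrite /p' /q' /r' /s' /u' /v' /w' /A /B /C /E; ring | lc 1 Ec | lc 1 Ed]).
by apply/eqP; rewrite (_ : _ + _ = (x * t - y * z) * (A * C - B * E)); [rewrite mulf_neq0 | ring].
Qed.

(* The kernel of the product on binary quadratic forms is spanned by the
   vector (k1, k2, k3) of minors, whose linear factors are the new generators. *)
Lemma class_GB :
  ~ (c2 * d3 - c3 * d2 = 0 /\ c1 * d3 - c3 * d1 = 0 /\ c1 * d2 - c2 * d1 = 0) ->
  listable (talg G).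
Proof.
have four : 4 != 0 :> F by rewrite (_ : 4 = 2 * 2); [nz | ring].
move=> nk; have [z1|n1] := eqVneq (c2 * d3 - c3 * d2) 0.
  have [z2|n2] := eqVneq (c1 * d3 - c3 * d1) 0.
    have n3 : c1 * d2 - c2 * d1 != 0 by apply/eqP=> z3; apply: nk.
    apply: (@GB_GB1 1 0 0 1).
    - by rewrite (_ : _ - _ = 1); [exact: oner_neq0 | ring].
    - by apply: (mul0_neq n3); lc c2 z2, (- c1) z1.
    - by apply: (mul0_neq n3); lc d2 z2, (- d1) z1.
    by rewrite (_ : _ - _ = c1 * d2 - c2 * d1) //; ring.
  (* The kernel is spanned by m23 a^2 - m13 a b + m12 b^2, with a, b the generators 0, 1. For m23 =
     0 it factors as b (m12 b - m13 a). *)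
  set m12 := c1 * d2 - c2 * d1; set m13 := c1 * d3 - c3 * d1 in n2.
  apply: (@GB_GB2 0 1 (- m13) m12).
  - by rewrite (_ : _ - _ = m13) //; ring.
  - by rewrite /m13 /m12; lc (- c1) z1.
  - by rewrite /m13 /m12; lc (- d1) z1.
  rewrite (_ : _ - _ = - m13 ^+ 3); first by nz.
  by rewrite /m13 /m12; lc (2 * (c1 * d3 - c3 * d1) * (c1 * d2 - c2 * d1)) z1.
(* [dl] is a square root of the discriminant of the kernel form, whose factors are a + T b with T =
   (- m13 + dl) / (2 m23) and its conjugate. A double root leads to [TB1], distinct roots to
   [TB2]. *)
have [dl dl2] := sqrtF ((c1 * d3 - c3 * d1) ^+ 2
  - 4 * (c2 * d3 - c3 * d2) * (c1 * d2 - c2 * d1)).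
set m12 := c1 * d2 - c2 * d1 in dl2; set m13 := c1 * d3 - c3 * d1 in dl2.
set m23 := c2 * d3 - c3 * d2 in dl2 n1.
have Kc : c1 * m23 - c2 * m13 + c3 * m12 = 0 by rewrite /m12 /m13 /m23; ring.
have Kd : d1 * m23 - d2 * m13 + d3 * m12 = 0 by rewrite /m12 /m13 /m23; ring.
have [dl0|dl0] := eqVneq dl 0.
  subst dl; apply: (@GB_GB1 0 1 1 (- m13 / (2 * m23))).
  - by rewrite (_ : _ - _ = - 1); [nz | ring].
  - by lcf (1 / m23) Kc, (- c3 / (4 * m23 ^+ 2)) dl2.
  - by lcf (1 / m23) Kd, (- d3 / (4 * m23 ^+ 2)) dl2.
  by rewrite (_ : _ * _ - _ * _ = - m23); [nz | rewrite /m23; ring].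
apply: (@GB_GB2 1 ((- m13 + dl) / (2 * m23)) 1 ((- m13 - dl) / (2 * m23))).
- by rewrite (_ : _ * _ - _ * _ = - dl / m23); [nz | fielda].
- by lcf (1 / m23) Kc, (- c3 / (4 * m23 ^+ 2)) dl2.
- by lcf (1 / m23) Kd, (- d3 / (4 * m23 ^+ 2)) dl2.
have NE y t : prd c1 c2 c3 1 y 1 y * prd d1 d2 d3 1 t 1 t
    - prd d1 d2 d3 1 y 1 y * prd c1 c2 c3 1 t 1 t
    = (t - y) * (2 * m12 + (t + y) * m13 + 2 * y * t * m23).
  by rewrite /m12 /m13 /m23; ring.
rewrite NE (_ : _ * _ = dl ^+ 3 / m23 ^+ 2); first by nz.
by lcf (- dl / (2 * m23 ^+ 2)) dl2.
Qed.

End GB.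
End ClassifyB.

(** * Algebras with dim J^<3> = 2 *)

Section TypeC.

Variable F : fieldType.
Hypothesis two : 2 != 0 :> F.

(* The vectors 0, 1 span J modulo J^<2> and 2 spans J^<2> modulo J^<3>; the
   latter is spanned by 3, 4. In TCx and TCy, J^<4> = 0 and the product
   of the generators modulo J^<3> is a form of rank 1, respectively 2; in TC2,
   J^<4> is spanned by 4. *)
Definition TCx (p q : F) : stable F :=
  [:: (i0, i0, [:: C0; C0; C1]); (i1, i2, [:: C0; C0; C0; C1]);
      (i0, i2, [:: C0; C0; C0; C0; C1]); (i0, i1, [:: C0; C0; C0; C0; CE p]);
      (i1, i1, [:: C0; C0; C0; C0; CE q])].

Definition TCy (p q : F) : stable F :=
  [:: (i0, i1, [:: C0; C0; C1]); (i0, i2, [:: C0; C0; C0; C1]);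
      (i1, i2, [:: C0; C0; C0; C0; C1]); (i0, i0, [:: C0; C0; C0; C0; CE p]);
      (i1, i1, [:: C0; C0; C0; CE q])].

Definition TC2 (be tau th : F) : stable F :=
  [:: (i0, i0, [:: C0; C0; C1]); (i0, i2, [:: C0; C0; C0; C1]);
      (i0, i3, [:: C0; C0; C0; C0; C1]); (i2, i2, [:: C0; C0; C0; C0; C1]);
      (i1, i2, [:: C0; C0; C0; C0; CE be]); (i1, i1, [:: C0; C0; C0; CE tau; CE th])].

(** 0 goes to t 0 + u 1 and 1 to w 1, modulo J^<2>. The 3 is 2 + 1: [u] contributes u w q' to the
    product of 0 and 1, and the component y = u w q' / (2 t) along 2, which the square of 1 forces
    on the image of 1, contributes t y. In characteristic 3 [u] has no effect. *)
Definition relX (p q p' q' : F) : Prop :=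
  exists t u w : F, [/\ t != 0, w != 0, 2 * t ^+ 3 * p = w * (2 * t * p' + 3 * u * q') &
    t ^+ 3 * q = w ^+ 2 * q'].

Definition relY (p q p' q' : F) : Prop :=
  exists t w : F, [/\ t != 0, w != 0, w ^+ 2 * p = t * p' & t ^+ 2 * q = w * q'].

(** [x] is the component along 2 of the image of 0. It enters with the coefficient 3 = 2 + 1: twice
    through the image of 2, the square of 0, and once more through the image of 3, the product of 0
    and 2. Only if 3 is invertible can it remove [th]. *)
Definition relC2 (be tau th be' tau' th' : F) : Prop :=
  exists t u w x : F, [/\ t != 0, w != 0, t ^+ 3 * be = w * (be' * t - tau' * u),
    t ^+ 3 * tau = tau' * w ^+ 2 &
    t ^+ 5 * th = w ^+ 2 * (t * th' - 3 * tau' * (be' * u + x))].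

Lemma iso_relX p q p' q' : relX p q p' q' ->
  isomorphic (talg (TCx p q)) (talg (TCx p' q')).
Proof.
move=> [t [u [w [t0 w0 Ep Eq]]]].
(* Solved from the coordinates along 3 of the square of 1 and of the product of 0 and 1: 2 w y = q
   t^2 u and u y + x w = p t^2 u. *)
pose y := q * t ^+ 2 * u / (2 * w); pose x := (p * t ^+ 2 * u - y * u) / w.
iso_with [:: [:: CE t; CE u; CE x]; [:: C0; CE w; CE y];
  [:: C0; C0; CE (t ^+ 2); CE (2 * x * u); CE (2 * t * u * p' + u ^+ 2 * q' + 2 * x * t)];
  [:: C0; C0; C0; CE (w * t ^+ 2)]; [:: C0; C0; C0; CE (t ^+ 2 * u); CE (t ^+ 3)]].
rewrite /TCx; sym; split; last by apply/eqP; rewrite ?subr0 ?addr0; nz.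
conjs ltac:(first [by ring | by rewrite /x /y; fielda | lcany | rewrite /x /y;
  lcf (- 1 / 2) Ep, (u / (2 * w)) Eq]).
Qed.

Lemma relX_iso p q p' q' : isomorphic (talg (TCx p q)) (talg (TCx p' q')) ->
  relX p q p' q'.
Proof.
move=> H; coords H; unfold TCx in H.
entry E H k0 k0 k0; subst a20; entry E H k0 k0 k1; subst a21.
entry E H k0 k2 k0; subst a40; entry E H k0 k2 k1; subst a41.
entry E H k1 k2 k0; subst a30; entry E H k1 k2 k1; subst a31; zeros H.
entry E H k0 k2 k2; subst a42; entry E H k1 k2 k2; subst a32; zeros H.
entry E H k1 k1 k2.
have z10 : a10 = 0 by apply/eqP; rewrite -sqrf_eq0 expr2 E.
subst a10; zeros H.
entry E002 H k0 k0 k2; entry E123 H k1 k2 k3; entry E124 H k1 k2 k4.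
entry E023 H k0 k2 k3; entry E024 H k0 k2 k4.
have D := is_iso_det H; sym in D.
have t0 : a00 != 0 by apply/eqP=> x0; apply: D; rewrite x0; ring.
have w0 : a11 != 0 by apply/eqP=> x0; apply: D; rewrite x0; ring.
entry E013 H k0 k1 k3; entry E014 H k0 k1 k4; entry E113 H k1 k1 k3; entry E114 H k1 k1 k4.
exists a00, a01, a11.
subst a22 a33 a34 a43 a44; split=> //.
  apply: (mulfI w0).
  by lc (- 2 * a11) E014, a00 E113, (- a01) E114.
by lc (- 1) E114.
Qed.

(** The product of the generators modulo J^<3> is a quadratic form of rank 1 on one side and of rank
    2 on the other. *)
Lemma TCx_TCy p q p' q' : ~ isomorphic (talg (TCx p q)) (talg (TCy p' q')).
Proof.
move=> H; coords H; unfold TCx, TCy in H.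
entry E H k0 k0 k0; subst a20; entry E H k0 k0 k1; subst a21.
entry E H k0 k2 k0; subst a40; entry E H k0 k2 k1; subst a41.
entry E H k1 k2 k0; subst a30; entry E H k1 k2 k1; subst a31; zeros H.
entry E H k0 k2 k2; rewrite ?(mulr0, addr0) in E; subst a42.
entry E H k1 k2 k2; rewrite ?(mulr0, addr0) in E; subst a32; zeros H.
entry E1 H k1 k1 k2; entry E2 H k0 k1 k2.
have D := is_iso_det H; sym in D.
have [z0|n0] := eqVneq a10 0.
  subst a10; have [z1|n1] := eqVneq a11 0; first by subst a11; apply: D; ring.
  have z00 : a00 = 0 by apply: (mul0_neq n1); lc 1 E2.
  by subst a00; apply: D; ring.
have z1 : a11 = 0 by apply: (mul0_neq (_ : 2 * a10 != 0)); [nz | lc 1 E1].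
have z01 : a01 = 0 by apply: (mul0_neq n0); lc 1 E2, (- a00) z1.
by subst a11 a01; apply: D; ring.
Qed.

Lemma iso_relY p q p' q' : relY p q p' q' ->
  isomorphic (talg (TCy p q)) (talg (TCy p' q')).
Proof.
move=> [t [w [t0 w0 Ep Eq]]].
iso_with [:: [:: CE t]; [:: C0; CE w]; [:: C0; C0; CE (t * w)];
  [:: C0; C0; C0; CE (t ^+ 2 * w)]; [:: C0; C0; C0; C0; CE (t * w ^+ 2)]].
rewrite /TCy; sym; split; last by apply/eqP; nz.
by conjs ltac:(first [by ring | lc (- t) Ep | lc (- w) Eq]).
Qed.

Lemma TCy_swap p q : isomorphic (talg (TCy p q)) (talg (TCy q p)).
Proof.
iso_with [:: [:: C0; C1]; [:: C1]; [:: C0; C0; C1]; [:: C0; C0; C0; C0; C1];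
  [:: C0; C0; C0; C1 : coef F]].
by rewrite /TCy; sym; split; [conjs ltac:(ring) | apply/eqP; nz].
Qed.

Lemma relY_iso p q p' q' : isomorphic (talg (TCy p q)) (talg (TCy p' q')) ->
  relY p q p' q' \/ relY p q q' p'.
Proof.
move=> H; coords H; unfold TCy in H.
entry E H k0 k1 k0; subst a20; entry E H k0 k1 k1; subst a21.
entry E H k0 k2 k0; subst a30; entry E H k0 k2 k1; subst a31.
entry E H k1 k2 k0; subst a40; entry E H k1 k2 k1; subst a41; zeros H.
entry E H k0 k2 k2; rewrite ?(mulr0, addr0) in E; subst a32.
entry E H k1 k2 k2; rewrite ?(mulr0, addr0) in E; subst a42; zeros H.
entry E012 H k0 k1 k2; subst a22.
entry E1 H k0 k0 k2; entry E2 H k1 k1 k2.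
have D := is_iso_det H; sym in D.
have [z0|n0] := eqVneq a00 0.
  subst a00; have n1 : a01 != 0 by apply/eqP=> z; subst a01; apply: D; ring.
  have n10 : a10 != 0 by apply/eqP=> z; subst a10; apply: D; ring.
  have z1 : a11 = 0 by apply: (mul0_neq (_ : 2 * a10 != 0)); [nz | lc 1 E2].
  subst a11; zeros H.
  entry E024 H k0 k2 k4; entry E023 H k0 k2 k3; entry E124 H k1 k2 k4; entry E123 H k1 k2 k3.
  entry E003 H k0 k0 k3; entry E004 H k0 k0 k4; entry E113 H k1 k1 k3; entry E114 H k1 k1 k4.
  right; exists a01, a10; split=> //.
    apply: (mulfI n1); rewrite -E123 in E003.
    by lc (- 1) E003.
  apply: (mulfI n10); rewrite -E024 in E114.
  by lc (- 1) E114.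
have z1 : a01 = 0 by apply: (mul0_neq (_ : 2 * a00 != 0)); [nz | lc 1 E1].
subst a01; have n1 : a11 != 0 by apply/eqP=> z; subst a11; apply: D; ring.
have z10 : a10 = 0 by apply: (mul0_neq (_ : 2 * a11 != 0)); [nz | lc 1 E2].
subst a10; zeros H.
entry E024 H k0 k2 k4; entry E023 H k0 k2 k3; entry E124 H k1 k2 k4; entry E123 H k1 k2 k3.
entry E003 H k0 k0 k3; entry E004 H k0 k0 k4; entry E113 H k1 k1 k3; entry E114 H k1 k1 k4.
left; exists a00, a11; split=> //.
  apply: (mulfI n0); rewrite -E124 in E004.
  by lc (- 1) E004.
apply: (mulfI n1); rewrite -E023 in E113.
by lc (- 1) E113.
Qed.

Lemma iso_relC2 be tau th be' tau' th' : relC2 be tau th be' tau' th' ->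
  isomorphic (talg (TC2 be tau th)) (talg (TC2 be' tau' th')).
Proof.
move=> [t [u [w [x [t0 w0 Eb Et Eh]]]]].
(* [y] and [z] make the product of the images of 0 and 1 vanish along 3 and along 4. *)
pose y := - u * w * tau' / t.
pose z := - (u * w * th' + x * w * be' + u * y * be' + x * y) / t.
pose v3 := u ^+ 2 * tau' + 2 * t * x.
iso_with [:: [:: CE t; CE u; CE x]; [:: C0; CE w; CE y; CE z];
  [:: C0; C0; CE (t ^+ 2); CE v3; CE (u ^+ 2 * th' + 2 * u * x * be' + x ^+ 2)];
  [:: C0; C0; C0; CE (t ^+ 3); CE (t * v3 + u * t ^+ 2 * be' + x * t ^+ 2)];
  [:: C0; C0; C0; C0; CE (t ^+ 4)]].
rewrite /TC2; sym; split; last by apply/eqP; nz.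
conjs ltac:(first [by ring | by rewrite /z /v3 /y; fielda | lcany
  | rewrite /z /v3 /y; lcf (- t) Eb
  | rewrite /z /v3 /y; lcf (- 1 / t) Eh,
     (- (u ^+ 2 * t * tau' + 2 * t ^+ 2 * x + u * t ^+ 2 * be' + x * t ^+ 2) / t ^+ 3) Et]).
Qed.

Lemma relC2_iso be tau th be' tau' th' :
  isomorphic (talg (TC2 be tau th)) (talg (TC2 be' tau' th')) -> relC2 be tau th be' tau' th'.
Proof.
move=> H; coords H; unfold TC2 in H.
entry E H k0 k0 k0; subst a20; entry E H k0 k0 k1; subst a21.
entry E H k0 k2 k0; subst a30; entry E H k0 k2 k1; subst a31.
entry E H k0 k3 k0; subst a40; entry E H k0 k3 k1; subst a41; zeros H.
entry E H k0 k2 k2; rewrite ?(mulr0, addr0) in E; subst a32.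
entry E H k0 k3 k2; rewrite ?(mulr0, addr0) in E; subst a42; zeros H.
entry E H k0 k3 k3; rewrite ?(mulr0, addr0) in E; subst a43; zeros H.
entry E H k1 k1 k2.
have z10 : a10 = 0 by apply/eqP; rewrite -sqrf_eq0 expr2 E; apply/eqP; ring.
subst a10; zeros H.
entry E002 H k0 k0 k2; subst a22; entry E023 H k0 k2 k3; subst a33.
entry E034 H k0 k3 k4; subst a44.
have D := is_iso_det H; sym in D.
have t0 : a00 != 0 by apply/eqP=> x0; apply: D; rewrite x0; ring.
have w0 : a11 != 0 by apply/eqP=> x0; apply: D; rewrite x0; ring.
entry E003 H k0 k0 k3; subst a23; entry E024 H k0 k2 k4; subst a34.
entry E013 H k0 k1 k3; entry E113 H k1 k1 k3; entry E114 H k1 k1 k4; entry E124 H k1 k2 k4.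
exists a00, a01, a11, a02; split=> //.
- by apply: (mulfI t0); lc (- 1) E124, a00 E013.
- by lc (- 1) E113.
have yE : a12 = - (a01 * a11 * tau') / a00 by lcf (1 / a00) E013.
have tE : tau = a11 ^+ 2 * tau' / a00 ^+ 3 by lcf (- 1 / a00 ^+ 3) E113.
by rewrite yE tE in E114; lcf (- a00) E114.
Qed.

End TypeC.

(** * Separation and normal forms when dim J^<3> = 2 *)

Section SeparationC.

Variable F : fieldType.
Hypothesis two : 2 != 0 :> F.
Hypothesis rootF : forall n (x : F), (0 < n)%N -> exists y, y ^+ n = x.

Definition nfCx (l : name F) (t : F * F) : Prop :=
  match l with
  | J5_31 => t = (0, 0) | J5_32 => t = (1, 0) | J5_33 => t = (0, 1)
  | M5_2 => t = (1, 1) | _ => False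
  end.

Definition nfCy (l : name F) (t : F * F) : Prop :=
  match l with
  | J5_36 => t = (0, 0) | J5_38 => t = (1, 0) | J5_40 => t = (1, 1) | _ => False
  end.

Definition nfC2 (l : name F) (t : F * F * F) : Prop :=
  match l with
  | J5_15 al => t = (1, 0, al) | J5_22 => t = (0, 1, 0) | M5_1 => t = (0, 1, - 1)
  | _ => False
  end.

Definition TCxof (t : F * F) : stable F := let: (p, q) := t in TCx p q.
Definition TCyof (t : F * F) : stable F := let: (p, q) := t in TCy p q.
Definition TC2of (t : F * F * F) : stable F := let: (be, tau, th) := t in TC2 be tau th.

Lemma listed_nfCx l t : nfCx l t -> isomorphic (talg (TCxof t)) (listed l).
Proof.
rewrite listedE; case: l => //= ->; rewrite /TCxof /TCx;
  (iso_with [:: [:: C1]; [:: C0; C0; C1]; [:: C0; C1]; [:: C0; C0; C0; C1]; [:: C0; C0; C0; C0; C1 : coef F]]);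
  by nf_check.
Qed.

Lemma listed_nfCy l t : nfCy l t -> isomorphic (talg (TCyof t)) (listed l).
Proof.
rewrite listedE; case: l => //= ->; rewrite /TCyof /TCy;
  (iso_with [:: [:: C1]; [:: C0; C1]; [:: C0; C0; C1]; [:: C0; C0; C0; C1]; [:: C0; C0; C0; C0; C1 : coef F]]);
  by nf_check.
Qed.

Lemma listed_nfC2 l t : nfC2 l t -> isomorphic (talg (TC2of t)) (listed l).
Proof.
rewrite listedE; case: l => //= [al||] ->; rewrite /TC2of /TC2.
- iso_with [:: [:: C1]; [:: C0; C0; C0; C1]; [:: C0; C1]; [:: C0; C0; C1]; [:: C0; C0; C0; C0; C1 : coef F]].
  by nf_check.
- iso_with [:: [:: C1]; [:: C0; C0; C1]; [:: C0; C1]; [:: C0; C0; C0; C1]; [:: C0; C0; C0; C0; C1 : coef F]].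
  by nf_check.
iso_with [:: [:: C1]; [:: C0; C0; C1]; [:: C0; C1]; [:: C0; C0; C0; C1; C1]; [:: C0; C0; C0; C0; C1 : coef F]].
by nf_check.
Qed.

Lemma notin_pchar3 : (3%N \notin [pchar F]) = (3 != 0 :> F).
Proof. by rewrite inE. Qed.

Lemma nfCx_same l l' t t' : nfCx l t -> nfCx l' t' ->
  isomorphic (listed l) (listed l') -> same_class l l'.
Proof.
move=> lt lt' ll'; have ll'' := isomorphic_sym ll'.
have rel l1 l2 s s' : nfCx l1 s -> nfCx l2 s' -> isomorphic (listed l1) (listed l2) ->
    relX s.1 s.2 s'.1 s'.2.
  move=> l1s l2s l12; have := isomorphic_trans (listed_nfCx l1s)
    (isomorphic_trans l12 (isomorphic_sym (listed_nfCx l2s))).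
  by move: s s' {l1s l2s} => [p q] [p' q'] /relX_iso.
have R := rel _ _ _ _ lt lt' ll'; have {rel} R' := rel _ _ _ _ lt' lt ll''.
have no1 (p p' : F) : ~ relX p 1 p' 0.
  case=> t0 [u [w [n0 w0 _ E]]]; have : t0 ^+ 3 != 0 by nz.
  by case/eqP; lc 1 E.
have no2 (p p' : F) : ~ relX p 0 p' 1.
  case=> t0 [u [w [n0 w0 _ E]]]; have : w ^+ 2 != 0 by nz.
  by case/eqP; lc (- 1) E.
have no3 : ~ relX (1 : F) 0 0 0.
  case=> t0 [u [w [n0 w0 E _]]]; have : 2 * t0 ^+ 3 != 0 by nz.
  by case/eqP; lc 1 E.
have no4 : ~ relX (0 : F) 0 1 0.
  case=> t0 [u [w [n0 w0 E _]]]; have : 2 * t0 * w != 0 by nz.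
  by case/eqP; lc (- 1) E.
have no5 : relX (0 : F) 1 1 1 -> 3 != 0 :> F.
  case=> t0 [u [w [n0 w0 E _]]]; apply/eqP=> E3; have : 2 * t0 * w != 0 by nz.
  by case/eqP; lc (- 1) E, (- w * u) E3.
move: lt lt' R R'; clear ll' ll''.
by case: l => //= ->; case: l' => //= -> /= R R'; rewrite ?notin_pchar3 //;
  first [exact: no5 R | exact: no5 R' | case: (no1 _ _ R) | case: (no1 _ _ R')
    | case: (no2 _ _ R) | case: (no2 _ _ R') | case: (no3 R) | case: (no3 R')
    | case: (no4 R) | case: (no4 R')].
Qed.

Lemma nfCy_same l l' t t' : nfCy l t -> nfCy l' t' ->
  isomorphic (listed l) (listed l') -> same_class l l'.
Proof.
move=> lt lt' ll'; have ll'' := isomorphic_sym ll'.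
have rel l1 l2 s s' : nfCy l1 s -> nfCy l2 s' -> isomorphic (listed l1) (listed l2) ->
    relY s.1 s.2 s'.1 s'.2 \/ relY s.1 s.2 s'.2 s'.1.
  move=> l1s l2s l12; have := isomorphic_trans (listed_nfCy l1s)
    (isomorphic_trans l12 (isomorphic_sym (listed_nfCy l2s))).
  by move: s s' {l1s l2s} => [p q] [p' q'] /(relY_iso two).
have R := rel _ _ _ _ lt lt' ll'; have {rel} R' := rel _ _ _ _ lt' lt ll''.
have no1 (q q' : F) : ~ relY 1 q 0 q'.
  case=> t0 [w [n0 w0 E _]]; have : w ^+ 2 != 0 by nz.
  by case/eqP; lc 1 E.
have no2 (p p' : F) : ~ relY p 1 p' 0.
  case=> t0 [w [n0 w0 _ E]]; have : t0 ^+ 2 != 0 by nz.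
  by case/eqP; lc 1 E.
move: lt lt' R R'; clear ll' ll''.
by case: l => //= ->; case: l' => //= -> /= R R'; exfalso;
  case: R => R; case: R' => R';
  first [case: (no1 _ _ R) | case: (no1 _ _ R') | case: (no2 _ _ R) | case: (no2 _ _ R')].
Qed.

Lemma nfC2_same l l' t t' : nfC2 l t -> nfC2 l' t' ->
  isomorphic (listed l) (listed l') -> same_class l l'.
Proof.
move=> lt lt' ll'; have ll'' := isomorphic_sym ll'.
have rel l1 l2 s s' : nfC2 l1 s -> nfC2 l2 s' -> isomorphic (listed l1) (listed l2) ->
    let: (be, tau, th) := s in let: (be', tau', th') := s' in relC2 be tau th be' tau' th'.
  move=> l1s l2s l12; have := isomorphic_trans (listed_nfC2 l1s)
    (isomorphic_trans l12 (isomorphic_sym (listed_nfC2 l2s))).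
  by move: s s' {l1s l2s} => [[p q] r] [[p' q'] r'] /relC2_iso.
have R := rel _ _ _ _ lt lt' ll'; have {rel} R' := rel _ _ _ _ lt' lt ll''.
have no1 (a b c d : F) : ~ relC2 a 0 b c 1 d.
  case=> t0 [u [w [x [n0 w0 _ E _]]]]; have : w ^+ 2 != 0 by nz.
  by case/eqP; lc (- 1) E.
have no2 : relC2 (0 : F) 1 0 0 1 (- 1) -> 3 != 0 :> F.
  case=> t0 [u [w [x [n0 w0 _ _ E]]]]; apply/eqP=> E3; have : w ^+ 2 * t0 != 0 by nz.
  by case/eqP; lc 1 E, (- w ^+ 2 * x) E3.
move: lt lt' R R'; clear ll' ll''.
case: l => //= [al||] ->;
  [case: l' => //= [be||] -> | case: l' => //= [be|] -> | case: l' => //= [be|] ->];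
  rewrite ?notin_pchar3 //; try by [move=> /no1 | move=> _ /no1 | move=> /no2 | move=> _ /no2].
case=> t0 [u [w [x [n0 w0 E _ E2]]]] _.
  have w1 : w = t0 ^+ 2 by apply: (mulfI n0); lc (- 1) E.
  subst w; suff -> : al = be by [].
  by apply: (mulfI (_ : t0 ^+ 5 != 0)); [nz | lc 1 E2].
Qed.

Lemma M51_J522 : 3 != 0 :> F -> isomorphic (listed (M5_1 F)) (listed (J5_22 F)).
Proof.
move=> three; have := @listed_nfC2 (M5_1 F) _ erefl; have := @listed_nfC2 (J5_22 F) _ erefl.
move=> H22 /isomorphic_sym H1; apply: isomorphic_trans H1 (isomorphic_trans _ H22).
(* With t = w = 1 and u = 0 the last equation of [relC2] reads - 1 = - 3 x. *)
apply: iso_relC2; exists 1, 0, 1, (1 / 3); split; try exact: oner_neq0; try by ring.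
by fielda.
Qed.

Lemma M52_J533 : 3 != 0 :> F -> isomorphic (listed (M5_2 F)) (listed (J5_33 F)).
Proof.
move=> three; have := @listed_nfCx (M5_2 F) _ erefl; have := @listed_nfCx (J5_33 F) _ erefl.
move=> H22 /isomorphic_sym H1; apply: isomorphic_trans H1 (isomorphic_trans _ H22).
(* With t = w = 1 the equation for p reads 2 = 3 u. *)
apply: iso_relX => //; exists 1, (2 / 3), 1; split; try exact: oner_neq0; try by ring.
by fielda.
Qed.

(** The scalings act by p = w t^-2 p' and q = w^2 t^-3 q'. The exponents form a unimodular matrix,
    so that nonzero coefficients become 1 without extracting roots. *)
Lemma class_TCx (p q : F) : listable (talg (TCx p q)).
Proof.
have H l p' q' : nfCx l (p', q') -> relX p' q' p q -> listable (talg (TCx p q)).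
  move=> ln /(iso_relX two)/listable_iso; apply; exists l.
  by split; [case: l ln | apply: (listed_nfCx ln)].
have [q0|q0] := eqVneq q 0; have [p0|p0] := eqVneq p 0.
- subst p q; apply: (H (J5_31 F) 0 0 erefl); exists 1, 0, 1.
  by split; [exact: oner_neq0 | exact: oner_neq0 | ring | ring].
- subst q; apply: (H (J5_32 F) 1 0 erefl); exists 1, 0, (1 / p).
  by split; [exact: oner_neq0 | nz | fielda | ring].
- subst p; apply: (H (J5_33 F) 0 1 erefl); exists q, 0, q.
  by split; [nz | nz | ring | ring].
apply: (H (M5_2 F) 1 1 erefl); exists (p ^+ 2 / q), 0, (p ^+ 3 / q ^+ 2).
by split; [nz | nz | fielda | fielda].
Qed.

Lemma class_TCy (p q : F) : listable (talg (TCy p q)).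
Proof.
have H l p' q' p1 q1 : nfCy l (p', q') -> relY p' q' p1 q1 -> listable (talg (TCy p1 q1)).
  move=> ln /iso_relY/listable_iso; apply; exists l.
  by split; [case: l ln | apply: (listed_nfCy ln)].
have [q0|q0] := eqVneq q 0; have [p0|p0] := eqVneq p 0.
- subst p q; apply: (H (J5_36 F) 0 0 _ _ erefl); exists 1, 1.
  by split; [exact: oner_neq0 | exact: oner_neq0 | ring | ring].
- subst q; apply: (H (J5_38 F) 1 0 _ _ erefl); exists (1 / p), 1.
  by split; [nz | exact: oner_neq0 | fielda | ring].
- subst p; apply: (listable_iso (TCy_swap q 0)).
  apply: (H (J5_38 F) 1 0 _ _ erefl); exists (1 / q), 1.
  by split; [nz | exact: oner_neq0 | fielda | ring].
(* The exponents in w^2 = t p and t^2 = w q have determinant 3 up to sign: eliminating w leaves t^3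
   = p q^2. *)
have [t t3] := @rootF 3 (p * q ^+ 2) isT.
have t0 : t != 0.
  by apply: contraTneq (mulf_neq0 p0 (mulf_neq0 q0 q0)) => t0; rewrite -expr2 -t3 t0 expr0n eqxx.
apply: (H (J5_40 F) 1 1 _ _ erefl); exists t, (t ^+ 2 / q).
split; [nz | nz | | fielda].
by lcf (t / q ^+ 2) t3.
Qed.

Lemma class_TC2 (be tau th : F) : ~ (be = 0 /\ tau = 0) -> listable (talg (TC2 be tau th)).
Proof.
move=> nbt; have H l a b c : nfC2 l (a, b, c) -> relC2 a b c be tau th -> listable (talg (TC2 be tau th)).
  move=> ln /iso_relC2/listable_iso; apply; exists l.
  by split; [case: l ln | apply: (listed_nfC2 ln)].
have [tau0|tau0] := eqVneq tau 0.
  subst tau; have be0 : be != 0 by apply/eqP=> be0; apply: nbt.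
  apply: (H (J5_15 (th / be ^+ 2)) 1 0 _ erefl); exists 1, 0, (1 / be), 0.
  by split; [exact: oner_neq0 | nz | fielda | ring | fielda].
have [E3|three] := eqVneq (3 : F) 0; last first.
  apply: (H (J5_22 F) 0 1 0 erefl).
  exists tau, be, tau, (th / 3 - be ^+ 2).
  by split; [nz | nz | ring | ring | fielda].
have [th0|th0] := eqVneq th 0.
  subst th; apply: (H (J5_22 F) 0 1 0 erefl).
  exists tau, be, tau, (- be ^+ 2).
  by split; [nz | nz | ring | ring | ring].
(* In characteristic 3 [x] is powerless. From t^3 = tau w^2 and - t^5 = w^2 t th one gets t = - th /
   tau, and [w] is a square root of t^3 / tau. *)
have [w w2] := @rootF 2 ((- th / tau) ^+ 3 / tau) isT.
have w0 : w != 0 by rewrite -sqrf_eq0 w2; nz.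
apply: (H (M5_1 F) 0 1 (- 1) erefl).
exists (- th / tau), (- be * th / tau ^+ 2), w, 0.
split; [nz | nz | by fielda | by rewrite w2; fielda | ].
by rewrite w2 E3; fielda.
Qed.

End SeparationC.

(** * Reduction to the normal tables when dim J^<3> = 2 *)

Section ClassifyC.

Variable F : fieldType.
Hypothesis two : 2 != 0 :> F.
Hypothesis rootF : forall n (x : F), (0 < n)%N -> exists y, y ^+ n = x.

Definition GC1 (q2 d2 e2 q3 d3 e3 : F) : stable F :=
  [:: (i0, i0, [:: C0; C0; C1]); (i0, i1, [:: C0; C0; CE q2; CE d2; CE e2]);
      (i1, i1, [:: C0; C0; CE q3; CE d3; CE e3]);
      (i0, i2, [:: C0; C0; C0; C0; C1]); (i1, i2, [:: C0; C0; C0; C1])].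

(* The product of the generators modulo J^<3> has the form
   (x + q2 y) ^+ 2 + (q3 - q2 ^+ 2) y ^+ 2, which is either a square or the
   product of two independent linear forms. *)
Lemma class_GC1 q2 d2 e2 q3 d3 e3 : listable (talg (GC1 q2 d2 e2 q3 d3 e3)).
Proof.
have [z z2] := @rootF 2 (q2 ^+ 2 - q3) isT.
have Eq3 : q3 = q2 ^+ 2 - z ^+ 2 by rewrite z2; ring.
subst q3; have [z0|z0] := eqVneq z 0.
  (* The generator 1 - q2 0 has its square in J^<3>; its component [y] along 2 cancels the
     coordinate 3 of that square. *)
  subst z; pose y := - (d3 - 2 * q2 * d2) / 2.
  pose p := e2 + d2 * q2 + y; pose q := e3 - 2 * q2 * e2 + q2 * (d3 - 2 * q2 * d2).
  apply: (listable_iso _ (class_TCx two p q)).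
  iso_with [:: [:: C1; C0; CE (- d2)]; [:: CE (- q2); C1; CE y];
    [:: C0; C0; C1; C0; CE (- 2 * d2)]; [:: C0; C0; C0; C1; CE (- q2)]; [:: C0; C0; C0; C0; C1]].
  rewrite /TCx /GC1; sym; split; last by apply/eqP; rewrite ?(oppr0, subr0, addr0, mulr0); nz.
  by conjs ltac:(first [by ring | by rewrite /p /q /y; fielda]).
pose fa := z - q2; pose ga := - (z + q2).
(* The vectors (fa, 1) and (ga, 1) are the isotropic ones. [Fd] and [Fe] are the coordinates along 3
   and 4 of the square of the former; this square has component - W / (2 z) along 3 + ga 4, and [x]
   cancels the one along 3 + fa 4. [Gd], [Ge], [W'] and [y] do the same for the latter. *)
pose Fd := d3 + 2 * fa * d2; pose Fe := e3 + 2 * fa * e2.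
pose Gd := d3 + 2 * ga * d2; pose Ge := e3 + 2 * ga * e2.
pose W := Fe - fa * Fd; pose W' := Ge - ga * Gd.
pose x := - (Fd + W / (2 * z)) / 2; pose y := - (Gd - W' / (2 * z)) / 2.
pose k2 := - 2 * z ^+ 2.
apply: (listable_iso _ (class_TCy rootF (- W / (2 * z) / k2) (W' / (2 * z) / k2))).
iso_with [:: [:: CE fa; C1; CE x]; [:: CE ga; C1; CE y];
  [:: C0; C0; CE k2; CE (d3 - 2 * q2 * d2 + x + y); CE (e3 - 2 * q2 * e2 + y * fa + x * ga)];
  [:: C0; C0; C0; CE k2; CE (k2 * fa)]; [:: C0; C0; C0; CE k2; CE (k2 * ga)]].
rewrite /TCy /GC1; sym; split; last first.
  have fg : fa - ga = 2 * z by rewrite /fa /ga; ring.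
  apply/eqP; rewrite (_ : _ + _ = - (fa - ga) ^+ 2 * k2 ^+ 3); last by ring.
  by rewrite fg /k2; nz.
by conjs ltac:(first [by ring | by rewrite /x /y /W /W' /Fd /Fe /Gd /Ge /k2 /fa /ga; fielda]).
Qed.

Definition GC2 (al al' be be' nu n m1 m2 k l q2 r2 s2 q3 r3 s3 : F) : stable F :=
  [:: (i0, i0, [:: C0; C0; C1]); (i0, i1, [:: C0; C0; CE q2; CE r2; CE s2]);
      (i1, i1, [:: C0; C0; CE q3; CE r3; CE s3]);
      (i0, i2, [:: C0; C0; C0; CE al; CE al']); (i1, i2, [:: C0; C0; C0; CE be; CE be']);
      (i2, i2, [:: C0; C0; C0; CE nu; CE n]);
      (i0, i3, [:: C0; C0; C0; C0; CE m1]); (i1, i3, [:: C0; C0; C0; C0; CE m2]);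
      (i2, i3, [:: C0; C0; C0; C0; CE k]); (i3, i3, [:: C0; C0; C0; C0; CE l])].

(** The last two hypotheses keep J^<3> away from J^<4>, and J^<4> away from 0. The Jordan identity
    then forces be = al q2, m2 = q2 m1 and q3 = q2^2: the generator 1 - q2 0 lowers the filtration
    like an element of J^<2>, and 0 with its powers supplies 2, 3 and 4. *)
Lemma class_GC2 al al' be be' nu n m1 m2 k l q2 r2 s2 q3 r3 s3 :
  let J := talg (GC2 al al' be be' nu n m1 m2 k l q2 r2 s2 q3 r3 s3) in
  is_jordan J -> ~ is_assoc J -> ~ [/\ al = 0, be = 0 & nu = 0] ->
  ~ [/\ m1 = 0, m2 = 0, k = 0 & l = 0] -> listable J.
Proof.
move=> J; unfold J, GC2 => {J} jJ nA nh nm.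
jord jJ [:: C1] [:: C1] E1; case: E1 => nu0 n1; subst nu.
jordl two jJ [:: C1] [:: C0; C0; C1] [:: C0; C0; C1] E2.
jordl two jJ [:: C0; C1] [:: C0; C0; C1] [:: C0; C0; C1] E3.
jordl two jJ [:: C1] [:: C0; C0; C1] [:: C1] E4.
jordl two jJ [:: C0; C1] [:: C0; C0; C1] [:: C1] E5.
jordl two jJ [:: C1; C1] [:: C0; C0; C1] [:: C1] E6.
jord jJ [:: C1] [:: C0; C1] E7.
jordl two jJ [:: C1] [:: C0; C1] [:: C1] E8.
jordl two jJ [:: C1] [:: C0; C1] [:: C0; C1] E9.
have {}E7 := proj2 E7; have {}E8 := proj2 E8; have {}E9 := proj2 E9.
(* If al = 0, then be is nonzero and the identities kill l, k, m1 and m2 in turn, that is J^<4>. *)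
have al0 : al != 0.
  apply/eqP=> al0; subst al; rewrite mul0r in n1; subst n.
  have be0 : be != 0 by apply/eqP=> be0; apply: nh.
  have l0 : l = 0.
    by apply: (mul0_neq (_ : 2 * be ^+ 2 != 0)); [nz | lc 1 E3].
  subst l; have k0 : k = 0.
    have q2k : q2 * k = 0 by apply: (mul0_neq (_ : 2 * be != 0)); [nz | lc 1 E5].
    by apply: (mul0_neq (_ : 2 * be != 0)); [nz | lc 1 E6, (- 2 * be) q2k].
  subst k; apply: nm; split=> //.
    by apply: (mul0_neq be0); lc (- 1) E7.
  by apply: (mul0_neq be0); lc (- 1) E9, (2 * q2) E7.
have l0 : l = 0 by apply: (mul0_neq (_ : 2 * al ^+ 2 != 0)); [nz | lc 1 E2].
have k0 : k = 0 by apply: (mul0_neq (_ : 2 * al != 0)); [nz | lc 1 E4].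
subst l k n; have Em2 : m2 = q2 * m1.
  by apply: (mulfI al0); lc (- 1) E8.
subst m2; have m0 : m1 != 0.
  by apply/eqP=> m0; apply: nm; rewrite m0 mulr0.
have Ebe : be = al * q2.
  by apply: (mulfI m0); lc (- 1) E7.
subst be; have Eq3 : q3 = q2 ^+ 2.
  by apply: (mulfI (mulf_neq0 al0 m0)); lc 1 E9.
subst q3; clear E2 E3 E4 E5 E6 E7 E8 E9 nh nm.
(* [y] and [z] make the new generator 1 - q2 0 + y 2 + z 3 annihilate 0; [R] and [S] are the
   coordinates of its square along 3 and 4. *)
pose y := - r2 / al.
pose z := (- s2 - y * al') / m1.
pose R := r3 - 2 * q2 * r2 + 2 * y * (al * q2 - q2 * al).
pose S := s3 - 2 * q2 * s2 + 2 * y * (be' - q2 * al') + y ^+ 2 * (al * m1).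
pose tau := R / al; pose th := (S - tau * al') / (al * m1).
pose b := (be' - q2 * al' + y * (al * m1)) / (al * m1).
have iso : isomorphic (talg (TC2 b tau th))
    (talg (GC2 al al' (al * q2) be' 0 (al * m1) m1 (q2 * m1) 0 0 q2 r2 s2 (q2 ^+ 2) r3 s3)).
  iso_with [:: [:: C1]; [:: CE (- q2); C1; CE y; CE z]; [:: C0; C0; C1];
    [:: C0; C0; C0; CE al; CE al']; [:: C0; C0; C0; C0; CE (al * m1)]].
  rewrite /TC2 /GC2; sym; split; last by apply/eqP; nz.
  by conjs ltac:(first [by ring | by rewrite /b /th /tau /R /S /z /y; fielda]).
apply: (listable_iso iso); apply: (class_TC2 rootF); case=> b0 tau0; apply: nA.
apply: (iso_assoc iso); rewrite b0 tau0; apply: assoc_check.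
by rewrite /TC2; sym; conjs ltac:(ring).
Qed.

End ClassifyC.

(** * Bases adapted to the filtration *)

Section AdaptedBases.

Variable F : fieldType.
Variable J : algebra F.

Implicit Types (X Y b : seq J) (U V W : {vspace J}).

(** Skipping the [C0] terms makes the conditions of [table_conds] literally the products computed in
    an adapted basis. *)
Fixpoint jcomb (v : seq (coef F)) b : J :=
  match v, b with
  | C0 :: v', _ :: b' => jcomb v' b'
  | c :: v', x :: b' => ev c *: x + jcomb v' b'
  | _, _ => 0
  end.

Fixpoint conjl (l : seq Prop) : Prop :=
  match l with [::] => True | [:: p] => p | p :: l' => p /\ conjl l' end.

Definition table_conds (s : stable F) b : Prop :=
  conjl (map (fun p => mulj J (nth 0 b p.1) (nth 0 b p.2) =
    jcomb (vmul s (nth [::] (units F) p.1) (nth [::] (units F) p.2)) b) ixpairs).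

Lemma conjlP (T : eqType) (f : T -> Prop) (l : seq T) :
  conjl (map f l) -> {in l, forall x, f x}.
Proof.
elim: l => [|x [|y l] IHl] //= H z; rewrite inE.
  by move/eqP->.
by case: H => fx /IHl fl /orP[/eqP-> // | /fl].
Qed.

Lemma jcombE v b : size b = 5%N -> jcomb v b = \sum_(k < 5) vev v 0 k *: b`_k.
Proof.
move=> b5; transitivity (\sum_(k < size b) ev (nth C0 v k) *: b`_k); last first.
  by rewrite b5; apply: eq_bigr => k _; rewrite mxE.
elim: b v {b5} => [|x b IHb] v; first by rewrite big_ord0; case: v => [|[]].
rewrite big_ord_recl /=; case: v => [|c v] /=.
  by rewrite scale0r add0r big1 // => i _; rewrite scale0r.
by rewrite -IHb; case: c => [||k] //=; rewrite scale0r add0r.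
Qed.

(** The passage from an abstract algebra to a table: fifteen products of basis vectors determine it,
    by commutativity and bilinearity. *)
Lemma talg_iso s b : commutative (mulj J) -> size b = 5%N -> basis_of fullv b ->
  table_conds s b -> isomorphic J (talg s).
Proof.
move=> cJ b5 bb /conjlP H; pose bt : 5.-tuple J := Tuple (introT eqP b5).
have fb : free bt by apply: basis_free bb.
pose phi (v : 'rV[F]_5) : J := \sum_(k < 5) v 0 k *: b`_k.
have lphi : linear phi.
  move=> k u v; rewrite /phi scaler_sumr -big_split; apply: eq_bigr => i _ /=.
  by rewrite !mxE scalerDl scalerA.
pose f : {linear talg s -> J} := HB.pack (phi : talg s -> J)
  (GRing.isLinear.Build F _ _ _ (phi : talg s -> J) lphi).
have phi_delta i : phi (delta_mx 0 i) = b`_i.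
  rewrite /phi (bigD1 i) //= mxE !eqxx scale1r big1 ?addr0 // => j /negbTE ji.
  by rewrite mxE eqxx ji scale0r.
have morf x y : phi (mulj (talg s) x y) = mulj J (phi x) (phi y).
  have [l r] := table_mul_is_bilinear (den s).
  move: x y; apply: bilinear_eq.
  - split=> [y|x] k x1 x2; rewrite -lphi; congr phi; [exact: l | exact: r].
  - by split=> [y|x] k x1 x2 /=; rewrite lphi; [rewrite linearPl | rewrite linearPr].
  move=> i j; wlog ij : i j / (i <= j)%N.
    move=> Wij; case: (leqP i j) => [|/ltnW] /Wij // ji.
    by rewrite talg_comm cJ ji.
  rewrite !phi_delta.
  have /(_ (val i, val j)) := H; rewrite (proj1 (ixpairsP (fun p => p \in ixpairs)) _ i j ij) //.
  move/(_ isT) => ->; rewrite jcombE // -mulj_talg !vev_units.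
  by [].
apply: isomorphic_sym; exists f; last exact: morf.
exists (fun x => \row_k coord bt k x) => [v | x] /=.
  by apply/rowP=> k; rewrite mxE (coord_sum_free _ _ fb).
rewrite {2}(coord_basis (bb : basis_of fullv bt) (memvf x)).
by apply: eq_bigr => k _; rewrite mxE.
Qed.

Lemma span_ind (Q : J -> Prop) X : (forall k u v, Q u -> Q v -> Q (k *: u + v)) -> Q 0 ->
  {in X, forall x, Q x} -> forall u, u \in <<X>>%VS -> Q u.
Proof.
move=> Qlin Q0; elim: X => [|x X IHX] QX u.
  by rewrite span_nil memv0 => /eqP->.
rewrite span_cons => /memv_addP[_ /vlineP[k ->] [v Xv ->]]; apply: Qlin.
  by apply: QX; rewrite mem_head.
by apply: IHX Xv => y yX; apply: QX; rewrite inE yX orbT.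
Qed.

Lemma prodj_span X Y W : {in X & Y, forall x y, mulj J x y \in W} ->
  (prodj <<X>> <<Y>> <= W)%VS.
Proof.
move=> H; apply/prodjP => u v Xu Yv; move: u Xu; apply: span_ind.
- by move=> k u1 u2 W1 W2; rewrite linearPl memvD ?memvZ.
- by rewrite linear0l mem0v.
move=> x Xx; move: v Yv; apply: span_ind.
- by move=> k u1 u2 W1 W2; rewrite linearPr memvD ?memvZ.
- by rewrite linear0r mem0v.
by move=> y Yy; apply: H.
Qed.

Lemma span_ext X x U : free X -> (<<X>> <= U)%VS -> \dim U = (size X).+1 ->
  x \in U -> x \notin <<X>>%VS -> U = <<x :: X>>%VS.
Proof.
move=> fX XU dU xU xX; apply/esym/eqP; rewrite eqEdim.
have fxX : free (x :: X) by rewrite free_cons xX.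
move: (fxX); rewrite /free => /eqP->; rewrite dU leqnn andbT.
by rewrite span_cons subv_add XU -memvE xU.
Qed.

Lemma ex_notin X U : free X -> (<<X>> <= U)%VS -> (size X < \dim U)%N ->
  exists2 x, x \in U & x \notin <<X>>%VS.
Proof.
move=> fX XU dX; have /subvPn[x xU xX] : ~~ (U <= <<X>>)%VS; last by exists x.
by apply: contraL dX => /dimvS; rewrite (eqP fX) -leqNgt.
Qed.

Lemma free_basis X : size X = \dim {: J} -> free X -> basis_of fullv X.
Proof.
move=> sX fX; rewrite basisEfree fX subvf /=; by rewrite sX.
Qed.

End AdaptedBases.

Ltac tconds :=
  unfold table_conds; cbv beta iota zeta delta [ev cadd cmul copp vadd vscale tcoef vmul
    units ixpairs map nth eqn fst snd nat_of_ord jcomb conjl];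
  repeat (apply: conj); rewrite ?scale1r ?addr0 //.

(** * From the dimensions of the filtration to a table *)

Section Shapes.

Variable F : fieldType.
Hypothesis two : 2 != 0 :> F.
Hypothesis rootF : forall n (x : F), (0 < n)%N -> exists y, y ^+ n = x.
Variable J : algebra F.
Hypothesis dimJ : \dim {: J} = 5%N.
Hypothesis jJ : is_jordan J.

Let cJ : commutative (mulj J) := jJ.1.
Let sqrtF (x : F) : exists y, y ^+ 2 = x := @rootF 2 x isT.


Lemma powjM n x y : x \in powj J n.+1 -> mulj J x y \in powj J n.+2.
Proof. by move=> Jx; apply: memv_prodj; rewrite ?memvf. Qed.

Lemma powj1M x y : mulj J x y \in powj J 2.
Proof. by apply: (@powjM 0); apply: memvf. Qed.

Lemma powj_sub n : (powj J n.+2 <= powj J n.+1)%VS.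
Proof.
elim: n => [|n IHn]; first exact: subvf.
apply/prodjP => u v Ju _; apply: powjM; exact: (subvP IHn).
Qed.

Lemma powj0_mul n x y : powj J n.+2 = 0%VS -> x \in powj J n.+1 -> mulj J x y = 0.
Proof. by move=> Jn0 /(powjM y); rewrite Jn0 memv0 => /eqP. Qed.

(** Polarisation: 2 (x∘y) = (x + y)^2 - x^2 - y^2, so that the squares of basis vectors and of their
    pairwise sums span J^<2>. *)
Lemma ex_square W : ~~ (powj J 2 <= W)%VS -> exists x, mulj J x x \notin W.
Proof.
pose s : seq J := vbasis {:J} ++ [seq x + y | x <- vbasis {:J}, y <- vbasis {:J}].
case: (altP (allP (a := fun z => mulj J z z \in W) (s := s))) => [sW|/allPn[x _ xW] _]; last by exists x.
case/negP; rewrite -[powj J 2]/(prodj fullv fullv) -(span_basis (vbasisP {:J})); apply: prodj_span => x y Bx By.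
have xx : mulj J x x \in W by apply: sW; rewrite mem_cat Bx.
have yy : mulj J y y \in W by apply: sW; rewrite mem_cat By.
have : mulj J (x + y) (x + y) \in W.
  by apply: sW; rewrite mem_cat; apply/orP; right; apply/allpairsP; exists (x, y).
rewrite linearDl !linearDr /= (cJ y x) => xy.
suff -> : mulj J x y = 2^-1 *: (mulj J x x + mulj J x y + (mulj J x y + mulj J y y)
    - mulj J x x - mulj J y y) by rewrite memvZ ?memvB.
have -> : mulj J x x + mulj J x y + (mulj J x y + mulj J y y) - mulj J x x - mulj J y y
  = 2 *: mulj J x y.
  by apply/eqP; rewrite !subr_eq scaler_nat mulr2n [X in _ == X]addrC !addrA.
by rewrite scalerA mulVf ?scale1r.
Qed.

Lemma mem_span1 (x e : J) : x \in <<[:: e]>>%VS -> exists k, x = k *: e.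
Proof. by rewrite span_seq1 => /vlineP. Qed.

Lemma mem_span2 (x v e : J) : x \in <<[:: v; e]>>%VS -> exists k l, x = k *: v + l *: e.
Proof.
rewrite span_cons => /memv_addP[_ /vlineP[k ->] [_ /mem_span1[l ->] ->]].
by exists k, l.
Qed.

Lemma mem_span3 (x w v e : J) : x \in <<[:: w; v; e]>>%VS ->
  exists h k l, x = h *: w + (k *: v + l *: e).
Proof.
rewrite span_cons => /memv_addP[_ /vlineP[k ->] [_ /mem_span2[l [m ->]] ->]].
by exists k, l, m.
Qed.

(** J^<2> is spanned by a square v and J^<3>, and J^<4> = 0, so that the action on J^<2> reduces to
    x |-> x∘v with values in a line. Take [x3] with x3∘v nonzero and correct the other two
    generators by multiples of [x3] so that they annihilate v. *)
Lemma shape_A : \dim (powj J 2) = 2%N -> \dim (powj J 3) = 1%N -> powj J 4 = 0%VS ->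
  ~ is_assoc J -> listable J.
Proof.
move=> d2 d3 J40 nA.
have [x0 x0v] : exists x, mulj J x x \notin powj J 3.
  by apply: ex_square; apply: contraTN isT => /dimvS; rewrite d2 d3.
set v := mulj J x0 x0 in x0v.
have J2v : v \in powj J 2 by apply: powj1M.
(* The Jordan identity at x = y = x0 turns v∘v into x0∘(v∘x0), an element of J^<4>. *)
have vv : mulj J v v = 0.
  by rewrite /v jJ.2 cJ; apply: (powj0_mul _ J40); apply: powjM.
have J3M x y : x \in powj J 3 -> mulj J x y = 0 by move=> ?; apply: (powj0_mul _ J40).
have span0 (W : {vspace J}) : (<<[::]>> <= W)%VS by rewrite span_nil sub0v.
have [e1 J3e1 ne1] : exists2 x, x \in powj J 3 & x \notin <<[::]>>%VS.
  by apply: ex_notin; rewrite ?nil_free // d3.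
have fe1 : free [:: e1] by rewrite free_cons ne1 nil_free.
have J3E : powj J 3 = <<[:: e1]>>%VS by apply: span_ext; rewrite ?nil_free.
have J2E1 : powj J 2 = <<[:: v; e1]>>%VS.
  by apply: span_ext; rewrite -?J3E ?powj_sub.
have [x3 x3v] : exists x3, mulj J x3 v != 0.
  case: (altP (allP (a := fun z => mulj J z v == 0) (s := vbasis {:J}))) => [H|/allPn[x _ xv]].
    suff : (powj J 3 <= 0)%VS by rewrite subv0 => /eqP J30; move: d3; rewrite J30 dimv0.
    rewrite -[powj J 3]/(prodj (powj J 2) fullv) J2E1 -(span_basis (vbasisP {:J})).
    apply: prodj_span => x y; rewrite !inE memv0 => /orP[]/eqP-> By; first by rewrite cJ H.
    by rewrite J3M.
  by exists x.
pose e := mulj J x3 v.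
have J3e : e \in powj J 3 by rewrite /e cJ; apply: powjM.
have fe : free [:: e] by rewrite free_cons nil_free span_nil memv0 x3v.
have {}J3E : powj J 3 = <<[:: e]>>%VS.
  by apply: span_ext => //; rewrite ?nil_free ?span_nil ?sub0v ?memv0.
have J2E : powj J 2 = <<[:: v; e]>>%VS.
  by apply: span_ext; rewrite -?J3E ?powj_sub.
have fve : free [:: v; e] by rewrite free_cons -J3E x0v.
have x3J2 : x3 \notin <<[:: v; e]>>%VS.
  apply: contra x3v; move=> /mem_span2[k [l ->]].
  by rewrite linearPl vv scaler0 add0r linearZl_LR J3M ?scaler0 //.
have f3 : free [:: x3; v; e] by rewrite free_cons x3J2.
have [x2 _ n2] : exists2 x, x \in fullv & x \notin <<[:: x3; v; e]>>%VS.
  by apply: ex_notin; rewrite ?subvf ?dimJ.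
have f4 : free [:: x2; x3; v; e] by rewrite free_cons n2.
have [x1 _ n1] : exists2 x, x \in fullv & x \notin <<[:: x2; x3; v; e]>>%VS.
  by apply: ex_notin; rewrite ?subvf ?dimJ.
have lam x : exists k, mulj J x v = k *: e.
  by apply: mem_span1; rewrite -J3E cJ; apply: powjM.
have [[k1 E1] [k2 E2]] := (lam x1, lam x2).
have x3S : x3 \in <<[:: x3; v; e]>>%VS by rewrite memv_span ?mem_head.
pose y2 := x2 - k2 *: x3; pose y1 := x1 - k1 *: x3.
have m2 : y2 \notin <<[:: x3; v; e]>>%VS by rewrite rpredBr // memvZ.
have S2 : <<[:: y2; x3; v; e]>>%VS = <<[:: x2; x3; v; e]>>%VS.
  apply/eqP; rewrite eqEdim; apply/andP; split.
    apply/span_subvP=> z; rewrite in_cons => /orP[/eqP->|zS].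
      by rewrite memvB ?memvZ ?memv_span // !inE eqxx ?orbT.
    by rewrite memv_span // in_cons zS orbT.
  have f4' : free [:: y2; x3; v; e] by rewrite free_cons m2.
  by rewrite (eqP f4) (eqP f4').
have m1 : y1 \notin <<[:: y2; x3; v; e]>>%VS.
  by rewrite S2 rpredBr // memvZ // memv_span // !inE eqxx ?orbT.
have fb : free [:: y1; y2; x3; v; e] by rewrite !free_cons m1 m2 x3J2 -J3E x0v nil_free span_nil memv0 x3v.
have y1v : mulj J y1 v = 0 by rewrite linearBl linearZl_LR /= E1 subrr.
have y2v : mulj J y2 v = 0 by rewrite linearBl linearZl_LR /= E2 subrr.
have pr x y : exists q r, mulj J x y = q *: v + r *: e.
  by apply: mem_span2; rewrite -J2E powj1M.
have [[q11 [r11 E11]] [q12 [r12 E12]]] := (pr y1 y1, pr y1 y2).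
have [[q13 [r13 E13]] [q22 [r22 E22]]] := (pr y1 x3, pr y2 y2).
have [[q23 [r23 E23]] [q33 [r33 E33]]] := (pr y2 x3, pr x3 x3).
have iso : isomorphic J (talg (GA q11 q12 q13 q22 q23 q33 r11 r12 r13 r22 r23 r33)).
  apply: (talg_iso (b := [:: y1; y2; x3; v; e])) => //.
    by apply: free_basis.
  have xe x : mulj J x e = 0 by rewrite cJ J3M.
  by unfold GA; tconds.
apply: listable_iso (isomorphic_sym iso) _; apply: class_GA => //.
by move/(iso_assoc (isomorphic_sym iso)).
Qed.

Lemma span_eq (X : seq J) (U : {vspace J}) : free X -> {subset X <= U} -> \dim U = size X -> U = <<X>>%VS.
Proof.
move=> fX XU dU; apply/esym/eqP; rewrite eqEdim (eqP fX) dU leqnn andbT.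
exact/span_subvP.
Qed.

(** Any basis adapted to the filtration gives a table [GB]. Its minors cannot all vanish, for
    otherwise the products of the generators would span at most a line modulo J^<3>. *)
Lemma shape_B : \dim (powj J 2) = 3%N -> \dim (powj J 3) = 1%N -> powj J 4 = 0%VS ->
  ~ is_assoc J -> listable J.
Proof.
move=> d2 d3 J40 nA.
have J3M x y : x \in powj J 3 -> mulj J x y = 0 by move=> ?; apply: (powj0_mul _ J40).
have span0 (W : {vspace J}) : (<<[::]>> <= W)%VS by rewrite span_nil sub0v.
have [e J3e ne] : exists2 x, x \in powj J 3 & x \notin <<[::]>>%VS.
  by apply: ex_notin; rewrite ?nil_free // d3.
have fe : free [:: e] by rewrite free_cons ne nil_free.
have J3E : powj J 3 = <<[:: e]>>%VS by apply: span_ext; rewrite ?nil_free.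
have [d J2d nd] : exists2 x, x \in powj J 2 & x \notin <<[:: e]>>%VS.
  by apply: ex_notin; rewrite -?J3E ?powj_sub // d2.
have fde : free [:: d; e] by rewrite free_cons nd.
have J2e : e \in powj J 2 by apply: (subvP (powj_sub 1)).
have [c J2c nc] : exists2 x, x \in powj J 2 & x \notin <<[:: d; e]>>%VS.
  apply: ex_notin; rewrite ?d2 //; apply/span_subvP => z.
  by rewrite !inE => /orP[]/eqP->.
have fcde : free [:: c; d; e] by rewrite free_cons nc.
have J2E : powj J 2 = <<[:: c; d; e]>>%VS.
  by apply: span_eq => // z; rewrite !inE => /or3P[]/eqP->.
have [b _ nb] : exists2 x, x \in fullv & x \notin <<[:: c; d; e]>>%VS.
  by apply: ex_notin; rewrite ?subvf ?dimJ.
have fb : free [:: b; c; d; e] by rewrite free_cons nb.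
have [a _ na] : exists2 x, x \in fullv & x \notin <<[:: b; c; d; e]>>%VS.
  by apply: ex_notin; rewrite ?subvf ?dimJ.
have fa : free [:: a; b; c; d; e] by rewrite free_cons na.
have Ba : basis_of fullv [:: a; b; c; d; e] by apply: free_basis.
have pr x y : exists q1 q2 q3, mulj J x y = q1 *: c + (q2 *: d + q3 *: e).
  by apply: mem_span3; rewrite -J2E powj1M.
have pr1 x y : y \in powj J 2 -> exists k, mulj J x y = k *: e.
  by move=> Jy; apply: mem_span1; rewrite -J3E cJ; apply: powjM.
have [c1 [d1 [e1 E00]]] := pr a a; have [c2 [d2' [e2 E01]]] := pr a b.
have [c3 [d3' [e3 E11]]] := pr b b.
have [p E02] := pr1 a c J2c; have [q E03] := pr1 a d J2d.
have [r E12] := pr1 b c J2c; have [s E13] := pr1 b d J2d.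
have [u E22] := pr1 c c J2c; have [v E23] := pr1 c d J2d; have [w E33] := pr1 d d J2d.
have eM x : mulj J e x = 0 by apply: J3M.
have Me x : mulj J x e = 0 by rewrite cJ J3M.
have iso : isomorphic J (talg (GB c1 d1 e1 c2 d2' e2 c3 d3' e3 p q r s u v w)).
  apply: (talg_iso (b := [:: a; b; c; d; e])) => //.
  by unfold GB; tconds.
apply: listable_iso (isomorphic_sym iso) _; apply: class_GB => //.
- by apply: iso_jordan jJ.
- by move/(iso_assoc (isomorphic_sym iso)).
case=> k1 [k2 k3].
(* Since the minors vanish, the three vectors (ci, di) are proportional, hence killed by a nonzero
   linear form (s1, s2); then J^<2> lies in the span of [x] and [e], of dimension at most 2. *)
have [s1 [s2 [s12 H1 H2 H3]]] : exists s1 s2 : F,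
    [/\ (s1 != 0) || (s2 != 0), s1 * c1 + s2 * d1 = 0,
        s1 * c2 + s2 * d2' = 0 & s1 * c3 + s2 * d3' = 0].
  case: (eqVneq c1 0) => [z1|n1]; last first.
    by exists (- d1), c1; rewrite n1 orbT; split=> //; [ring | lc 1 k3 | lc 1 k2].
  case: (eqVneq c2 0) => [z2|n2]; last first.
    by exists (- d2'), c2; rewrite n2 orbT; split=> //; [lc (- 1) k3 | ring | lc 1 k1].
  case: (eqVneq c3 0) => [z3|n3]; last first.
    by exists (- d3'), c3; rewrite n3 orbT; split=> //; [lc (- 1) k2 | lc (- 1) k1 | ring].
  by exists 1, 0; rewrite oner_neq0 z1 z2 z3; split=> //; ring.
pose x := s2 *: c - s1 *: d.
have xE (i j k : F) : s1 * i + s2 * j = 0 -> i *: c + (j *: d + k *: e) \in <<[:: x; e]>>%VS.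
  move=> ij; rewrite addrA memvD //; last by rewrite memvZ // memv_span // !inE eqxx orbT.
  have xS : x \in <<[:: x; e]>>%VS by rewrite memv_span ?mem_head.
  case/orP: s12 => n0.
    have -> : i *: c + j *: d = (- j / s1) *: x; last by rewrite memvZ.
    rewrite /x scalerBr !scalerA (_ : - j / s1 * s2 = i); last by lcf (- 1 / s1) ij.
    by rewrite -scaleNr (_ : - (- j / s1 * s1) = j) //; fielda.
  have -> : i *: c + j *: d = (i / s2) *: x; last by rewrite memvZ.
  rewrite /x scalerBr !scalerA (_ : i / s2 * s2 = i); last by fielda.
  by rewrite -scaleNr (_ : - (i / s2 * s1) = j) //; lcf (- 1 / s2) ij.
have J2x : (powj J 2 <= <<[:: x; e]>>)%VS.
  rewrite -[powj J 2]/(prodj fullv fullv) -(span_basis Ba); apply: prodj_span.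
  have ke k : k *: e \in <<[:: x; e]>>%VS by rewrite memvZ // memv_span // !inE eqxx orbT.
  move=> y z; rewrite !inE => /orP[|/or4P[]] /eqP-> /orP[|/or4P[]] /eqP->;
    rewrite ?(eM, Me) ?mem0v //;
    by rewrite ?E00 ?E01 ?E11 ?E02 ?E03 ?E12 ?E13 ?E22 ?E23 ?E33 ?xE //
       cJ ?E01 ?E02 ?E03 ?E12 ?E13 ?E23 ?xE.
have := leq_trans (dimvS J2x) (dim_span _).
by rewrite d2.
Qed.

(** With v a square outside J^<3>, J^<2> is spanned by v and J^<3>, so that J^<2>∘J^<2> = 0 and
    J^<3> is spanned by a∘v and b∘v. Having dimension 2, it has these two vectors as a basis. *)
Lemma shape_C1 : \dim (powj J 2) = 3%N -> \dim (powj J 3) = 2%N -> powj J 4 = 0%VS ->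
  listable J.
Proof.
move=> d2 d3 J40.
have J3M x y : x \in powj J 3 -> mulj J x y = 0 by move=> ?; apply: (powj0_mul _ J40).
have J3M' x y : x \in powj J 3 -> mulj J y x = 0 by rewrite cJ; apply: J3M.
have [a av] : exists x, mulj J x x \notin powj J 3.
  by apply: ex_square; apply: contraTN isT => /dimvS; rewrite d2 d3.
set v := mulj J a a in av.
have J2v : v \in powj J 2 by apply: powj1M.
have vv : mulj J v v = 0.
  by rewrite /v jJ.2 cJ; apply: J3M; apply: powjM; apply: powj1M.
have J2J3 x : x \in powj J 2 -> exists k, exists2 x', x' \in powj J 3 & x = k *: v + x'.
  move=> J2x; have f3 := vbasisP (powj J 3).
  have E : powj J 2 = <<v :: vbasis (powj J 3)>>%VS.
    apply: span_ext; rewrite ?(basis_free f3) ?(span_basis f3) ?powj_sub //.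
    by rewrite size_tuple d3 d2.
  move: J2x; rewrite E span_cons (span_basis f3) => /memv_addP[_ /vlineP[k ->] [y J3y ->]].
  by exists k, y.
have J2M x y : x \in powj J 2 -> y \in powj J 2 -> mulj J x y = 0.
  move=> /J2J3[k [x' J3x ->]] /J2J3[l [y' J3y ->]].
  rewrite linearDl !linearDr /= !(J3M _ _ J3x) !(J3M' _ _ J3y) !addr0.
  by rewrite linearZl_LR linearZr_LR /= vv !scaler0.
have aJ2 : a \notin powj J 2.
  by apply: contra av => J2a; apply: powjM.
have f2 := vbasisP (powj J 2).
have fa : free (a :: vbasis (powj J 2)).
  by rewrite free_cons (span_basis f2) aJ2 (basis_free f2).
have [b _ nb] : exists2 x, x \in fullv & x \notin <<a :: vbasis (powj J 2)>>%VS.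
  by apply: ex_notin; rewrite ?subvf ?dimJ //= size_tuple d2.
have fb : free (b :: a :: vbasis (powj J 2)) by rewrite free_cons nb.
have Bb : basis_of fullv (b :: a :: vbasis (powj J 2)).
  by apply: free_basis; rewrite //= size_tuple d2 dimJ.
pose d := mulj J b v; pose e := mulj J a v.
have J3d : d \in powj J 3 by rewrite /d cJ; apply: powjM.
have J3e : e \in powj J 3 by rewrite /e cJ; apply: powjM.
have J3S : (powj J 3 <= <<[:: d; e]>>)%VS.
  rewrite -[powj J 3]/(prodj (powj J 2) fullv) -{1}(span_basis f2) -(span_basis Bb).
  apply: prodj_span => x y Bx; rewrite !in_cons.
  have /J2J3[k [x' J3x Ex]] := vbasis_mem Bx.
  have xE z : mulj J x z = k *: mulj J z v.
    by rewrite Ex linearDl /= (J3M _ _ J3x) addr0 linearZl_LR /= cJ.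
  case/or3P=> [/eqP->|/eqP->|By].
  - by rewrite xE memvZ // memv_span // !inE eqxx.
  - by rewrite xE memvZ // memv_span // !inE eqxx orbT.
  by rewrite J2M ?mem0v // vbasis_mem.
have J3E : powj J 3 = <<[:: d; e]>>%VS.
  apply/eqP; rewrite eqEsubv J3S; apply/span_subvP => z.
  by rewrite !inE => /orP[]/eqP->.
have fde : free [:: d; e] by rewrite /free -J3E d3.
have fvde : free [:: v; d; e] by rewrite free_cons -J3E av.
have J2E : powj J 2 = <<[:: v; d; e]>>%VS.
  by apply: span_ext; rewrite // -J3E ?powj_sub.
have S : <<a :: vbasis (powj J 2)>>%VS = <<[:: a; v; d; e]>>%VS.
  by rewrite !(span_cons a) (span_basis f2) J2E.
have fall : free [:: b; a; v; d; e].
  by rewrite free_cons -S nb free_cons -J2E aJ2.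
have fall' : free [:: a; b; v; d; e].
  by rewrite (perm_free (_ : perm_eq _ [:: b; a; v; d; e])) // -[_ :: _ in X in perm_eq X _]/([:: a] ++ [:: b] ++ [:: v; d; e]) perm_catCA.
have pr x y : exists q1 q2 q3, mulj J x y = q1 *: v + (q2 *: d + q3 *: e).
  by apply: mem_span3; rewrite -J2E powj1M.
have [q2 [d2' [e2 E01]]] := pr a b; have [q3 [d3' [e3 E11]]] := pr b b.
have iso : isomorphic J (talg (GC1 q2 d2' e2 q3 d3' e3)).
  apply: (talg_iso (b := [:: a; b; v; d; e])) => //; first exact: free_basis.
  have [dM eM] : (forall x, mulj J x d = 0) /\ (forall x, mulj J x e = 0).
    by split=> x; apply: J3M'.
  by unfold GC1; tconds.
exact: listable_iso (isomorphic_sym iso) (class_GC1 two rootF _ _ _ _ _ _).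
Qed.

Lemma shape_C2 : \dim (powj J 2) = 3%N -> \dim (powj J 3) = 2%N -> \dim (powj J 4) = 1%N ->
  powj J 5 = 0%VS -> ~ is_assoc J -> listable J.
Proof.
move=> d2 d3 d4 J50 nA.
have J4M x y : x \in powj J 4 -> mulj J x y = 0 by move=> ?; apply: (powj0_mul _ J50).
have J4M' x y : x \in powj J 4 -> mulj J y x = 0 by rewrite cJ; apply: J4M.
have [a av] : exists x, mulj J x x \notin powj J 3.
  by apply: ex_square; apply: contraTN isT => /dimvS; rewrite d2 d3.
set v := mulj J a a in av.
have J2v : v \in powj J 2 by apply: powj1M.
have aJ2 : a \notin powj J 2.
  by apply: contra av => J2a; apply: powjM.
have span0 (W : {vspace J}) : (<<[::]>> <= W)%VS by rewrite span_nil sub0v.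
have [e J4e ne] : exists2 x, x \in powj J 4 & x \notin <<[::]>>%VS.
  by apply: ex_notin; rewrite ?nil_free // d4.
have fe : free [:: e] by rewrite free_cons ne nil_free.
have J4E : powj J 4 = <<[:: e]>>%VS by apply: span_ext; rewrite ?nil_free.
have [w J3w nw] : exists2 x, x \in powj J 3 & x \notin <<[:: e]>>%VS.
  by apply: ex_notin; rewrite -?J4E ?powj_sub // d3.
have fwe : free [:: w; e] by rewrite free_cons nw.
have J3E : powj J 3 = <<[:: w; e]>>%VS by apply: span_ext => //; rewrite -J4E powj_sub.
have fvwe : free [:: v; w; e] by rewrite free_cons -J3E av.
have J2E : powj J 2 = <<[:: v; w; e]>>%VS by apply: span_ext; rewrite -?J3E ?powj_sub.
have fa : free [:: a; v; w; e] by rewrite free_cons -J2E aJ2.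
have [b _ nb] : exists2 x, x \in fullv & x \notin <<[:: a; v; w; e]>>%VS.
  by apply: ex_notin; rewrite ?subvf ?dimJ.
have fb : free [:: b; a; v; w; e] by rewrite free_cons nb.
have fb' : free [:: a; b; v; w; e].
  by rewrite (perm_free (_ : perm_eq _ [:: b; a; v; w; e])) // -[_ :: _ in X in perm_eq X _]/([:: a] ++ [:: b] ++ [:: v; w; e]) perm_catCA.
have Ba : basis_of fullv [:: a; b; v; w; e] by apply: free_basis.
have pr x y : exists q1 q2 q3, mulj J x y = q1 *: v + (q2 *: w + q3 *: e).
  by apply: mem_span3; rewrite -J2E powj1M.
have pr2 x y : y \in powj J 2 -> exists k l, mulj J x y = k *: w + l *: e.
  by move=> Jy; apply: mem_span2; rewrite -J3E cJ; apply: powjM.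
have pr1 x y : y \in powj J 3 -> exists k, mulj J x y = k *: e.
  by move=> Jy; apply: mem_span1; rewrite -J4E cJ; apply: powjM.
have [q2 [r2 [s2 E01]]] := pr a b; have [q3 [r3 [s3 E11]]] := pr b b.
have [al [al' E02]] := pr2 a v J2v; have [be [be' E12]] := pr2 b v J2v.
have [nu [n E22]] := pr2 v v J2v.
have [m1 E03] := pr1 a w J3w; have [m2 E13] := pr1 b w J3w.
have [k E23] := pr1 v w J3w; have [l E33] := pr1 w w J3w.
have eM x : mulj J e x = 0 by apply: J4M.
have Me x : mulj J x e = 0 by apply: J4M'.
have iso : isomorphic J (talg (GC2 al al' be be' nu n m1 m2 k l q2 r2 s2 q3 r3 s3)).
  apply: (talg_iso (b := [:: a; b; v; w; e])) => //.
  by unfold GC2; tconds.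
apply: listable_iso (isomorphic_sym iso) _; apply: class_GC2 => //.
- by apply: iso_jordan jJ.
- by move/(iso_assoc (isomorphic_sym iso)).
(* Vanishing of al, be and nu would put J^<3> inside J^<4>. *)
- case=> z1 z2 z3; have /dimvS : (powj J 3 <= powj J 4)%VS; last by rewrite d3 d4.
  rewrite -[powj J 3]/(prodj (powj J 2) fullv) J2E -(span_basis Ba) J4E.
  have ke c : c *: e \in <<[:: e]>>%VS by rewrite memvZ // memv_span // mem_head.
  apply: prodj_span => y z; rewrite !inE => /or3P[] /eqP-> /orP[|/or4P[]] /eqP->;
    rewrite ?(eM, Me) ?mem0v //;
    by [ rewrite ?E02 ?E12 ?E22 ?E03 ?E13 ?E23 ?E33 ?z1 ?z2 ?z3 ?scale0r ?add0r ke
       | rewrite cJ ?E02 ?E12 ?E22 ?E03 ?E13 ?E23 ?E33 ?z1 ?z2 ?z3 ?scale0r ?add0r ke].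
case=> z1 z2 z3 z4; have : (powj J 4 <= 0)%VS; last first.
  by rewrite subv0 => /eqP J40; move: d4; rewrite J40 dimv0.
rewrite -[powj J 4]/(prodj (powj J 3) fullv) J3E -(span_basis Ba).
apply: prodj_span => y z; rewrite !inE => /orP[] /eqP-> /orP[|/or4P[]] /eqP->;
  rewrite memv0 ?(eM, Me) //;
  by rewrite ?(cJ w) ?E03 ?E13 ?E23 ?E33 ?z1 ?z2 ?z3 ?z4 ?scale0r.
Qed.

End Shapes.

(** * Powers of an element, and the possible dimensions *)

Section Classification.

Variable F : fieldType.
Hypothesis two : 2 != 0 :> F.
Hypothesis rootF : forall n (x : F), (0 < n)%N -> exists y, y ^+ n = x.
Variable J : algebra F.
Hypothesis jJ : is_jordan J.

Let cJ : commutative (mulj J) := jJ.1.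

(** Exponents are shifted, since there is no unit: [jpow a i] is the power of exponent i + 1. *)
Definition jpow (a : J) i : J := iter i (mulj J a) a.

(** Power-associativity. The linearised identity at a and its powers of exponents i + 1 and j + 1
    contains twice the wanted product; every other term is known by induction on i and then on j. *)
Lemma jpow_mul a i j : mulj J (jpow a i) (jpow a j) = jpow a (i + j).+1.
Proof.
have aP k : mulj J a (jpow a k) = jpow a k.+1 by [].
have P1 k : mulj J (mulj J a a) (jpow a k) = jpow a k.+2.
  by elim: k => [|k IHk]; [rewrite cJ | rewrite /= jJ.2 IHk].
elim: i j => [|i IHi] j //.
elim: j => [|j IHj]; first by rewrite addn0 cJ.
have := jordan_lin two jJ a (jpow a i) (jpow a j).
rewrite IHi !P1 !aP IHj IHi aP !addnS !addSn => /addIr.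
exact: scalerI.
Qed.

Lemma jpow_powj a i : jpow a i \in powj J i.+1.
Proof. by elim: i => [|i IHi]; [apply: memvf | rewrite /= cJ; apply: powjM]. Qed.

Lemma powj_le m n : (powj J (m + n).+1 <= powj J m.+1)%VS.
Proof.
elim: n => [|n IHn]; first by rewrite addn0.
by rewrite addnS; apply: subv_trans (powj_sub J _) IHn.
Qed.

Section Nilpotent.

Variable N : nat.
Hypothesis JN0 : powj J N.+1 = 0%VS.

(** Once two consecutive terms agree, the filtration is constant, and nilpotency makes it zero. *)
Lemma powj_stable n : powj J n.+2 = powj J n.+1 -> powj J n.+1 = 0%VS.
Proof.
move=> E; have {}E k : powj J (n + k).+1 = powj J n.+1.
  elim: k => [|k IHk]; first by rewrite addn0.
  by rewrite addnS -[powj J _.+2]/(prodj (powj J _.+1) fullv) IHk.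
by apply/eqP; rewrite -subv0 -JN0 -(E N) addnC powj_le.
Qed.

Lemma powj_dim_lt n : powj J n.+1 != 0%VS -> (\dim (powj J n.+2) < \dim (powj J n.+1))%N.
Proof.
move=> n0; rewrite ltnNge; apply: contra n0 => le; apply/eqP/powj_stable/eqP.
by rewrite eqEdim powj_sub.
Qed.

(* One generator: J is spanned by the powers of a, which multiply associatively. *)
Lemma one_generator_assoc : \dim {: J} = (\dim (powj J 2)).+1 -> is_assoc J.
Proof.
move=> d2; have f2 := vbasisP (powj J 2).
have [a _ na] : exists2 x, x \in fullv & x \notin <<vbasis (powj J 2)>>%VS.
  by apply: ex_notin; rewrite ?subvf ?(basis_free f2) // size_tuple d2.
have Jfull : fullv = <<a :: vbasis (powj J 2)>>%VS.
  by apply: span_ext; rewrite ?subvf ?(basis_free f2) ?memvf // size_tuple.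
pose P := [seq jpow a i | i <- iota 0 N].
have Pmem i : jpow a i \in <<P>>%VS.
  case: (ltnP i N) => iN.
    by apply/memv_span/mapP; exists i; rewrite ?mem_iota.
  suff -> : jpow a i = 0 by rewrite mem0v.
  have := subvP (powj_le N (i - N)) (jpow a i); rewrite subnKC // => /(_ (jpow_powj a i)).
  by rewrite JN0 memv0 => /eqP.
have PP : (prodj <<P>> <<P>> <= <<P>>)%VS.
  by apply: prodj_span => _ _ /mapP[i _ ->] /mapP[j _ ->]; rewrite jpow_mul.
(* J is the line of [a] plus J^<2>; squaring the inclusion for n puts J^<2>, hence J, inside the
   powers of [a] plus the next term. At n = N the last summand is zero. *)
have cover n : (fullv <= <<P>> + powj J n.+1)%VS.
  elim: n => [|n IHn]; first exact: addvSr.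
  have J2 : (powj J 2 <= <<P>> + powj J n.+2)%VS.
    apply/prodjP => u v _ _.
    have /memv_addP[s Ps [x Jx ->]] := subvP IHn u (memvf u).
    have /memv_addP[t Pt [y Jy ->]] := subvP IHn v (memvf v).
    rewrite linearDl !linearDr /= -addrA memv_add //.
      by apply: (subvP PP); apply: memv_prodj.
    by rewrite memvD ?memvD ?(powjM _ Jx) // cJ (powjM _ Jy).
  rewrite {1}Jfull; apply/span_subvP => x; rewrite in_cons => /orP[/eqP->|x2].
    by apply: (subvP (addvSl _ _)); apply: (Pmem 0%N).
  by apply: (subvP J2); apply: vbasis_mem.
have Pfull x : x \in <<P>>%VS.
  by have := subvP (cover N) x (memvf x); rewrite JN0 addv0.
move=> x y z; move: x (Pfull x); apply: span_ind.
- by move=> k u v; rewrite !linearPl => -> ->.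
- by rewrite !linear0l.
move=> _ /mapP[i _ ->]; move: y (Pfull y); apply: span_ind.
- by move=> k u v; rewrite linearPl !linearPr /= linearPl => -> ->.
- by rewrite !(linear0l, linear0r).
move=> _ /mapP[j _ ->]; move: z (Pfull z); apply: span_ind.
- by move=> k u v; rewrite !linearPr => -> ->.
- by rewrite !linear0r.
by move=> _ /mapP[k _ ->]; rewrite !jpow_mul addnS addSn addnA.
Qed.

Lemma class_nilpotent : \dim {: J} = 5%N -> ~ is_assoc J -> listable J.
Proof.
move=> dJ nA.
have J30 : powj J 3 != 0%VS.
  (* Both bracketings of a product of three elements lie in J^<3>. *)
  apply: contra_notN nA => /eqP J30 x y z.
  rewrite cJ (powj0_mul x J30) ?powj1M //.
  by rewrite (powj0_mul z J30) ?powj1M.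
have n0 k : \dim (powj J k.+1) != 0%N -> (\dim (powj J k.+2) < \dim (powj J k.+1))%N.
  by rewrite dimv_eq0; apply: powj_dim_lt.
have d3 : (0 < \dim (powj J 3))%N by rewrite lt0n dimv_eq0.
have d32 : (\dim (powj J 3) < \dim (powj J 2))%N.
  by apply: n0; rewrite -lt0n (leq_trans d3) ?dimvS ?powj_sub.
have d43 : (\dim (powj J 4) < \dim (powj J 3))%N by apply: n0; rewrite -lt0n.
have d25 : (\dim (powj J 2) < 5)%N by have := n0 0%N; rewrite -[powj J 1]/(fullv : {vspace J}) dJ; apply.
have z k : \dim (powj J k) = 0%N -> powj J k = 0%VS by move/eqP; rewrite dimv_eq0 => /eqP.
have [d4|d24] := eqVneq (\dim (powj J 2)) 4%N.
  by case: nA; apply: one_generator_assoc; rewrite dJ d4.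
case E2: (\dim (powj J 2)) d24 d25 d32 => [|[|[|[|[|?]]]]] // _ _ d32;
  case E3: (\dim (powj J 3)) d3 d32 d43 => [|[|[|?]]] // _ _;
  case E4: (\dim (powj J 4)) => [|[|?]] // _.
- exact: (shape_A two rootF dJ jJ E2 E3 (z _ E4) nA).
- exact: (shape_B two rootF dJ jJ E2 E3 (z _ E4) nA).
- exact: (shape_C1 two rootF dJ jJ E2 E3 (z _ E4)).
have E5 : powj J 5 = 0%VS.
  by apply: z; have := n0 3%N; rewrite E4 => /(_ isT); rewrite ltnS leqn0 => /eqP.
exact: (shape_C2 two rootF dJ jJ E2 E3 E4 E5 nA).
Qed.

End Nilpotent.
End Classification.

(** * Separation of the types *)

Section Types.

Variable F : fieldType.
Hypothesis two : 2 != 0 :> F.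

Implicit Types J K : algebra F.

(** [thin2], [thin3] and [nil4] say that dim J^<2> <= 2, dim J^<3> <= 1 and J^<4> = 0. Stated by
    products of elements, they are transported along isomorphisms and checked on tables without
    computing subspaces. *)
Definition thin2 J : Prop :=
  exists u v : J, forall x y, exists s t, mulj J x y = s *: u + t *: v.

Definition thin3 J : Prop :=
  exists u : J, forall x y z, exists s, mulj J (mulj J x y) z = s *: u.

Definition nil4 J : Prop :=
  forall x y z t, mulj J (mulj J (mulj J x y) z) t = 0.

Lemma thin2_iso J K : isomorphic J K -> thin2 J -> thin2 K.
Proof.
move=> [f [g fK gK] mf] [u [v uv]]; exists (f u), (f v) => x y.
have [s [t E]] := uv (g x) (g y); exists s, t.
by rewrite -(gK x) -(gK y) -mf E linearD !linearZ.
Qed.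

Lemma thin3_iso J K : isomorphic J K -> thin3 J -> thin3 K.
Proof.
move=> [f [g fK gK] mf] [u uv]; exists (f u) => x y z.
have [s E] := uv (g x) (g y) (g z); exists s.
by rewrite -(gK x) -(gK y) -(gK z) -!mf E linearZ.
Qed.

Lemma nil4_iso J K : isomorphic J K -> nil4 J -> nil4 K.
Proof.
move=> [f [g fK gK] mf] H x y z t.
by rewrite -(gK x) -(gK y) -(gK z) -(gK t) -!mf H linear0.
Qed.

Definition of_level (i : nat) J : Prop :=
  match i with
  | 0 => thin2 J /\ thin3 J /\ nil4 J
  | 1 => ~ thin2 J /\ thin3 J /\ nil4 J
  | 2 => ~ thin3 J /\ nil4 J
  | _ => ~ nil4 J
  end.

Lemma level_iso i j J K : (i < 4)%N -> (j < 4)%N -> isomorphic J K ->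
  of_level i J -> of_level j K -> i = j.
Proof.
move=> i4 j4 JK; have KJ := isomorphic_sym JK.
have := thin2_iso JK; have := thin2_iso KJ; have := thin3_iso JK; have := thin3_iso KJ.
have := nil4_iso JK; have := nil4_iso KJ.
case: i i4 => [|[|[|[|//]]]] _; case: j j4 => [|[|[|[|//]]]] _ //=.
all: tauto.
Qed.

(** Three products in the span of two vectors are dependent; this is the minor on the coordinates 2,
    3, 4. It refutes [thin2] on concrete tables. *)
Lemma thin2_det (s : stable F) x1 y1 x2 y2 x3 y3 : thin2 (talg s) ->
  let c i w := ev (nth C0 w i) in
  let w1 := vmul s x1 y1 in let w2 := vmul s x2 y2 in let w3 := vmul s x3 y3 in
  c 2%N w1 * (c 3%N w2 * c 4%N w3 - c 4%N w2 * c 3%N w3)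
  - c 3%N w1 * (c 2%N w2 * c 4%N w3 - c 4%N w2 * c 2%N w3)
  + c 4%N w1 * (c 2%N w2 * c 3%N w3 - c 3%N w2 * c 2%N w3) = 0.
Proof.
move=> [u [v uv]] c; have E x y : exists a b, forall i : 'I_5,
    c i (vmul s x y) = a * (u : 'rV_5) 0 i + b * (v : 'rV_5) 0 i.
  have [a [b ab]] := uv (vev x) (vev y); exists a, b => i.
  have := congr1 (fun w : 'rV[F]_5 => w 0 i) ab.
  by rewrite (mulj_talg s x y) !mxE.
have [a1 [b1 E1]] := E x1 y1; have [a2 [b2 E2]] := E x2 y2; have [a3 [b3 E3]] := E x3 y3.
move=> /=; rewrite !(E1 i2, E1 i3, E1 i4, E2 i2, E2 i3, E2 i4, E3 i2, E3 i3, E3 i4).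
by ring.
Qed.

Lemma thin3_det (s : stable F) x1 y1 z1 x2 y2 z2 : thin3 (talg s) ->
  let c i w := ev (nth C0 w i) in
  let w1 := vmul s (vmul s x1 y1) z1 in let w2 := vmul s (vmul s x2 y2) z2 in
  c 3%N w1 * c 4%N w2 - c 4%N w1 * c 3%N w2 = 0.
Proof.
move=> [u uv] c; have E x y z : exists a, forall i : 'I_5,
    c i (vmul s (vmul s x y) z) = a * (u : 'rV_5) 0 i.
  have [a ab] := uv (vev x) (vev y) (vev z); exists a => i.
  have := congr1 (fun w : 'rV[F]_5 => w 0 i) ab.
  by rewrite (mulj_talg s x y) (mulj_talg s (vmul s x y) z) !mxE.
have [a1 E1] := E x1 y1 z1; have [a2 E2] := E x2 y2 z2.
by move=> /=; rewrite !(E1 i3, E1 i4, E2 i3, E2 i4); ring.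
Qed.

Lemma thin2_talg (s : stable F) :
  (forall x0 x1 x2 x3 x4 y0 y1 y2 y3 y4,
    let w := vmul s [:: CE x0; CE x1; CE x2; CE x3; CE x4] [:: CE y0; CE y1; CE y2; CE y3; CE y4] in
    allp (veqs w [:: C0; C0; C0; nth C0 w 3%N; nth C0 w 4%N])) -> thin2 (talg s).
Proof.
move=> H; exists (vev [:: C0; C0; C0; C1]), (vev [:: C0; C0; C0; C0; C1]) => x y.
rewrite (vev_surj x) (vev_surj y) mulj_talg; set w := vmul _ _ _.
exists (ev (nth C0 w 3%N)), (ev (nth C0 w 4%N)).
rewrite -!vev_scale -vev_add (proj1 (veqsP _ _) (H _ _ _ _ _ _ _ _ _ _)).
rewrite -/w; apply/rowP=> i; rewrite !mxE nth_vadd !nth_vscale.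
by case: i => [[|[|[|[|[|?]]]]] ?] //=; rewrite ?mulr1 ?mulr0 ?addr0 ?add0r.
Qed.

Lemma thin3_talg (s : stable F) :
  (forall x0 x1 x2 x3 x4 y0 y1 y2 y3 y4 z0 z1 z2 z3 z4,
    let w := vmul s (vmul s [:: CE x0; CE x1; CE x2; CE x3; CE x4]
      [:: CE y0; CE y1; CE y2; CE y3; CE y4]) [:: CE z0; CE z1; CE z2; CE z3; CE z4] in
    allp (veqs w [:: C0; C0; C0; C0; nth C0 w 4%N])) -> thin3 (talg s).
Proof.
move=> H; exists (vev [:: C0; C0; C0; C0; C1]) => x y z.
rewrite (vev_surj x) (vev_surj y) (vev_surj z) !mulj_talg; set w := vmul _ _ _.
exists (ev (nth C0 w 4%N)).
rewrite -vev_scale (proj1 (veqsP _ _) (H _ _ _ _ _ _ _ _ _ _ _ _ _ _ _)).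
rewrite -/w; apply/rowP=> i; rewrite !mxE nth_vscale.
by case: i => [[|[|[|[|[|?]]]]] ?] //=; rewrite ?mulr1 ?mulr0.
Qed.

Lemma nil4_talg (s : stable F) :
  (forall x0 x1 x2 x3 x4 y0 y1 y2 y3 y4 z0 z1 z2 z3 z4 t0 t1 t2 t3 t4,
    allp (veqs (vmul s (vmul s (vmul s [:: CE x0; CE x1; CE x2; CE x3; CE x4]
      [:: CE y0; CE y1; CE y2; CE y3; CE y4]) [:: CE z0; CE z1; CE z2; CE z3; CE z4])
      [:: CE t0; CE t1; CE t2; CE t3; CE t4]) [::])) -> nil4 (talg s).
Proof.
move=> H x y z t.
rewrite (vev_surj x) (vev_surj y) (vev_surj z) (vev_surj t) !mulj_talg -vev_nil.
by apply/veqsP; apply: H.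
Qed.

Lemma level_TA q11 q12 q13 q22 q23 q33 r11 r12 r22 :
  of_level 0 (talg (TA (F := F) q11 q12 q13 q22 q23 q33 r11 r12 r22)).
Proof.
split; [|split]; unfold TA.
- by apply: thin2_talg; cbv zeta => *; sym; conjs ltac:(ring).
- by apply: thin3_talg; cbv zeta => *; sym; conjs ltac:(ring).
by apply: nil4_talg => *; sym; conjs ltac:(ring).
Qed.

Lemma level_TB1 (p q r s rho : F) : ~ [/\ p = 0, q = 0, r = 0 & s = 0] ->
  of_level 1 (talg (TB1 p q r s rho)).
Proof.
move=> nM; split; [|split]; unfold TB1; last first.
- by apply: nil4_talg => *; sym; conjs ltac:(ring).
- by apply: thin3_talg; cbv zeta => *; sym; conjs ltac:(ring).
move=> H.
have E1 := thin2_det [:: C1] [:: C1] [:: C1] [:: C0; C1] [:: C1] [:: C0; C0; C1] H; sym in E1.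
have E2 := thin2_det [:: C1] [:: C1] [:: C1] [:: C0; C1] [:: C1] [:: C0; C0; C0; C1] H; sym in E2.
have E3 := thin2_det [:: C1] [:: C1] [:: C1] [:: C0; C1] [:: C0; C1] [:: C0; C0; C1] H; sym in E3.
have E4 := thin2_det [:: C1] [:: C1] [:: C1] [:: C0; C1] [:: C0; C1] [:: C0; C0; C0; C1] H; sym in E4.
by apply: nM; split; [lc 1 E1 | lc 1 E2 | lc 1 E3 | lc 1 E4].
Qed.

Lemma level_TB2 (p q r s : F) : ~ [/\ p = 0, q = 0, r = 0 & s = 0] ->
  of_level 1 (talg (TB2 p q r s)).
Proof.
move=> nM; split; [|split]; unfold TB2; last first.
- by apply: nil4_talg => *; sym; conjs ltac:(ring).
- by apply: thin3_talg; cbv zeta => *; sym; conjs ltac:(ring).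
move=> H.
have E1 := thin2_det [:: C1] [:: C1] [:: C0; C1] [:: C0; C1] [:: C1] [:: C0; C0; C1] H; sym in E1.
have E2 := thin2_det [:: C1] [:: C1] [:: C0; C1] [:: C0; C1] [:: C1] [:: C0; C0; C0; C1] H; sym in E2.
have E3 := thin2_det [:: C1] [:: C1] [:: C0; C1] [:: C0; C1] [:: C0; C1] [:: C0; C0; C1] H; sym in E3.
have E4 := thin2_det [:: C1] [:: C1] [:: C0; C1] [:: C0; C1] [:: C0; C1] [:: C0; C0; C0; C1] H; sym in E4.
by apply: nM; split; [lc 1 E1 | lc 1 E2 | lc 1 E3 | lc 1 E4].
Qed.

Lemma level_TCx (p q : F) : of_level 2 (talg (TCx p q)).
Proof.
split; unfold TCx; last by apply: nil4_talg => *; sym; conjs ltac:(ring).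
move=> H; have E := thin3_det [:: C1] [:: C1] [:: C0; C1] [:: C1] [:: C1] [:: C1] H; sym in E.
by have /eqP := oner_neq0 F; apply; lc 1 E.
Qed.

Lemma level_TCy (p q : F) : of_level 2 (talg (TCy p q)).
Proof.
split; unfold TCy; last by apply: nil4_talg => *; sym; conjs ltac:(ring).
move=> H; have E := thin3_det [:: C1] [:: C0; C1] [:: C1] [:: C1] [:: C0; C1] [:: C0; C1] H; sym in E.
by have /eqP := oner_neq0 F; apply; lc 1 E.
Qed.

Lemma level_TC2 (be tau th : F) : of_level 3 (talg (TC2 be tau th)).
Proof.
unfold TC2 => H; have := H (vev [:: C1]) (vev [:: C1]) (vev [:: C1]) (vev [:: C1]).
rewrite !mulj_talg -vev_nil => /veqsP; sym => E.
by have /eqP := oner_neq0 F; apply.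
Qed.

End Types.

(** * Isomorphisms between the listed algebras, and an infinite family *)

Section Isomorphisms.

Variable F : fieldType.
Hypothesis two : 2 != 0 :> F.
Hypothesis rootF : forall n (x : F), (0 < n)%N -> exists y, y ^+ n = x.

Variant normal_form (l : name F) : nat -> Prop :=
| NFA p of parA l = Some p : normal_form l 0
| NFB1 t of nfB1 l t : normal_form l 1
| NFB2 t of nfB2 l t : normal_form l 1
| NFCx t of nfCx l t : normal_form l 2
| NFCy t of nfCy l t : normal_form l 2
| NFC2 t of nfC2 l t : normal_form l 3.

Lemma ex_normal_form l : exists i, normal_form l i.
Proof.
case: l;
  try by move=> *; first [exists 0%N; by eapply NFA; exact: erefl | exists 1%N; by eapply NFB1; exact: erefl
    | exists 1%N; by eapply NFB2; exact: erefl | exists 2%N; by eapply NFCx; exact: erefl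
    | exists 2%N; by eapply NFCy; exact: erefl | exists 3%N; by eapply NFC2; exact: erefl].
move=> al.
exists 1%N; have [->|al0] := eqVneq al 0; first by eapply NFB1; split; exact: erefl.
have [g g2] := rootF al (isT : (0 < 2)%N).
apply: (@NFB2 _ (1 + g, - (1 + g), 1 - g, - (1 - g))); exists g; split=> //.
by rewrite -sqrf_eq0 g2.
Qed.

Lemma normal_form_level l i : normal_form l i -> (i < 4)%N /\ of_level i (listed l).
Proof.
have iso_level j J K : (j < 4)%N -> isomorphic J K -> of_level (F := F) j J -> of_level j K.
  case: j => [|[|[|[|//]]]] _ JK /=; have KJ := isomorphic_sym JK.
  - case=> /(thin2_iso JK) ? [/(thin3_iso JK) ? /(nil4_iso JK) ?] //.
  - by case=> n2 [/(thin3_iso JK) ? /(nil4_iso JK) ?]; split=> // /(thin2_iso KJ).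
  - by case=> n3 /(nil4_iso JK) ?; split=> // /(thin3_iso KJ).
  by move=> n4 /(nil4_iso KJ).
case=> [p|t|t|t|t|t] lt; split=> //.
- apply: iso_level (listed_nfA lt) _ => //.
  by move: p lt => [[[[[[[[q11 q12] q13] q22] q23] q33] r11] r12] r22] _; apply: level_TA.
- apply: iso_level (listed_nfB1 lt) _ => //.
  by move: t lt => [[[[p q] r] s] rho] /nfB1_nonzero; apply: level_TB1.
- apply: iso_level (listed_nfB2 two lt) _ => //.
  by move: t lt => [[[p q] r] s] /(nfB2_nonzero two); apply: level_TB2.
- apply: iso_level (listed_nfCx lt) _ => //.
  by move: t lt => [p q] _; apply: level_TCx.
- apply: iso_level (listed_nfCy lt) _ => //.
  by move: t lt => [p q] _; apply: level_TCy.
apply: iso_level (listed_nfC2 lt) _ => //.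
by move: t lt => [[be tau] th] _; apply: level_TC2.
Qed.

Lemma iso_same_class (l m : name F) : admissible l -> admissible m ->
  isomorphic (listed l) (listed m) -> same_class l m.
Proof.
move=> al am lm; have ml := isomorphic_sym lm.
have [[i li] [j mj]] := (ex_normal_form l, ex_normal_form m).
have [[i4 Li] [j4 Mj]] := (normal_form_level li, normal_form_level mj).
have ij := level_iso i4 j4 lm Li Mj; subst j; clear Li Mj i4 j4.
have no12 (l1 l2 : name F) t1 t2 : nfB1 l1 t1 -> nfB2 l2 t2 -> ~ isomorphic (listed l1) (listed l2).
  move=> H1 H2 l12; have := isomorphic_trans (listed_nfB1 H1)
    (isomorphic_trans l12 (isomorphic_sym (listed_nfB2 two H2))).
  move: t1 t2 H1 H2 => [[[[p q] r] s] rho] [[[p' q'] r'] s'] /nfB1_nonzero nz _.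
  exact: TB1_TB2.
have noxy (l1 l2 : name F) t1 t2 : nfCx l1 t1 -> nfCy l2 t2 -> ~ isomorphic (listed l1) (listed l2).
  move=> H1 H2 l12; have := isomorphic_trans (listed_nfCx H1)
    (isomorphic_trans l12 (isomorphic_sym (listed_nfCy H2))).
  move: t1 t2 {H1 H2} => [p q] [p' q']; exact: (TCx_TCy two).
case: li mj => [p|t|t|t|t|t] lt mj; inversion mj as [p' mt|t' mt|t' mt|t' mt|t' mt|t' mt]; subst.
- have -> : l = m by apply: (nfA_same two lt mt).
  by case: m {lt mt mj am lm ml} => * //=; ring || by left.
- exact: (nfB1_same two lt mt).
- by case: (no12 _ _ _ _ lt mt lm).
- by case: (no12 _ _ _ _ mt lt ml).
- exact: (nfB2_same two lt mt).
- exact: (nfCx_same two lt mt).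
- by case: (noxy _ _ _ _ lt mt lm).
- by case: (noxy _ _ _ _ mt lt ml).
- exact: (nfCy_same two lt mt).
exact: (nfC2_same lt mt).
Qed.

Lemma same_class_iso (l m : name F) : same_class l m -> isomorphic (listed l) (listed m).
Proof.
have sq (x y : F) : x ^+ 2 - y ^+ 2 = 0 -> y = x \/ y = - x.
  move/eqP; rewrite subr_eq0 eqf_sqr => /orP[/eqP->|/eqP->]; first by left.
  by right; rewrite opprK.
have one0 := @oner_neq0 F; have mone0 : - 1 != 0 :> F by rewrite oppr_eq0.
have ref (l1 l2 : name F) : l1 = l2 -> isomorphic (listed l1) (listed (F := F) l2).
  by move=> ->; apply: isomorphic_refl.
case: l; case: m => //=; try (by move=> *; apply: ref).
- by rewrite notin_pchar3 => /M51_J522/isomorphic_sym.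
- move=> be al /sq[->|->]; first exact: isomorphic_refl.
  apply: isomorphic_trans (isomorphic_sym (listed_nfB1 (l := J5_23 al) erefl)) _.
  apply: isomorphic_trans _ (listed_nfB1 (l := J5_23 (- al)) erefl).
  apply: iso_relB1; exists (- 1), 0, 1, (- 1), 0, 0; split; first by split.
  by split; ring.
- move=> be al /sq[->|->]; first exact: isomorphic_refl.
  apply: isomorphic_trans (isomorphic_sym (listed_nfB2 two (l := J5_26 al) erefl)) _.
  apply: isomorphic_trans _ (listed_nfB2 two (l := J5_26 (- al)) erefl).
  apply: iso_relB2; exists (- 1), 1, (- 1); split; first by split.
  by split; ring.
- move=> al' be' al be [[-> ->]|[-> ->]]; first exact: isomorphic_refl.
  apply: isomorphic_trans (isomorphic_sym (listed_nfB2 two (l := J5_27 be' al') erefl)) _.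
  apply: isomorphic_trans _ (listed_nfB2 two (l := J5_27 al' be') erefl).
  exact: TB2_swap.
- by rewrite notin_pchar3 => /(M52_J533 two)/isomorphic_sym.
- move=> be al E; have [->|ab] := eqVneq al be; first exact: isomorphic_refl.
  (* The relation is (al - be)(al be - 1) = 0. For al = g^2 this gives be = (g^-1)^2, and the
     parameters for g and g^-1 differ by a scaling. *)
  have {E} E : al * be = 1.
    have ab0 : be - al != 0 by rewrite subr_eq0 eq_sym.
    by apply: (mulfI ab0); lc (- 1) E.
  have al0 : al != 0 by apply: contraTneq isT => al0; move/eqP: E; rewrite al0 mul0r eq_sym (negbTE one0).
  have [g g2] := rootF al (isT : (0 < 2)%N).
  have g0 : g != 0 by rewrite -sqrf_eq0 g2.
  have nal : nfB2 (J5_41 al) (1 + g, - (1 + g), 1 - g, - (1 - g)) by exists g.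
  have nbe : nfB2 (J5_41 be) (1 + g^-1, - (1 + g^-1), 1 - g^-1, - (1 - g^-1)).
    exists g^-1; split=> //; first by rewrite invr_eq0.
    by apply: (mulfI al0); rewrite E exprVn g2 divff.
  apply: isomorphic_trans (isomorphic_sym (listed_nfB2 two nal)) _.
  apply: isomorphic_trans _ (listed_nfB2 two nbe).
  apply: iso_relB2; exists 1, (- 1), g^-1; split; first by rewrite invr_eq0.
  by split; fielda.
- by rewrite notin_pchar3 => /M51_J522.
by rewrite notin_pchar3 => /(M52_J533 two).
Qed.

(** The family [J5_15] provides the infinitely many algebras: distinct parameters are never
    isomorphic. *)
Lemma J515_jordan (al : F) : is_jordan (listed (J5_15 al)).
Proof.
rewrite listedE; split; first exact: talg_comm.
move=> x y; rewrite (vev_surj x) (vev_surj y) !mulj_talg; apply: (proj1 (veqsP _ _)).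
by rewrite /stab; sym; conjs ltac:(ring).
Qed.

Lemma prodj_ind (J : algebra F) (U V : {vspace J}) (Q : J -> Prop) :
  (forall (k : F) u v, Q u -> Q v -> Q (k *: u + v)) -> Q 0 ->
  {in U & V, forall u v, Q (mulj J u v)} -> {in prodj U V, forall w, Q w}.
Proof.
move=> Qlin Q0 QUV w; apply: span_ind => // _ /allpairsP[[u v] /= [Uu Vv ->]].
by apply: QUV; apply: vbasis_mem.
Qed.

(** In the listed basis, J^<2>, J^<3>, J^<4> lie in the spans of b, c, e, then of c, e, then of e;
    each is recorded by the coordinates that vanish. *)
Lemma J515_nilpotent (al : F) : is_nilpotent (listed (J5_15 al)).
Proof.
rewrite listedE; set J := talg _; exists 5%N; apply/eqP; rewrite -subv0; apply/subvP => w Jw.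
have pM x y : mulj J x y = vev (vmul (stab (J5_15 al))
    [:: CE (x 0 i0); CE (x 0 i1); CE (x 0 i2); CE (x 0 i3); CE (x 0 i4)]
    [:: CE (y 0 i0); CE (y 0 i1); CE (y 0 i2); CE (y 0 i3); CE (y 0 i4)]).
  by rewrite -mulj_talg -!vev_surj.
have Q2 : {in powj J 2, forall w : J, (w : 'rV[F]_5) 0 i0 = 0 /\ (w : 'rV[F]_5) 0 i3 = 0}.
  apply: prodj_ind => [k u v [u0 u3] [v0 v3]||x y _ _]; rewrite ?mxE //.
    by rewrite u0 u3 v0 v3 mulr0 addr0.
  by rewrite pM !mxE /stab; sym; conjs ltac:(ring).
have Q3 : {in powj J 3, forall w : J,
    [/\ (w : 'rV[F]_5) 0 i0 = 0, (w : 'rV[F]_5) 0 i3 = 0 & (w : 'rV[F]_5) 0 i1 = 0]}.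
  apply: prodj_ind => [k u v [u0 u3 u1] [v0 v3 v1]||x y /Q2[x0 x3] _]; rewrite ?mxE //.
    by rewrite u0 u3 v0 v3 u1 v1 mulr0 addr0.
  by rewrite pM !mxE /stab; split; sym; rewrite ?x0 ?x3; ring.
have Q4 : {in powj J 4, forall w : J,
    [/\ (w : 'rV[F]_5) 0 i0 = 0, (w : 'rV[F]_5) 0 i3 = 0, (w : 'rV[F]_5) 0 i1 = 0
       & (w : 'rV[F]_5) 0 i2 = 0]}.
  apply: prodj_ind => [k u v [u0 u3 u1 u2] [v0 v3 v1 v2]||x y /Q3[x0 x3 x1] _]; rewrite ?mxE //.
    by rewrite u0 u3 v0 v3 u1 v1 u2 v2 mulr0 addr0.
  by rewrite pM !mxE /stab; split; sym; rewrite ?x0 ?x3 ?x1; ring.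
have Q5 : {in powj J 5, forall w : J, w = 0}.
  apply: prodj_ind => [k u v -> ->||x y /Q4[x0 x3 x1 x2] _] //; first by rewrite scaler0 addr0.
  rewrite pM -vev_nil; apply: (proj1 (veqsP _ _)).
  by rewrite /stab; sym; rewrite ?x0 ?x3 ?x1 ?x2; conjs ltac:(ring).
by rewrite (Q5 _ Jw) mem0v.
Qed.

End Isomorphisms.

(** * Roots and infinity of an algebraically closed field; the theorem *)

Lemma closed_root (F : closedFieldType) n (x : F) : (0 < n)%N -> exists y, y ^+ n = x.
Proof.
move=> n0; have [y yn] := solve_monicpoly (fun i => if i is 0 then x else 0) n0.
exists y; rewrite yn; case: n n0 {yn} => // n _.
by rewrite big_ord_recl mulr1 big1 ?addr0 // => i _; rewrite mul0r.
Qed.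

(** The polynomial with roots in a finite list is nonzero, so it has a non-root, which lies outside
    the list; choosing such an element again and again gives the injection. *)
Lemma ex_injection (F : closedFieldType) : exists f : nat -> F, injective f.
Proof.
have next (s : seq F) : exists x, x \notin s.
  have /closed_nonrootP[x] : \prod_(y <- s) ('X - y%:P) != 0 :> {poly F}.
    by rewrite monic_neq0 // monic_prod_XsubC.
  by rewrite root_prod_XsubC => xs; exists x.
pose L n := iter n (fun s => xchoose (next s) :: s) [::].
pose f n := xchoose (next (L n)).
have fL m n : (m < n)%N -> f m \in L n.
  elim: n => // n IHn; rewrite ltnS leq_eqVlt inE => /orP[/eqP->|/IHn->]; first by rewrite eqxx.
  by rewrite orbT.
exists f => m n fmn; case: (ltngtP m n) => // /fL.
  by rewrite fmn (negbTE (xchooseP (next (L n)))).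
by rewrite -fmn (negbTE (xchooseP (next (L m)))).
Qed.

Theorem theorem7p3 (F : closedFieldType) (hF : 2%N \notin [pchar F]) :
  (exists A : nat -> algebra F,
     (forall n, [/\ \dim {: A n} = 5%N, is_jordan (A n) & is_nilpotent (A n)])
     /\ (forall m n, m <> n -> ~ isomorphic (A m) (A n))) /\
  (forall J : algebra F,
     \dim {: J} = 5%N -> is_jordan J -> is_nilpotent J -> ~ is_assoc J ->
     exists l : name F, admissible l /\ isomorphic J (listed l)) /\
  (forall l m : name F, admissible l -> admissible m ->
     isomorphic (listed l) (listed m) <-> same_class l m).
Proof.
have two : 2 != 0 :> F by move: hF; rewrite inE.
have rootF := @closed_root F.
split; [|split].
- have [f inj_f] := ex_injection F; exists (fun n => listed (J5_15 (f n))); split.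
    move=> n; split; [|exact: J515_jordan | exact: J515_nilpotent].
    by rewrite dimvf.
  move=> m n mn /(iso_same_class two rootF) => /(_ I I) [] /inj_f.
  exact: mn.
- move=> J dJ jJ [[|N] JN] nA; last exact: (class_nilpotent two rootF jJ JN dJ nA).
  (* Nilpotency witnessed at n = 0: [powj J 0] is J itself, which is nonzero in dimension 5. *)
  by have E : fullv = 0%VS :> {vspace J} := JN; move: dJ; rewrite E dimv0.
move=> l m al am; split; first exact: iso_same_class.
exact: same_class_iso.
Qed.
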